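(* Let $M$ be the Markov-modulated Ornstein-Uhlenbeck process $$M(t)=m_0+\int_0^t(\alpha_{X(s)}-\gamma_{X(s)}M(s))\,\mathrm ds+\int_0^t\sigma_{X(s)}\,\mathrm dB(s),\qquad t\ge0,$$ with $m_0\in\mathbb R$. Let $\boldsymbol\nu_t:=\mathbb E[\boldsymbol Z(t)M(t)]$ and $\boldsymbol w_t:=\mathbb E[\boldsymbol Z(t)M(t)^2]$. Then for all $t\ge0$ $$\boldsymbol\nu_t=e^{\bar Q_{\boldsymbol\gamma}t}\boldsymbol\nu_0+\int_0^te^{\bar Q_{\boldsymbol\gamma}(t-s)}\mathrm{diag}\{\boldsymbol\alpha\}\boldsymbol p_s\,\mathrm ds,\qquad \boldsymbol\nu_0=m_0\boldsymbol p_0,$$ $$\boldsymbol w_t=e^{\bar Q_{2\boldsymbol\gamma}t}\boldsymbol w_0+\int_0^te^{\bar Q_{2\boldsymbol\gamma}(t-s)}\left(2\,\mathrm{diag}\{\boldsymbol\alpha\}\boldsymbol\nu_s+\mathrm{diag}\{\boldsymbol\sigma^2\}\boldsymbol p_s\right)\mathrm ds,\qquad \boldsymbol w_0=m_0^2\boldsymbol p_0,$$ and the mean and variance of $M(t)$ are $\mu_t:=\mathbb EM(t)=\mathbf 1^{\rm T}\boldsymbol\nu_t$ and $v_t:=\mathrm{Var}\,M(t)=\mathbf 1^{\rm T}\boldsymbol w_t-\mu_t^2$. If $\boldsymbol p_0=\boldsymbol\pi$, then $\boldsymbol\nu_t=e^{\bar Q_{\boldsymbol\gamma}t}\boldsymbol\nu_0-\bar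 Q_{\boldsymbol\gamma}^{-1}(I-e^{\bar Q_{\boldsymbol\gamma}t})\mathrm{diag}\{\boldsymbol\alpha\}\boldsymbol\pi$. Moreover, as $t\to\infty$, $\boldsymbol\nu_t$, $\boldsymbol w_t$, $\mu_t$, $v_t$ converge respectively to $$\boldsymbol\nu_\infty=-\bar Q_{\boldsymbol\gamma}^{-1}\mathrm{diag}\{\boldsymbol\alpha\}\boldsymbol\pi,\qquad \boldsymbol w_\infty=-\bar Q_{2\boldsymbol\gamma}^{-1}\left(2\,\mathrm{diag}\{\boldsymbol\alpha\}\boldsymbol\nu_\infty+\mathrm{diag}\{\boldsymbol\sigma^2\}\boldsymbol\pi\right),$$ $\mu_\infty=\mathbf 1^{\rm T}\boldsymbol\nu_\infty$ and $v_\infty=\mathbf 1^{\rm T}\boldsymbol w_\infty-\mu_\infty^2$.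
   Context: $X$ is a continuous-time Markov chain on $\{1,\dots,d\}$ with generator $Q$ and unique invariant distribution $\boldsymbol\pi$ (column vector); $B$ is a standard Brownian motion independent of $X$; $\alpha_i\in\mathbb R$, $\gamma_i>0$, $\sigma_i\in\mathbb R$ are collected in vectors $\boldsymbol\alpha,\boldsymbol\gamma,\boldsymbol\sigma$, and $\boldsymbol\sigma^2:=(\sigma_1^2,\dots,\sigma_d^2)^{\rm T}$. $\boldsymbol Z(t)\in\{0,1\}^d$ is the indicator vector of $X(t)$ ($Z_i(t)=1$ if $X(t)=i$, else $0$), and $\boldsymbol p_t:=\mathbb E\boldsymbol Z(t)$ is the vector of transient probabilities of $X$. For a vector $\boldsymbol\delta\in\mathbb R^d$, $\bar Q_{\boldsymbol\delta}:=Q^{\rm T}-\mathrm{diag}\{\boldsymbol\delta\}$. $\mathbf 1$ is the all-ones vector and $I$ the identity matrix. *)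

(* Defs.v *)
From HB Require Import structures.
From mathcomp Require Import all_boot all_order all_algebra.
From mathcomp Require Import all_classical all_reals all_analysis.

Set Implicit Arguments.
Unset Strict Implicit.
Unset Printing Implicit Defensive.

Import Order.TTheory GRing.Theory Num.Theory.
Import numFieldNormedType.Exports.

Local Open Scope classical_set_scope.
Local Open Scope ring_scope.

Section Matrices.
Context {R : realType} {d : nat}.
Implicit Types (Q A : 'M[R]_d) (v : 'cV[R]_d).

Definition mexp A : 'M[R]_d := limn (series (fun k => (k`!%:R)^-1 *: A ^+ k)).

Definition diagc v : 'M[R]_d := diag_mx v^T.

Definition Qbar Q v : 'M[R]_d := Q^T - diagc v.

(* the scalar 1^T v *)
Definition ones_dot v : R := ((const_mx 1 : 'cV[R]_d)^T *m v) 0 0.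

Definition is_generator Q :=
  (forall i j, i != j -> 0 <= Q i j) /\ (forall i, \sum_j Q i j = 0).

Definition is_invariant Q v :=
  [/\ forall i, 0 <= v i 0, ones_dot v = 1 & Q^T *m v = 0].

Definition is_unique_invariant Q v :=
  is_invariant Q v /\ (forall v', is_invariant Q v' -> v' = v).

(* entrywise integral over [0, t] *)
Definition vint (t : R) (f : R -> 'cV[R]_d) : 'cV[R]_d :=
  \col_i \int[lebesgue_measure]_(s in `[0, t]) f s i 0.

End Matrices.

(* Processes are families Y : R -> Omega -> S of which only the times t >= 0
   matter. *)
Section Processes.
Context {disp : measure_display} {Omega : measurableType disp} {R : realType}.
Variable P : probability Omega R.

(* sigma(Y_s, s in D) is <<s gen mS Y D >>, with mS the sigma-algebra on S *)
Definition gen {S : Type} (mS : set (set S)) (Y : R -> Omega -> S)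
    (D : set R) : set (set Omega) :=
  \bigcup_(s in D) preimage_set_system setT (Y s) mS.

Definition indep_events (F G : set (set Omega)) :=
  forall A B, F A -> G B -> P (A `&` B) = (P A * P B)%E.

Definition is_brownian (B : R -> Omega -> R) :=
  [/\ forall t, 0 <= t -> measurable_fun setT (B t),
      {ae P, forall w, B 0 w = 0},
      (forall s t, 0 <= s -> s <= t ->
        indep_events (preimage_set_system setT (B t \- B s) measurable)
                     <<s gen measurable B `[0, s] >>),
      (forall s t, 0 <= s -> s < t -> forall U : set R, measurable U ->
        P ((B t \- B s) @^-1` U) = normal_prob 0 (Num.sqrt (t - s)) U) &
      {ae P, forall w, {within `[0, +oo[, continuous (B ^~ w)}}].

(* X is a Markov chain with transition semigroup exp(tQ) and, almost surely,
   right-continuous paths with left limits in the discrete space 'I_d; the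
   Markov property is the usual conditional one, multiplied out to avoid
   conditioning on null events. *)
Definition is_markov_chain {d : nat} (Q : 'M[R]_d) (X : R -> Omega -> 'I_d) :=
  [/\ is_generator Q,
      (forall t, 0 <= t -> forall i, measurable (X t @^-1` [set i])),
      (forall (n : nat) (t : nat -> R) (i : nat -> 'I_d), 0 <= t 0%N ->
        (forall k, (k <= n)%N -> t k < t k.+1) ->
        P (\bigcap_(k in `I_n.+2) X (t k) @^-1` [set i k]) =
        (P (\bigcap_(k in `I_n.+1) X (t k) @^-1` [set i k]) *
         (mexp ((t n.+1 - t n) *: Q) (i n) (i n.+1))%:E)%E) &
      {ae P, forall w,
        (forall t, 0 <= t -> \forall s \near t^'+, X s w = X t w) /\
        (forall t, 0 < t -> exists i, \forall s \near t^'-, X s w = i)}].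

Definition independent_of {d : nat} (X : R -> Omega -> 'I_d)
    (B : R -> Omega -> R) :=
  indep_events <<s gen setT X `[0, +oo[ >> <<s gen measurable B `[0, +oo[ >>.

Definition history {d : nat} (X : R -> Omega -> 'I_d) (B : R -> Omega -> R)
    (t : R) : set (set Omega) :=
  <<s gen setT X `[0, t] `|` gen measurable B `[0, t] >>.

(* The process sum_(k < n) c_k 1_[tau_k, tau_(k+1)[ on [0, t], adapted to F. *)
Record simple_process (F : R -> set (set Omega)) (t : R) := SimpleProcess {
  sp_size : nat;
  sp_time : nat -> R;
  sp_coef : nat -> Omega -> R;
  sp_time0 : sp_time 0%N = 0;
  sp_timeT : sp_time sp_size = t;
  sp_incr : forall k, (k < sp_size)%N -> sp_time k <= sp_time k.+1;
  sp_meas : forall k, (k < sp_size)%N ->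
    forall U : set R, measurable U -> F (sp_time k) (sp_coef k @^-1` U);
  sp_bound : forall k, (k < sp_size)%N ->
    exists C : R, forall w, `|sp_coef k w| <= C }.

Definition sp_val F t (phi : simple_process F t) (s : R) (w : Omega) : R :=
  \sum_(k < sp_size phi)
    sp_coef phi k w * \1_(`[sp_time phi k, sp_time phi k.+1[) s.

Definition sp_int F t (phi : simple_process F t) (B : R -> Omega -> R)
    (w : Omega) : R :=
  \sum_(k < sp_size phi)
    sp_coef phi k w * (B (sp_time phi k.+1) w - B (sp_time phi k) w).

(* J is (a version of) the Ito integral of H over [0, t] against B: the L^2
   limit of the integrals of F-adapted simple processes which converge to H in
   L^2([0, t] x Omega). *)
Definition is_ito_integral (F : R -> set (set Omega)) (B H : R -> Omega -> R)
    (t : R) (J : Omega -> R) :=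
  measurable_fun setT J /\
  exists phi : nat -> simple_process F t,
    ((\int[lebesgue_measure]_(s in `[0%R, t])
        'E_P[fun w => ((sp_val (phi n) s w - H s w) ^+ 2)%R])%E
       @[n --> \oo] --> 0%E) /\
    ('E_P[fun w => ((sp_int (phi n) B w - J w) ^+ 2)%R]%E
       @[n --> \oo] --> 0%E).

Definition is_MMOU {d : nat} (alpha gamma sigma : 'cV[R]_d) (m0 : R)
    (X : R -> Omega -> 'I_d) (B M : R -> Omega -> R) :=
  [/\ forall t, 0 <= t -> measurable_fun setT (M t),
      {ae P, forall w, {within `[0, +oo[, continuous (M ^~ w)}} &
      forall t, 0 <= t -> exists J : Omega -> R,
        is_ito_integral (history X B) B (fun s w => sigma (X s w) 0) t J /\
        {ae P, forall w, M t w = m0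
          + \int[lebesgue_measure]_(s in `[0, t])
              (alpha (X s w) 0 - gamma (X s w) 0 * M s w)
          + J w}].

Definition Zind {d : nat} (X : R -> Omega -> 'I_d) (t : R) (w : Omega) :
  'cV[R]_d := \col_i (X t w == i)%:R.

Definition vexpect {d : nat} (Y : Omega -> 'cV[R]_d) : 'cV[R]_d :=
  \col_i fine 'E_P[fun w => (Y w i 0)%R]%E.

Definition transient {d : nat} (X : R -> Omega -> 'I_d) (t : R) : 'cV[R]_d :=
  vexpect (Zind X t).

Definition nu {d : nat} (X : R -> Omega -> 'I_d) (M : R -> Omega -> R)
  (t : R) : 'cV[R]_d := vexpect (fun w => M t w *: Zind X t w).

Definition wvec {d : nat} (X : R -> Omega -> 'I_d) (M : R -> Omega -> R)
  (t : R) : 'cV[R]_d := vexpect (fun w => M t w ^+ 2 *: Zind X t w).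

End Processes.

Section Limits.
Context {R : realType} {d : nat}.
Implicit Types (Q : 'M[R]_d) (alpha gamma sigma pi : 'cV[R]_d).

Definition sqvec (v : 'cV[R]_d) : 'cV[R]_d := \col_i (v i 0 ^+ 2).

Definition nu_lim Q alpha gamma pi : 'cV[R]_d :=
  - (invmx (Qbar Q gamma) *m (diagc alpha *m pi)).

Definition w_lim Q alpha gamma sigma pi : 'cV[R]_d :=
  - (invmx (Qbar Q (2 *: gamma)) *m
      (2 *: (diagc alpha *m nu_lim Q alpha gamma pi)
       + diagc (sqvec sigma) *m pi)).

End Limits.

(* Main.v *)
Require Import Defs.
From mathcomp Require Import all_boot all_order all_algebra.
From mathcomp Require Import all_classical all_reals all_analysis.
From mathcomp Require Import measurable_realfun ring lra.
Import Order.TTheory GRing.Theory Num.Theory.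
Import numFieldNormedType.Exports.
Set Implicit Arguments.
Unset Strict Implicit.
Unset Printing Implicit Defensive.
Local Open Scope classical_set_scope.
Local Open Scope ring_scope.

(* The moments of M are obtained without Ito calculus, as limits of those of a
   discrete scheme.  On the grid k h, with increments D_k of B over
   [k h, (k+1) h], let
     N_(k+1) = (1 - h gamma_x) N_k + h alpha_x + sigma_x D_k,
   where x is the state of X at (k+1) h.  By the Ito isometry and a discrete
   Gronwall lemma applied path by path, N at the last step of the grid of mesh
   T / 2^k converges almost surely to M(T).  Since D_k is independent of X and
   of the past of B, the vectors E[Z N] and E[Z N^2] satisfy exact linear
   recursions, whose limit is the linear system of differential equations
   solved by nu and w; a bound on E[N^4], uniform in the grid, lets the
   expectations converge.  Duhamel's formula is then the claim for finite t.
   As t -> oo, the exponential of Qbar decays because Qbar is a Metzler matrix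
   whose column sums are at most - min gamma, while p_t -> pi because
   Q^T p_t -> 0 and pi is the only invariant law. *)

(** * Matrix exponentials and linear differential equations *)

(** Three choices shape the argument. The coefficients of M depend on the chain only, so the
    increments of [B] are tested against a past that contains the whole trajectory of [X]
    ([pastgen]), which is larger than the [history] to which the Ito integral is adapted.
    Coefficients may then be frozen at the right end of a cell, and this keeps the recursion of the
    moments closed: the transition matrix acts first, diagonal matrices after it. The triple (p, nu,
    w) obeys a single linear recursion in dimension 3d, so one limit theorem for matrix powers
    ([euler_mexp]) produces both differential equations at once. The grids are dyadic because the
    squared error is, in mean, of the order of the mesh: along meshes T / 2^k it is summable. For t
    -> oo, uniqueness of the invariant law is the only information on the chain, with no spectral
    gap at hand. That Q^T p_t tends to 0 comes from writing e^{tA} as a limit of binomial mixtures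
    of powers of a substochastic matrix: a binomial law of variance v changes by O(v^(-1/2)) under a
    unit shift, whence a decay like t^(-1/2). *)

Section MatrixL1.
Context {R : realType}.

(** The sum of the entries is preferred to their maximum because it is submultiplicative ([mx_l1M]),
    for rectangular factors too, with no dimensional constant. *)
Definition mx_l1 m n (A : 'M[R]_(m, n)) : R := \sum_i \sum_j `|A i j|.

Lemma mx_l1_ge0 m n (A : 'M[R]_(m, n)) : 0 <= mx_l1 A.
Proof. by apply: sumr_ge0 => i _; apply: sumr_ge0. Qed.

Lemma mx_l1_entry m n (A : 'M[R]_(m, n)) i j : `|A i j| <= mx_l1 A.
Proof.
rewrite /mx_l1 (bigD1 i)//= (bigD1 j)//= -addrA lerDl addr_ge0//.
  exact: sumr_ge0.
by apply: sumr_ge0 => k _; exact: sumr_ge0.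
Qed.

Lemma mx_l1D m n (A B : 'M[R]_(m, n)) : mx_l1 (A + B) <= mx_l1 A + mx_l1 B.
Proof.
rewrite /mx_l1 -big_split/= ler_sum// => i _.
by rewrite -big_split/= ler_sum// => j _; rewrite mxE ler_normD.
Qed.

Lemma mx_l1Z m n (a : R) (A : 'M[R]_(m, n)) : mx_l1 (a *: A) = `|a| * mx_l1 A.
Proof.
rewrite /mx_l1 mulr_sumr; apply: eq_bigr => i _.
by rewrite mulr_sumr; apply: eq_bigr => j _; rewrite mxE normrM.
Qed.

Lemma mx_l1M m n p (A : 'M[R]_(m, n)) (B : 'M[R]_(n, p)) :
  mx_l1 (A *m B) <= mx_l1 A * mx_l1 B.
Proof.
rewrite /mx_l1 mulr_suml ler_sum// => i _.
apply: (@le_trans _ _ (\sum_k \sum_j `|A i j| * `|B j k|)).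
  apply: ler_sum => k _; rewrite mxE (le_trans (ler_norm_sum _ _ _))//.
  by apply: ler_sum => j _; rewrite normrM.
rewrite exchange_big/= mulr_suml ler_sum// => j _.
rewrite -mulr_sumr ler_wpM2l//.
rewrite [leRHS](bigD1 j)//= lerDl.
by apply: sumr_ge0 => k _; exact: sumr_ge0.
Qed.

Lemma mx_l1_eq0 m n (A : 'M[R]_(m, n)) : mx_l1 A <= 0 -> A = 0.
Proof.
move=> A0; apply/matrixP => i j; rewrite mxE; apply/eqP.
by rewrite -normr_le0 (le_trans (mx_l1_entry A i j)).
Qed.

(** Stated for entries because [mx_l1] of the identity is [d], so the bound on the whole norm would
    already fail at [k = 0]. *)
Lemma mx_l1_exp d (A : 'M[R]_d) k i j : `|(A ^+ k) i j| <= mx_l1 A ^+ k.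
Proof.
elim: k i j => [|k IH] i j.
  by rewrite !expr0 mxE; case: (i == j); rewrite ?normr1// normr0.
rewrite !exprS -[_ * _]/(_ *m _) mxE (le_trans (ler_norm_sum _ _ _))//.
apply: (@le_trans _ _ (\sum_l `|A i l| * mx_l1 A ^+ k)).
  by apply: ler_sum => l _; rewrite normrM ler_wpM2l.
rewrite -mulr_suml ler_wpM2r ?exprn_ge0 ?mx_l1_ge0//.
rewrite [leRHS](bigD1 i)//= lerDl.
by apply: sumr_ge0 => ? _; exact: sumr_ge0.
Qed.

End MatrixL1.

Section MatrixCvg.
Context {R : realType}.

Lemma cvg_mxP {T : Type} (F : set_system T) {FF : Filter F} m n
    (f : T -> 'M[R]_(m, n)) (A : 'M[R]_(m, n)) :
  f x @[x --> F] --> A <-> (forall i j, f x i j @[x --> F] --> A i j).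
Proof.
split=> [fA i j|fA].
  exact: (cvg_comp f (fun B : 'M[R]_(m, n) => B i j) fA (@coord_continuous _ _ _ i j A)).
apply/cvgrPdist_lt => e e0.
have : \forall x \near F, forall ij : 'I_m * 'I_n, `|A ij.1 ij.2 - f x ij.1 ij.2| < e.
  apply: filter_forall => -[i j]/=.
  by have /cvgrPdist_lt := fA i j; apply.
apply: filterS => x xe.
rewrite /Num.norm/= mx_normrE; apply/bigmax_ltP; split=> // ij _.
by rewrite !mxE.
Qed.

Lemma cvg_mx_l1 {T : Type} (F : set_system T) {FF : Filter F} m n
    (f : T -> 'M[R]_(m, n)) (A : 'M[R]_(m, n)) :
  f x @[x --> F] --> A <-> mx_l1 (f x - A) @[x --> F] --> 0.
Proof.
rewrite cvg_mxP; split=> [fA|fA i j].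
  rewrite /mx_l1 -[X in _ --> X](_ : \sum_(i < m) \sum_(j < n) 0 = 0); last first.
    by rewrite big1// => i _; rewrite big1.
  apply: cvg_big => [|i _]; first exact: add_continuous.
  apply: cvg_big => [|j _]; first exact: add_continuous.
  apply/norm_cvg0P; under eq_cvg do rewrite !mxE.
  by apply/subr_cvg0; exact: fA.
apply/subr_cvg0/norm_cvg0P.
apply: (@squeeze_cvgr _ _ _ _ (cst 0) (fun x => mx_l1 (f x - A))) => //; last exact: cvg_cst.
near=> x; rewrite normr_ge0/=.
by have := mx_l1_entry (f x - A) i j; rewrite !mxE.
Unshelve. all: by end_near. Qed.

End MatrixCvg.

(** * The matrix exponential as a power series in time *)

Section MexpEntries.
Context {R : realType} {d : nat}.
Implicit Types A C : 'M[R]_d.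

(** Coefficients of an entry of [mexp (t *: A) *m C] as a scalar power series in [t]. Carrying the
    factor [C] makes the family stable under differentiation, which replaces [C] by [A *m C]. *)
Let coef A m (C : 'M[R]_(d, m)) i j k := (k`!%:R)^-1 * (A ^+ k *m C) i j.

Let coef_cvg A m (C : 'M[R]_(d, m)) i j t : cvgn (pseries (coef A C i j) t).
Proof.
apply: normed_cvg; apply: (@series_le_cvg _ _
    (mx_l1 C \*: exp_coeff (mx_l1 A * `|t|))) => [n|n|n|].
- by rewrite normr_ge0.
- by rewrite /= mulr_ge0 ?mx_l1_ge0// exp_coeff_ge0// mulr_ge0// mx_l1_ge0.
- rewrite /exp_coeff/= /coef !normrM normrX ger0_norm ?invr_ge0// exprMn.
  rewrite -mulrA mulrC [X in _ <= X]mulrA ler_wpM2r ?invr_ge0//.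
  rewrite mulrA ler_wpM2r ?exprn_ge0//.
  rewrite mxE (le_trans (ler_norm_sum _ _ _))//.
  apply: (@le_trans _ _ (\sum_l mx_l1 A ^+ n * `|C l j|)).
    by apply: ler_sum => l _; rewrite normrM ler_wpM2r// mx_l1_exp.
  rewrite -mulr_sumr mulrC ler_wpM2r ?exprn_ge0 ?mx_l1_ge0//.
  rewrite /mx_l1; apply: ler_sum => l _.
  by rewrite (bigD1 j)//= lerDl sumr_ge0.
- by apply: is_cvg_seriesZ; exact: is_cvg_series_exp_coeff.
Qed.

Lemma mexp_cvg A : series (fun k => (k`!%:R)^-1 *: A ^+ k) @ \oo --> mexp A.
Proof.
suff: series (fun k => (k`!%:R)^-1 *: A ^+ k) @ \oo -->
   (\matrix_(i, j) limn (pseries (coef A 1%:M i j) 1) : 'M[R]_d).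
  by move=> /[dup] /cvg_lim; rewrite /mexp => ->.
apply/cvg_mxP => k l; rewrite mxE.
have -> : (fun x : nat => series (fun k0 : nat => (k0`!%:R)^-1 *: A ^+ k0) x k l)
   = pseries (coef A 1%:M k l) 1.
  apply/funext => n; rewrite /pseries /series/= summxE; apply: eq_bigr => m _.
  by rewrite /coef mulmx1 mxE expr1n mulr1.
exact: coef_cvg.
Qed.

Let mexp_mulE A m (C : 'M[R]_(d, m)) i j t :
  limn (pseries (coef A C i j) t) = (mexp (t *: A) *m C) i j.
Proof.
apply: cvg_lim => //.
have -> : pseries (coef A C i j) t = (fun n =>
   (series (fun k => (k`!%:R)^-1 *: (t *: A) ^+ k) n *m C) i j).
  apply/funext => n; rewrite /pseries /series/= mulmx_suml summxE.
  apply: eq_bigr => k _.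
  rewrite /coef (_ : (t *: A) ^+ k = t ^+ k *: A ^+ k).
    by rewrite -!scalemxAl [RHS]mxE [X in _ = _ * X]mxE; ring.
  elim: k => [|k IH]; first by rewrite !expr0 scale1r.
  by rewrite exprS IH -[(t *: A) * _]/(_ *m _) -scalemxAl -scalemxAr scalerA [t ^+ k.+1]exprS [A ^+ k.+1]exprS.
rewrite [X in _ --> X]mxE; under eq_cvg do rewrite mxE.
apply: cvg_big => [|l _]; first exact: add_continuous.
apply: cvgM; last exact: cvg_cst.
by move/cvg_mxP : (@mexp_cvg (t *: A)); apply.
Qed.

(** Termwise differentiation of a series that converges everywhere: since (k+1) / (k+1)! = 1 / k!,
    the shifted coefficients for [C] are the coefficients for [A *m C]. *)
Lemma is_derive_mexp_mul A m (C : 'M[R]_(d, m)) i j (t : R) :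
  is_derive t (1 : R) (fun t => (mexp (t *: A) *m C) i j)
    ((mexp (t *: A) *m (A *m C)) i j).
Proof.
rewrite -(mexp_mulE A (A *m C)).
have dE (D : 'M[R]_(d, m)) : pseries_diffs (coef A D i j) = coef A (A *m D) i j.
  apply/funext => k; rewrite /pseries_diffs /coef mulmxA -[A ^+ k *m A]/(A ^+ k * A).
  rewrite -exprSr mulrA; congr (_ * _).
  by rewrite factS natrM invfM mulrA mulfV ?mul1r.
rewrite -dE (_ : (fun _ => _) = (fun t => limn (pseries (coef A C i j) t))).
  apply: (@pseries_snd_diffs _ _ (`|t| + 1)); rewrite ?dE; try exact: coef_cvg.
  by rewrite [ltRHS]ger0_norm ?addr_ge0// ltrDl.
by apply/funext => s; rewrite mexp_mulE.
Qed.

Lemma mexp_comm A C : C *m A = A *m C -> C *m mexp A = mexp A *m C.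
Proof.
move=> CA; apply/matrixP => i j; rewrite -[A in RHS]scale1r -mexp_mulE.
apply/esym/cvg_lim => //.
have -> : pseries (coef A C i j) 1 = (fun n =>
   (C *m series (fun k => (k`!%:R)^-1 *: A ^+ k) n) i j).
  apply/funext => n; rewrite /pseries /series/= mulmx_sumr summxE.
  apply: eq_bigr => k _; rewrite /coef expr1n mulr1 -scalemxAr [RHS]mxE.
  congr (_ * _); congr (fun_of_matrix _ i j).
  elim: k => [|k IH]; first by rewrite !expr0 mul1mx mulmx1.
  by rewrite exprS -![A * _]/(A *m _) mulmxA CA -mulmxA IH mulmxA.
rewrite [X in _ --> X]mxE; under eq_cvg do rewrite mxE.
apply: cvg_big => [|l _]; first exact: add_continuous.
apply: cvgM; first exact: cvg_cst.
by move/cvg_mxP : (@mexp_cvg A); apply.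
Qed.

Lemma mexp_tr A : mexp A^T = (mexp A)^T.
Proof.
apply: cvg_lim => //; apply/cvg_mxP => i j; rewrite mxE.
have -> : (fun n => series (fun k : nat => k`!%:R^-1 *: (A^T) ^+ k) n i j) =
  (fun n => series (fun k => (k`!%:R)^-1 *: A ^+ k) n j i).
  apply/funext => n; rewrite /series/= !summxE; apply: eq_bigr => k _.
  rewrite !mxE; congr (_ * _); elim: k i j => [|k IH] i j.
    by rewrite !expr0 !mxE eq_sym.
  rewrite exprS exprSr -![_ * _]/(_ *m _) !mxE; apply: eq_bigr => l _.
  by rewrite IH mxE mulrC.
by move/cvg_mxP : (@mexp_cvg A); apply.
Qed.

Lemma mexp0 : mexp (0 : 'M[R]_d) = 1%:M.
Proof.
apply: cvg_lim => //; apply: cvg_near_cst; near=> n.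
have n0 : (0 < n)%N by near: n; exists 1%N.
rewrite -(prednK n0) /series/= big_nat_recl// big1 => [|k _].
  by rewrite addr0 expr0 fact0 invr1 scale1r.
by rewrite exprS mul0r scaler0.
Unshelve. all: by end_near. Qed.

End MexpEntries.

Section MatrixDerivative.
Context {R : realType}.

(** Entrywise, so that every rule of calculus below reduces to its scalar version. *)
Definition mx_derive m n (F : R -> 'M[R]_(m, n)) t (F' : 'M[R]_(m, n)) :=
  forall i j, is_derive t (1 : R) (fun s => F s i j) (F' i j).

Lemma mx_derive_cst m n (C : 'M[R]_(m, n)) t : mx_derive (fun=> C) t 0.
Proof. by move=> i j; rewrite mxE; exact: is_derive_cst. Qed.

Lemma mx_deriveD m n (F G : R -> 'M[R]_(m, n)) t F' G' :
  mx_derive F t F' -> mx_derive G t G' ->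
  mx_derive (fun s => F s + G s) t (F' + G').
Proof.
move=> dF dG i j; rewrite mxE.
rewrite (_ : (fun _ => _) = (fun s => F s i j) \+ (fun s => G s i j)).
  exact: is_deriveD.
by apply/funext => s; rewrite mxE.
Qed.

Lemma mx_deriveM m n p (F : R -> 'M[R]_(m, n)) (G : R -> 'M[R]_(n, p)) t F' G' :
  mx_derive F t F' -> mx_derive G t G' ->
  mx_derive (fun s => F s *m G s) t (F' *m G t + F t *m G').
Proof.
move=> dF dG i j; rewrite mxE.
rewrite (_ : (fun _ => _) = \sum_(k < n) ((fun s => F s i k) * (fun s => G s k j))).
  apply: is_derive_eq.
    by apply: is_derive_sum => k; apply: is_deriveM; [exact: dF|exact: dG].
  rewrite !mxE -big_split/=; apply: eq_bigr => k _.
  by rewrite /GRing.scale/= addrC [_ * F' _ _]mulrC.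
by apply/funext => s; rewrite mxE fct_sumE.
Qed.

Lemma mx_derive_mexp d (A : 'M[R]_d) t :
  mx_derive (fun s => mexp (s *: A)) t (mexp (t *: A) *m A).
Proof.
move=> i j; have := is_derive_mexp_mul A 1%:M i j t.
by under eq_fun do rewrite mulmx1; rewrite mulmx1.
Qed.

Lemma mx_derive_comp m n (F : R -> 'M[R]_(m, n)) (g : R -> R) t F' g' :
  mx_derive F (g t) F' -> is_derive t (1 : R) g g' ->
  mx_derive (F \o g) t (g' *: F').
Proof.
move=> dF dg i j; rewrite mxE mulrC.
by apply: (@is_derive1_comp _ (fun s => F s i j) g).
Qed.

Lemma mx_derive_mexp_rev d (A : 'M[R]_d) t T :
  mx_derive (fun s => mexp ((T - s) *: A)) t (- (mexp ((T - t) *: A) *m A)).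
Proof.
rewrite -scaleN1r; apply: (@mx_derive_comp _ _ (fun s => mexp (s *: A)) (fun s => T - s)).
  exact: mx_derive_mexp.
rewrite -[-1]add0r; apply: is_deriveD.
Qed.

Lemma mx_derive_continuous m n (F : R -> 'M[R]_(m, n)) (F' : R -> 'M[R]_(m, n)) :
  (forall t, mx_derive F t (F' t)) -> forall i j, continuous (fun s => F s i j).
Proof.
move=> dF i j t; apply/differentiable_continuous/derivable1_diffP.
by have [] := dF t i j.
Qed.

Lemma mx_derive0 m n (F : R -> 'M[R]_(m, n)) :
  (forall t, mx_derive F t 0) -> forall s t, F s = F t.
Proof.
move=> dF s t; apply/matrixP => i j.
apply: (@is_derive_0_is_cst _ (fun s => F s i j)) => x.
by have := dF x i j; rewrite mxE.
Qed.

End MatrixDerivative.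

Section MexpSemigroup.
Context {R : realType} {d : nat}.
Implicit Types A : 'M[R]_d.

(** The product of the exponentials at times [s + t - u] and [u] has derivative 0 in [u]; the two
    sides are its values at [u = 0] and [u = t]. *)
Lemma mexpDscale A (s t : R) :
  mexp ((s + t) *: A) = mexp (s *: A) *m mexp (t *: A).
Proof.
pose F u := mexp ((s + t - u) *: A) *m mexp (u *: A).
have dF u : mx_derive F u 0.
  have := @mx_deriveM _ _ _ _ _ _ u _ _ (@mx_derive_mexp_rev _ _ A u (s + t)) (@mx_derive_mexp _ _ A u).
  rewrite mulNmx -mulmxA (@mexp_comm _ _ (u *: A) A) ?addNr//.
  by rewrite -scalemxAl -scalemxAr.
have := mx_derive0 dF 0 t.
by rewrite /F subr0 scale0r mexp0 mulmx1 addrK.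
Qed.

Lemma mexp_scale_comm A t : A *m mexp (t *: A) = mexp (t *: A) *m A.
Proof. by apply: mexp_comm; rewrite -scalemxAl -scalemxAr. Qed.

Lemma mexp_natmul A (h : R) n : mexp ((n%:R * h) *: A) = mexp (h *: A) ^+ n.
Proof.
elim: n => [|n IH]; first by rewrite mul0r scale0r mexp0 expr0.
by rewrite exprS -IH -[mexp _ * _]/(_ *m _) -mexpDscale mulrSr mulrDl mul1r addrC.
Qed.

End MexpSemigroup.

(** * Powers of near-identity matrices and the exponential *)

Section EulerMexp.
Context {R : realType}.

Lemma derive0_littleo (g : R -> R) : is_derive (0 : R) (1 : R) g 0 -> g 0 = 0 ->
  forall e, 0 < e -> \forall h \near (0 : R), `|g h| <= e * `|h|.
Proof.
move=> [dg dg0] g0 e e0.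
have : (fun h => h^-1 *: ((g \o shift 0) (h *: (1 : R)) - g 0)) @ 0^' --> 'D_1 g 0.
  exact: dg.
rewrite dg0 => /cvgr0Pnorm_lt => /(_ e e0) H.
have /nbhs_ballP[r /= r0 Hr] := H.
apply/nbhs_ballP; exists r => //= h hr.
have [->|h0] := eqVneq h 0; first by rewrite g0 !normr0 mulr0.
have := Hr h hr h0.
rewrite /= g0 subr0 addr0 [h *: 1]mulr1 [_ *: _]/(_ * _) normrM normfV.
by rewrite mulrC ltr_pdivrMr ?normr_gt0// => /ltW.
Qed.

Lemma mx_derive0_littleo d (G : R -> 'M[R]_d) : mx_derive G 0 0 -> G 0 = 0 ->
  forall e, 0 < e -> \forall h \near (0 : R), mx_l1 (G h) <= e * `|h|.
Proof.
move=> dG G0 e e0.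
(* The number of entries, plus one so that [c] is positive even when [d = 0]. *)
pose c : R := (d * d).+1%:R.
have c0 : 0 < c by rewrite ltr0n.
have H (ij : 'I_d * 'I_d) : \forall h \near (0 : R), `|G h ij.1 ij.2| <= e / c * `|h|.
  case: ij => i j /=.
  apply: (@derive0_littleo (fun h => G h i j)); last by rewrite divr_gt0.
    by have := dG i j; rewrite mxE.
  by rewrite G0 mxE.
have H' : \forall h \near (0 : R), forall ij : 'I_d * 'I_d, `|G h ij.1 ij.2| <= e / c * `|h|.
  exact: (@filter_forall R _ _ (nbhs (0 : R)) (nbhs_filter (0 : R)) H).
apply: (filterS _ H') => h {}H.
apply: (@le_trans _ _ (\sum_(i < d) \sum_(j < d) e / c * `|h|)).
  by apply: ler_sum => i _; apply: ler_sum => j _; exact: (H (i, j)).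
rewrite !sumr_const !card_ord -mulrnA -mulr_natl.
rewrite mulrA ler_wpM2r// mulrCA ler_piMr ?ltW//.
by rewrite ltr_pdivrMr// mul1r ltr_nat.
Qed.

Lemma is_derive_mulr (a x : R) : is_derive x (1 : R) (fun h => h * a) a.
Proof.
have := @is_deriveM R R^o id (cst a) x 1 1 0 (is_derive_id x 1) (is_derive_cst a x 1).
by rewrite scaler0 add0r [a *: 1]mulr1.
Qed.

(** Near 0 the difference is [h *: A] up to a remainder o(h); the summand 1 in the constant absorbs
    the remainder. *)
Lemma mx_derive_lip d (B : R -> 'M[R]_d) A : mx_derive B 0 A -> B 0 = 1%:M ->
  \forall h \near (0 : R), mx_l1 (B h - 1%:M) <= (mx_l1 A + 1) * `|h|.
Proof.
move=> dB B0.
have /(_ _ _ 1 ltr01) := @mx_derive0_littleo d (fun h => B h + (- 1%:M + h *: (- A))).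
have dG : mx_derive (fun h => B h + (- 1%:M + h *: (- A))) 0 0.
  move=> i j; rewrite mxE -[X in is_derive _ _ _ X](subrr (A i j)).
  rewrite (_ : (fun _ => _) = (fun h => B h i j) \+
      (cst (- (1%:M : 'M[R]_d) i j) \+ (fun h => h * (- A i j)))).
    apply: is_deriveD; first exact: dB.
    rewrite -[X in is_derive _ _ _ X]add0r; apply: is_deriveD.
    exact: is_derive_mulr.
  by apply/funext => h; rewrite !mxE.
move=> /(_ dG); rewrite /= B0 scale0r addr0 subrr => /(_ erefl).
move=> H; apply: (filterS _ H) => h; rewrite mul1r => Hh.
rewrite (_ : B h - 1%:M = (B h + (- 1%:M + h *: (- A))) + h *: A).
  rewrite (le_trans (mx_l1D _ _))// addrC mulrDl mul1r lerD// mx_l1Z.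
  by rewrite mulrC.
by rewrite scalerN addrA addrNK.
Qed.

(** The splitting B Y = Y + (B - 1) Y gives the factor 1 + k at each step. Bounding [mx_l1 B]
    directly would start from [d] instead of 1, and its powers would explode as the mesh shrinks. *)
Lemma mx_l1_pow_le d (B : 'M[R]_d) (k : R) n : 0 <= k -> mx_l1 (B - 1%:M) <= k ->
  forall m (X : 'M[R]_(d, m)), mx_l1 (B ^+ n *m X) <= (1 + k) ^+ n * mx_l1 X.
Proof.
move=> k0 Bk m X; elim: n => [|n IH]; first by rewrite !expr0 mul1mx mul1r.
rewrite !exprS -[B * _]/(B *m _) -mulmxA.
rewrite (_ : B *m _ = B ^+ n *m X + (B - 1%:M) *m (B ^+ n *m X)).
  rewrite (le_trans (mx_l1D _ _))// -mulrA mulrDl mul1r lerD//.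
  rewrite (le_trans (mx_l1M _ _))// ler_pM ?mx_l1_ge0//.
by rewrite mulmxBl mul1mx addrC subrK.
Qed.

(** Telescoping: B^(n+1) - E^(n+1) = B (B^n - E^n) + (B - E) E^n. Each of the [n] local errors [dl]
    is amplified at most by the growth of the remaining steps. *)
Lemma mx_l1_powB d (B E : 'M[R]_d) (k dl : R) n : 0 <= k ->
  mx_l1 (B - 1%:M) <= k -> mx_l1 (E - 1%:M) <= k -> mx_l1 (B - E) <= dl ->
  mx_l1 (B ^+ n - E ^+ n) <= n%:R * (1 + k) ^+ n * (dl * mx_l1 (1%:M : 'M[R]_d)).
Proof.
move=> k0 Bk Ek BE.
have N0 := @mx_l1_ge0 R d d 1%:M.
have dl0 : 0 <= dl by rewrite (le_trans (mx_l1_ge0 _) BE).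
have k1 : 1 <= 1 + k by rewrite lerDl.
elim: n => [|n IH]; first by rewrite !expr0 subrr mul0r mul0r -(scale0r 0) mx_l1Z normr0 mul0r.
rewrite (_ : B ^+ n.+1 - E ^+ n.+1 =
    B ^+ 1 *m (B ^+ n - E ^+ n) + (B - E) *m (E ^+ n *m 1%:M)); last first.
  rewrite mulmx1 expr1 mulmxBr mulmxBl !exprS -![_ * _]/(_ *m _).
  by rewrite addrA subrK.
rewrite (le_trans (mx_l1D _ _))//.
have := @mx_l1_pow_le _ B k 1 k0 Bk _ (B ^+ n - E ^+ n); rewrite [X in _ <= X * _]expr1.
move=> /le_trans - /(_ _ (ler_wpM2l _ IH)) H1.
have H2 : mx_l1 ((B - E) *m (E ^+ n *m 1%:M)) <= dl * ((1 + k) ^+ n * mx_l1 (1%:M : 'M[R]_d)).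
  rewrite (le_trans (mx_l1M _ _))// ler_pM ?mx_l1_ge0//.
  exact: mx_l1_pow_le.
rewrite (le_trans (lerD (H1 _) H2))//; first by rewrite addr_ge0.
set N := mx_l1 1%:M; rewrite [leRHS](_ : _ = (1 + k) * (n%:R * (1 + k) ^+ n * (dl * N)) +
  (1 + k) * (dl * ((1 + k) ^+ n * N))); last by rewrite -natr1 exprS; ring.
by rewrite lerD2l ler_peMl// !mulr_ge0// exprn_ge0// addr_ge0.
Qed.

(** Consistency and stability imply convergence: [B h] and [mexp (h *: A)] agree up to o(h), and n+1
    steps of length T/(n+1) accumulate an error o(1). Only the tangent of [B] at 0 matters, so the
    result serves both for the plain Euler factor 1 + hA and for the step of the moment
    recursion. *)
Lemma euler_mexp d (B : R -> 'M[R]_d) A T : mx_derive B 0 A -> B 0 = 1%:M ->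
  0 <= T -> (fun n => B (T / n.+1%:R) ^+ n.+1) @ \oo --> mexp (T *: A).
Proof.
move=> dB B0 T0; apply/cvg_mx_l1/cvgr0Pnorm_le => e e0.
pose k := mx_l1 A + 1; pose N := mx_l1 (1%:M : 'M[R]_d).
have k0 : 0 <= k by rewrite addr_ge0// mx_l1_ge0.
(* Amplification of a local error per unit of [h]: total time, growth of the n+1 steps, norm of the
   identity. The 1 makes [c] positive. *)
pose c := T * expR (k * T) * N + 1.
have c0 : 0 < c by rewrite ltr_wpDl// !mulr_ge0 ?expR_ge0// mx_l1_ge0.
pose E h := mexp (h *: A).
have E0 : E 0 = 1%:M by rewrite /E scale0r mexp0.
have dE : mx_derive E 0 A.
  by have := mx_derive_mexp A 0; rewrite scale0r mexp0 mul1mx.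
have BE : \forall h \near (0 : R), mx_l1 (B h - E h) <= e / c * `|h|.
  apply: (@mx_derive0_littleo d (fun h => B h - E h)); last by rewrite divr_gt0.
    rewrite -(subrr A); apply: mx_deriveD => // i j.
    rewrite mxE (_ : (fun _ => _) = \- (fun h => E h i j)).
      by apply: is_deriveN; exact: dE.
    by apply/funext => h; rewrite mxE.
  by rewrite B0 E0 subrr.
have hcvg : (fun n : nat => T / n.+1%:R) @ \oo --> (0 : R).
  by rewrite -(mulr0 T); apply: cvgM; [exact: cvg_cst|exact: cvg_harmonic].
near=> n.
have H1 : mx_l1 (B (T / n.+1%:R) - E (T / n.+1%:R)) <= e / c * `|T / n.+1%:R|.
  by near: n; exact: (hcvg _ BE).
have H2 : mx_l1 (B (T / n.+1%:R) - 1%:M) <= k * `|T / n.+1%:R|.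
  by near: n; exact: (hcvg _ (mx_derive_lip dB B0)).
have H3 : mx_l1 (E (T / n.+1%:R) - 1%:M) <= k * `|T / n.+1%:R|.
  by near: n; exact: (hcvg _ (mx_derive_lip dE E0)).
set h := T / n.+1%:R in H1 H2 H3 *.
have h0 : 0 <= h by rewrite divr_ge0.
have Th : T = n.+1%:R * h by rewrite /h mulrC divfK// pnatr_eq0.
rewrite ger0_norm in H1 H2 H3 => //.
rewrite [X in mexp (X *: _)]Th mexp_natmul -/(E h) ger0_norm ?mx_l1_ge0//.
rewrite (le_trans (mx_l1_powB n.+1 (mulr_ge0 k0 h0) H2 H3 H1))//.
have : (1 + k * h) ^+ n.+1 <= expR (k * T).
  have -> : k * T = n.+1%:R * (k * h) by rewrite [in LHS]Th mulrCA.
  rewrite expRM_natl lerXn2r ?nnegrE ?expR_ge0 ?addr_ge0 ?mulr_ge0//.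
  exact: expR_ge1Dx.
move=> Hq; rewrite (_ : _ * _ * _ = (n.+1%:R * h) * (1 + k * h) ^+ n.+1 * N * (e / c)); last by rewrite /N; ring.
rewrite -Th (@le_trans _ _ (T * expR (k * T) * N * (e / c)))//.
  by rewrite ler_wpM2r ?divr_ge0 ?(ltW e0) ?(ltW c0)// ler_wpM2r ?mx_l1_ge0// ler_wpM2l.
by rewrite mulrCA ler_piMr ?(ltW e0)// ler_pdivrMr// mul1r lerDl.
Unshelve. all: by end_near. Qed.

End EulerMexp.

(** * Exponentials of Metzler matrices *)

Section Metzler.
Context {R : realType} {d : nat}.
Implicit Types A : 'M[R]_d.

Definition metzler A := forall i j, i != j -> 0 <= A i j.

Let euler1 A T : 0 <= T ->
  (fun n => (1%:M + (T / n.+1%:R) *: A) ^+ n.+1) @ \oo --> mexp (T *: A).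
Proof.
move=> T0; apply: (@euler_mexp _ _ (fun h => 1%:M + h *: A)) => //; last first.
  by rewrite scale0r addr0.
move=> i j; rewrite (_ : (fun _ => _) = cst ((1%:M : 'M[R]_d) i j) \+ (fun h => h * A i j)).
  rewrite -[X in is_derive _ _ _ X]add0r; apply: is_deriveD.
  exact: is_derive_mulr.
by apply/funext => h; rewrite !mxE.
Qed.

Lemma mx_mul_ge0 m n p (A : 'M[R]_(m, n)) (B : 'M[R]_(n, p)) :
  (forall i j, 0 <= A i j) -> (forall i j, 0 <= B i j) ->
  forall i j, 0 <= (A *m B) i j.
Proof. by move=> A0 B0 i j; rewrite mxE sumr_ge0// => k _; rewrite mulr_ge0. Qed.

Let hnear T : (fun n : nat => T / n.+1%:R) @ \oo --> (0 : R).
Proof. by rewrite -(mulr0 T); apply: cvgM; [exact: cvg_cst|exact: cvg_harmonic]. Qed.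

(** Off the diagonal this is the Metzler condition; on it, 1 + h A_ii is nonnegative once h is at
    most the inverse of [mx_l1 A + 1]. *)
Let euler1_ge0 A T : metzler A -> 0 <= T ->
  \forall n \near \oo, forall i j, 0 <= (1%:M + (T / n.+1%:R) *: A) i j.
Proof.
move=> mA T0.
have N0 : 0 < mx_l1 A + 1 by rewrite ltr_wpDl// mx_l1_ge0.
have : \forall h \near (0 : R), `|h| < (mx_l1 A + 1)^-1.
  by apply/nbhs_ballP; exists (mx_l1 A + 1)^-1 => /=; [rewrite invr_gt0|move=> h; rewrite /ball/= sub0r normrN].
move=> /(hnear T) H; near=> n => i j.
have hn : `|T / n.+1%:R| < (mx_l1 A + 1)^-1 by near: n; exact: H.
rewrite !mxE.
have h0 : 0 <= T / n.+1%:R by rewrite divr_ge0.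
have [<-|ij] := eqVneq i j; last by rewrite add0r mulr_ge0// mA.
suff: T / n.+1%:R * - A i i <= 1 by rewrite [true%:R](_ : _ = 1 :> R)// -[_ * A i i]opprK subr_ge0 -mulrN.
apply: (@le_trans _ _ (T / n.+1%:R * (mx_l1 A + 1))).
  rewrite ler_wpM2l// (@le_trans _ _ `|A i i|)//.
    by rewrite -normrN ler_norm.
  by rewrite (le_trans (mx_l1_entry A i i))// lerDl.
by rewrite -ler_pdivlMr// mul1r (le_trans _ (ltW hn))// ler_norm.
Unshelve. all: by end_near. Qed.

Lemma mexp_ge0 A T : metzler A -> 0 <= T -> forall i j, 0 <= mexp (T *: A) i j.
Proof.
move=> mA T0 i j.
have /cvg_mxP/(_ i j) H := @euler1 A _ T0.
rewrite -(cvg_lim _ H)//; apply: limr_ge; first by apply/cvg_ex; exists (mexp (T *: A) i j).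
near=> n.
have : forall i j, 0 <= (1%:M + (T / n.+1%:R) *: A) i j.
  by near: n; exact: euler1_ge0.
move: (1%:M + _) => B B0; elim: (n.+1) i j {H} => [|m IH] i j.
  by rewrite expr0 mxE; case: eqP.
by rewrite exprS; apply: mx_mul_ge0.
Unshelve. all: by end_near. Qed.

(** An Euler factor has column sums at most 1 - ch, hence at most e^{-ch}. For nonnegative matrices
    a bound on the column sums is multiplicative along products, and it survives the limit. *)
Lemma mexp_col_sum_le A c T : metzler A -> 0 <= T ->
  (forall j, \sum_i A i j <= - c) ->
  forall j, \sum_i mexp (T *: A) i j <= expR (- c * T).
Proof.
move=> mA T0 cA j.
have /cvg_mxP H := @euler1 A _ T0.
have {}H : (fun n : nat => \sum_i ((1%:M + (T / n.+1%:R) *: A) ^+ n.+1) i j) @ \oo -->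
    \sum_i mexp (T *: A) i j.
  by apply: cvg_big => [|i _]; [exact: add_continuous|exact: H].
rewrite -(cvg_lim _ H)//; apply: limr_le.
  by apply/cvg_ex; exists (\sum_i mexp (T *: A) i j).
near=> n.
have : forall i j, 0 <= (1%:M + (T / n.+1%:R) *: A) i j.
  by near: n; exact: euler1_ge0.
set h := T / _; have h0 : 0 <= h by rewrite divr_ge0.
have -> : T = n.+1%:R * h by rewrite /h mulrC divfK// pnatr_eq0.
have cB k : \sum_i (1%:M + h *: A) i k <= expR (- c * h).
  under eq_bigr do rewrite !mxE.
  rewrite big_split/= (bigD1 k)//= eqxx big1 ?addr0 => [|i /negPf ->//].
  rewrite (le_trans _ (expR_ge1Dx _))// lerD2l -mulr_sumr mulrC.
  by rewrite ler_wpM2r.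
move: (1%:M + _) cB => B cB B0.
rewrite mulrCA expRM_natl.
have : forall m i j, 0 <= (B ^+ m) i j.
  elim=> [|m IH] k l; first by rewrite expr0 mxE; case: eqP.
  by rewrite exprS; apply: mx_mul_ge0.
move=> Bm0; elim: (n.+1) => [|m IH].
  rewrite !expr0 (bigD1 j)//= mxE eqxx big1 ?addr0// => i /negPf ij.
  by rewrite mxE ij.
rewrite !exprS.
under eq_bigr do rewrite -[B * _]/(B *m _) mxE.
rewrite exchange_big/= (@le_trans _ _ (\sum_k expR (- c * h) * (B ^+ m) k j))//.
  by apply: ler_sum => k _; rewrite -mulr_suml ler_wpM2r.
by rewrite -mulr_sumr ler_wpM2l// expR_ge0.
Unshelve. all: by end_near. Qed.

Lemma mexp_l1_le A c T : metzler A -> 0 <= T ->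
  (forall j, \sum_i A i j <= - c) ->
  mx_l1 (mexp (T *: A)) <= d%:R * expR (- c * T).
Proof.
move=> mA T0 cA; rewrite /mx_l1 exchange_big/=.
rewrite (@le_trans _ _ (\sum_(j < d) expR (- c * T)))//; last first.
  by rewrite sumr_const card_ord mulr_natl.
apply: ler_sum => j _; rewrite (le_trans _ (mexp_col_sum_le mA T0 cA j))//.
by apply: ler_sum => i _; rewrite ger0_norm// mexp_ge0.
Qed.

(** A row vector killed by [A] is fixed by every [mexp (t *: A)], whose norm tends to 0; hence the
    left kernel is trivial. *)
Lemma metzler_unitmx A c : metzler A -> 0 < c ->
  (forall j, \sum_i A i j <= - c) -> A \in unitmx.
Proof.
move=> mA c0 cA; rewrite -row_free_unit -kermx_eq0; apply/rowV0P => v.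
rewrite sub_kermx => /eqP vA.
have vE t : v *m mexp (t *: A) = v.
  have := @mx_derive0 R _ _ (fun t => v *m mexp (t *: A)) _ t 0.
  rewrite scale0r mexp0 mulmx1; apply => s.
  have := mx_deriveM (mx_derive_cst v s) (mx_derive_mexp A s).
  by rewrite mul0mx add0r -mexp_scale_comm mulmxA vA mul0mx.
apply: mx_l1_eq0; apply/ler_addgt0Pr => e e0; rewrite add0r.
pose K := mx_l1 v * d%:R.
have K0 : 0 <= K by rewrite mulr_ge0// mx_l1_ge0.
have : K * expR (- t) @[t --> +oo] --> K * 0.
  by apply: cvgM; [exact: cvg_cst|exact: cvgr_expR].
rewrite mulr0 => /cvgr0Pnorm_le/(_ e e0)[M [_ /(_ (`|M| + 1))]].
rewrite (le_lt_trans (ler_norm M)) ?ltrDl// => /(_ isT) H.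
(* Chosen so that [c * t] is [|M| + 1], a point beyond the threshold [M] of the limit above. *)
pose t := (`|M| + 1) / c.
have t0 : 0 <= t by rewrite divr_ge0 ?addr_ge0// ltW.
rewrite -(vE t) (le_trans (mx_l1M _ _))//.
rewrite (le_trans (ler_wpM2l (mx_l1_ge0 v) (mexp_l1_le mA t0 cA)))//.
have -> : - c * t = - (`|M| + 1) by rewrite /t mulNr mulrC divfK ?gt_eqF.
by rewrite mulrA (le_trans _ H)// ler_norm.
Qed.

End Metzler.

(** * Inhomogeneous linear systems *)

Section LinearODE.
Context {R : realType}.

Lemma mx_derive_FTC d (F f : R -> 'cV[R]_d) (t : R) : 0 <= t ->
  (forall s, mx_derive F s (f s)) -> (forall i, continuous (fun s => f s i 0)) ->
  vint t f = F t - F 0.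
Proof.
move=> t0 dF cf; apply/matrixP => i j; rewrite !mxE (ord1 j).
move: t0; rewrite le_eqVlt => /predU1P[<-|t0].
  by rewrite set_itv1 Rintegral_set1 subrr.
have dFi s : derivable (fun s => F s i 0) s 1 by have [] := dF s i 0.
have cF : continuous (fun s => F s i 0).
  by move=> s; apply/differentiable_continuous/derivable1_diffP; exact: dFi.
rewrite /Rintegral (@continuous_FTC2 _ (fun s => f s i 0) (fun s => F s i 0))//.
- exact: continuous_subspaceT.
- split=> [s _||]; first exact: dFi.
  + by apply: cvg_at_right_filter; exact: cF.
  + by apply: cvg_at_left_filter; exact: cF.
- by move=> s _; rewrite derive1E; have [_ ->] := dF s i 0.
Qed.

Lemma mx_continuousM m n p (F : R -> 'M[R]_(m, n)) (G : R -> 'M[R]_(n, p)) :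
  (forall i j, continuous (fun s => F s i j)) ->
  (forall i j, continuous (fun s => G s i j)) ->
  forall i j, continuous (fun s => (F s *m G s) i j).
Proof.
move=> cF cG i j t; under eq_fun do rewrite mxE.
apply: cvg_big => [|k _]; first exact: add_continuous.
by apply: cvgM; [exact: cF|exact: cG].
Qed.

Lemma mexp_rev_continuous d (A : 'M[R]_d) (t : R) i j :
  continuous (fun s => mexp ((t - s) *: A) i j).
Proof.
apply: (@mx_derive_continuous R d d (fun s => mexp ((t - s) *: A))
  (fun s => - (mexp ((t - s) *: A) *m A))) => s.
exact: mx_derive_mexp_rev.
Qed.

(** The exponential of the time left is an integrating factor: its derivative cancels the
    homogeneous term and leaves the source. *)
Lemma mx_derive_duhamel d (A : 'M[R]_d) (y b : R -> 'cV[R]_d) (t : R) :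
  (forall s, mx_derive y s (A *m y s + b s)) ->
  forall s, mx_derive (fun s => mexp ((t - s) *: A) *m y s) s (mexp ((t - s) *: A) *m b s).
Proof.
move=> dy s.
have := mx_deriveM (@mx_derive_mexp_rev _ _ A s t) (dy s).
by rewrite mulNmx mulmxDr mulmxA addrA addNr add0r.
Qed.

Lemma duhamel d (A : 'M[R]_d) (y b : R -> 'cV[R]_d) (t : R) : 0 <= t ->
  (forall s, mx_derive y s (A *m y s + b s)) ->
  (forall i, continuous (fun s => b s i 0)) ->
  y t = mexp (t *: A) *m y 0 + vint t (fun s => mexp ((t - s) *: A) *m b s).
Proof.
move=> t0 dy cb.
rewrite (mx_derive_FTC t0 (@mx_derive_duhamel _ _ _ _ t dy)).
  by rewrite subrr subr0 scale0r mexp0 mul1mx addrC subrK.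
move=> i; apply: mx_continuousM => [k l|k l]; first exact: mexp_rev_continuous.
by rewrite (ord1 l).
Qed.

(** In [s], the integrand has the antiderivative - e^{(t-s)A} A^{-1} b; the exponential commutes
    with the inverse of [A]. *)
Lemma vint_mexp_cst d (A : 'M[R]_d) (b : 'cV[R]_d) (t : R) : 0 <= t -> A \in unitmx ->
  vint t (fun s => mexp ((t - s) *: A) *m b) = - (invmx A *m ((1%:M - mexp (t *: A)) *m b)).
Proof.
move=> t0 uA.
have dF s : mx_derive (fun s => mexp ((t - s) *: A) *m (- (invmx A *m b))) s
    (mexp ((t - s) *: A) *m b).
  have := mx_deriveM (@mx_derive_mexp_rev _ _ A s t) (mx_derive_cst (- (invmx A *m b)) s).
  by rewrite mulmx0 addr0 mulNmx mulmxN opprK -mulmxA mulKVmx.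
rewrite (mx_derive_FTC t0 dF).
  have cA : invmx A *m mexp (t *: A) = mexp (t *: A) *m invmx A.
    rewrite -[RHS]mul1mx -(mulVmx uA) -mulmxA [A *m (_ *m _)]mulmxA mexp_scale_comm.
    by rewrite -mulmxA mulmxV// mulmx1.
  rewrite subrr subr0 scale0r mexp0 !mul1mx mulmxBl mulmxBr mul1mx.
  by rewrite [mexp _ *m - _]mulmxN opprK [invmx A *m (_ *m b)]mulmxA cA -mulmxA opprB addrC.
move=> i; apply: mx_continuousM => [k l|k l]; first exact: mexp_rev_continuous.
by move=> s; exact: cvg_cst.
Qed.

(** The source is split at a time [s] after which it is small: what was accumulated before [s]
    decays exponentially, what comes later contributes at most e/2. No integral is taken; a function
    [phi] with the derivative of Duhamel's integrand is compared with a scalar [psi] whose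
    derivative dominates it. *)
Lemma linear_ode_cvg0 d (A : 'M[R]_d) (y b : R -> 'cV[R]_d) (K c : R) : 0 <= K -> 0 < c ->
  (forall t, 0 <= t -> mx_l1 (mexp (t *: A)) <= K * expR (- c * t)) ->
  (forall s, mx_derive y s (A *m y s + b s)) ->
  b t @[t --> +oo] --> (0 : 'cV[R]_d) -> y t @[t --> +oo] --> (0 : 'cV[R]_d).
Proof.
move=> K0 c0 EK dy b0; apply/cvg_mxP => i j; rewrite (ord1 j) [X in _ --> X]mxE.
apply/cvgr0Pnorm_le => e e0.
(* With this bound on the source, [psi t] is [K * e1 / c], at most [e / 2]; [K + 1] replaces [K] in
   the denominator because [K] may be 0. *)
pose e1 : R := e / 2 * c / (K + 1).
have K1 : 0 < K + 1 by rewrite ltr_wpDl.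
have e10 : 0 < e1 by rewrite !mulr_gt0// invr_gt0.
have /cvg_mx_l1/cvgr0Pnorm_le/(_ e1 e10)[s0 [_ bs]] := b0.
pose s : R := `|s0| + 1.
have {}bs r : s <= r -> mx_l1 (b r) <= e1.
  move=> sr; have := bs r; rewrite subr0 ger0_norm ?mx_l1_ge0//; apply.
  by rewrite (lt_le_trans _ sr)// (le_lt_trans (ler_norm s0))// ltrDl.
have bound t : s <= t -> `|y t i 0| <= K * expR (- c * (t - s)) * mx_l1 (y s) + e / 2.
  move=> st.
  pose phi r := (mexp ((t - r) *: A) *m y r) i 0.
  pose psi r := K * e1 / c * expR (- c * (t - r)).
  have dphi r : is_derive r (1 : R) phi ((mexp ((t - r) *: A) *m b r) i 0).
    exact: mx_derive_duhamel.
  have dpsi r : is_derive r (1 : R) psi (K * e1 * expR (- c * (t - r))).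
    have dl : is_derive r (1 : R) (fun r => - c * (t - r)) c.
      have -> : (fun r => - c * (t - r)) = cst (- c * t) \+ (fun r => r * c).
        by apply/funext => u /=; ring.
      rewrite -[X in is_derive _ _ _ X]add0r; apply: is_deriveD.
      exact: is_derive_mulr.
    have de := @is_derive1_comp R expR (fun r => - c * (t - r)) r _ _ (is_derive_expR _) dl.
    have := @is_deriveZ R R^o R^o _ (K * e1 / c) r 1 _ de.
    rewrite /GRing.scale/= [X in is_derive _ _ _ X](_ : _ = K * e1 * expR (- c * (t - r)))//.
    by have := gt_eqF c0; move=> cn; field; rewrite cn.
  have bd r : s <= r -> r <= t -> `|(mexp ((t - r) *: A) *m b r) i 0| <= K * e1 * expR (- c * (t - r)).
    move=> sr rt; rewrite (le_trans (mx_l1_entry _ _ _))// (le_trans (mx_l1M _ _))//.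
    rewrite mulrAC ler_pM ?mx_l1_ge0 ?bs// EK// subr_ge0//.
  (* Both signs are needed to bound the absolute value of [phi t]: for each of them the difference
     with [psi] is nonincreasing on [s, t]. *)
  have mono (sg : R) : `|sg| = 1 -> sg * phi t - psi t <= sg * phi s - psi s.
    move=> sg1.
    have dF r : is_derive r (1 : R) (fun r => sg * phi r - psi r)
        (sg * (mexp ((t - r) *: A) *m b r) i 0 - K * e1 * expR (- c * (t - r))).
      have dsg := @is_deriveZ R R^o R^o phi sg r 1 _ (dphi r).
      exact: (@is_deriveB R R^o R^o _ _ r 1 _ _ dsg (dpsi r)).
    apply: (@ler0_derive1_nincr _ (fun r => sg * phi r - psi r) s t) => //.
    - move=> r; rewrite in_itv/= => /andP[sr rt].
      rewrite derive1E; have [_ ->] := dF r.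
      rewrite subr_le0 (le_trans (ler_norm _))// normrM sg1 mul1r.
      by apply: bd; exact: ltW.
    - apply: continuous_subspaceT => r; apply/differentiable_continuous/derivable1_diffP.
      by have [] := dF r.
  have phit : phi t = y t i 0 by rewrite /phi subrr scale0r mexp0 mul1mx.
  have phis : `|phi s| <= K * expR (- c * (t - s)) * mx_l1 (y s).
    rewrite (le_trans (mx_l1_entry _ _ _))// (le_trans (mx_l1M _ _))//.
    by rewrite ler_wpM2r ?mx_l1_ge0// EK// subr_ge0.
  have psit : psi t <= e / 2.
    rewrite /psi subrr mulr0 expR0 mulr1 /e1 ler_pdivrMr//.
    rewrite mulrCA ler_piMr ?mulr_ge0 ?(ltW e0) ?(ltW c0)//.
    by rewrite ler_pdivrMr// mul1r lerDl.
  have psis : 0 <= psi s by rewrite /psi mulr_ge0 ?expR_ge0// divr_ge0 ?(ltW c0)// mulr_ge0// ltW.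
  have := mono 1; have := mono (-1); rewrite normrN normr1 phit => /(_ erefl) h1 /(_ erefl) h2.
  move: phis; rewrite ler_norml => /andP[p1 p2].
  by rewrite ler_norml; apply/andP; split; lra.
have : (fun t => K * expR (- (c * (t - s))) * mx_l1 (y s)) t @[t --> +oo] --> K * 0 * mx_l1 (y s).
  apply: cvgM; last exact: cvg_cst.
  apply: cvgM; first exact: cvg_cst.
  apply: (cvg_comp (fun t => c * (t - s)) (fun t => expR (- t)) _ (@cvgr_expR R)).
  apply/cvgryPge => a; near=> t; rewrite mulrC -ler_pdivrMr// lerBrDr.
  near: t; by apply: nbhs_pinfty_ge; rewrite num_real.
rewrite mulr0 mul0r => /cvgr0Pnorm_le/(_ (e / 2)); rewrite divr_gt0// => /(_ isT) H.
near=> t.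
have st : s <= t by near: t; by apply: nbhs_pinfty_ge; rewrite num_real.
rewrite (le_trans (bound _ st))// [leRHS](splitr e) lerD2r.
have : `|K * expR (- (c * (t - s))) * mx_l1 (y s)| <= e / 2 by near: t.
by rewrite mulNr; apply: le_trans; exact: ler_norm.
Unshelve. all: by end_near. Qed.

(** The distance to the equilibrium - A^{-1} bl solves the same equation with the source [b - bl],
    which tends to 0. *)
Lemma linear_ode_cvg d (A : 'M[R]_d) (y b : R -> 'cV[R]_d) (bl : 'cV[R]_d) (K c : R) :
  0 <= K -> 0 < c ->
  (forall t, 0 <= t -> mx_l1 (mexp (t *: A)) <= K * expR (- c * t)) ->
  A \in unitmx ->
  (forall s, mx_derive y s (A *m y s + b s)) ->
  b t @[t --> +oo] --> bl -> y t @[t --> +oo] --> - (invmx A *m bl).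
Proof.
move=> K0 c0 EK uA dy bb; apply/cvg_mx_l1.
have : (fun t => b t - bl) t @[t --> +oo] --> (0 : 'cV[R]_d).
  by apply/cvg_mx_l1; under eq_fun do rewrite subr0; exact/cvg_mx_l1.
have dz t : mx_derive (fun t => y t - - (invmx A *m bl)) t
    (A *m (y t - - (invmx A *m bl)) + (b t - bl)).
  have := mx_deriveD (dy t) (mx_derive_cst (- - (invmx A *m bl)) t).
  by rewrite addr0 opprK mulmxDr mulKVmx// [b t - bl]addrC addrA addrK.
move=> /(linear_ode_cvg0 K0 c0 EK dz) /cvg_mx_l1.
by under eq_fun do rewrite subr0.
Qed.

End LinearODE.

(** * Convergence of the transient probabilities *)

Section BinomialMean.
Context {R : realType}.

(* the mean of a(N) for a binomial variable N of parameters n and p *)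
Fixpoint binom_mean (p : R) (n : nat) (a : nat -> R) : R :=
  if n is m.+1 then
    (1 - p) * binom_mean p m a + p * binom_mean p m (fun l => a l.+1)
  else a 0%N.

Lemma binom_meanD p n a b :
  binom_mean p n (fun l => a l + b l) = binom_mean p n a + binom_mean p n b.
Proof. by elim: n a b => [//|n IH] a b /=; rewrite !IH; ring. Qed.

Lemma binom_meanZ p n c a :
  binom_mean p n (fun l => c * a l) = c * binom_mean p n a.
Proof. by elim: n a => [//|n IH] a /=; rewrite !IH; ring. Qed.

Lemma le_binom_mean p n a b : 0 <= p <= 1 -> (forall l, a l <= b l) ->
  binom_mean p n a <= binom_mean p n b.
Proof.
move=> /andP[p0 p1]; elim: n a b => [|n IH] a b ab //=.
by rewrite lerD// ler_wpM2l ?subr_ge0// IH.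
Qed.

Lemma binom_mean_cst p n c : binom_mean p n (fun=> c) = c.
Proof. by elim: n => [//|n IH] /=; rewrite IH; ring. Qed.

(* summation by parts against the binomial weights *)
Lemma binom_mean_centered p n a :
  binom_mean p n.+1 (fun l => (l%:R - n.+1%:R * p) * a l) =
  n.+1%:R * p * (1 - p) * binom_mean p n (fun l => a l.+1 - a l).
Proof.
elim: n a => [|n IH] a; first by rewrite /=; ring.
have E1 b c : binom_mean p n.+1 (fun l => (l%:R - n.+1%:R * p + c) * b l) =
    n.+1%:R * p * (1 - p) * binom_mean p n (fun l => b l.+1 - b l) + c * binom_mean p n.+1 b.
  rewrite -IH -binom_meanZ -binom_meanD; congr binom_mean; apply/funext => l; ring.
transitivity ((1 - p) * binom_mean p n.+1 (fun l => (l%:R - n.+1%:R * p + - p) * a l)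
  + p * binom_mean p n.+1 (fun l => (l%:R - n.+1%:R * p + (1 - p)) * a l.+1)).
  congr (_ * binom_mean p n.+1 _ + _ * binom_mean p n.+1 _); apply/funext => l; rewrite -?natr1; ring.
rewrite (E1 a) (E1 (fun l => a l.+1)).
have E3 : binom_mean p n.+1 (fun l => a l.+1 - a l) =
    binom_mean p n.+1 (fun l => a l.+1) - binom_mean p n.+1 a.
  rewrite -[in RHS]mulN1r -binom_meanZ -binom_meanD; congr binom_mean; apply/funext => l; ring.
transitivity (n.+1%:R * p * (1 - p) * binom_mean p n.+1 (fun l => a l.+1 - a l) +
  p * (1 - p) * (binom_mean p n.+1 (fun l => a l.+1) - binom_mean p n.+1 a)).
  rewrite [binom_mean p n.+1 (fun l => a l.+1 - a l)]/=; ring.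
rewrite -E3 -[n.+2%:R]natr1; ring.
Qed.

Lemma binom_mean_var p n :
  binom_mean p n.+1 (fun l => (l%:R - n.+1%:R * p) ^+ 2) = n.+1%:R * p * (1 - p).
Proof.
under [X in binom_mean _ _ X]eq_fun do rewrite expr2.
rewrite binom_mean_centered (_ : (fun _ => _) = fun=> 1).
  by rewrite binom_mean_cst mulr1.
by apply/funext => l; rewrite -natr1; ring.
Qed.

(** Smoothing by the binomial law: by parts, the variance v times the mean of the increments of [a]
    is the covariance of [a] with the centered variable, at most M times the mean absolute
    deviation, hence at most M sqrt(v). *)
Lemma binom_mean_diff_le (p : R) n a (M : R) : 0 < p < 1 -> (forall l, `|a l| <= M) ->
  Num.sqrt (n.+1%:R * p * (1 - p)) * `|binom_mean p n (fun l => a l.+1 - a l)| <= M.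
Proof.
move=> /andP[p0 p1] aM.
have M0 : 0 <= M by exact: le_trans (aM 0%N).
pose v : R := n.+1%:R * p * (1 - p).
have v0 : 0 < v by rewrite !mulr_gt0 ?subr_gt0.
pose e : R := Num.sqrt v.
have e0 : 0 < e by rewrite sqrtr_gt0.
have vE : v = e ^+ 2 by rewrite sqr_sqrtr// ltW.
suff H (s : R) : `|s| = 1 -> s * (v * binom_mean p n (fun l => a l.+1 - a l)) <= e * M.
  rewrite -/v -/e -(ler_pM2l e0) mulrA -expr2 -vE.
  rewrite -{1}(gtr0_norm v0) -normrM ler_norml -[leRHS]mul1r.
  have := H 1; have := H (-1); rewrite normrN normr1 => /(_ erefl) H1 /(_ erefl) H2.
  by apply/andP; split; lra.
move=> s1; rewrite -binom_mean_centered -binom_meanZ.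
(* In place of the Cauchy-Schwarz inequality, the pointwise bound |x| <= x^2 / (2e) + e / 2, where
   [e] is the standard deviation; it makes both halves of the mean equal to e M / 2. *)
rewrite (@le_trans _ _ (binom_mean p n.+1
    (fun l => M / (2 * e) * (l%:R - n.+1%:R * p) ^+ 2 + M * e / 2)))//.
  apply: le_binom_mean; first by rewrite !ltW.
  move=> l; set x := _ - _.
  rewrite (le_trans (ler_norm _))// !normrM s1 mul1r.
  rewrite (@le_trans _ _ (`|x| * M))// ?ler_wpM2l//.
  have : 0 <= M / (2 * e) * (`|x| - e) ^+ 2.
    by rewrite mulr_ge0 ?sqr_ge0// divr_ge0// mulr_ge0// ltW.
  have -> : x ^+ 2 = `|x| ^+ 2 by rewrite real_normK// num_real.
  move=> H; rewrite -subr_ge0; apply: le_trans H _; rewrite le_eqVlt; apply/orP; left; apply/eqP.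
  by field; rewrite gt_eqF.
rewrite binom_meanD binom_meanZ binom_mean_cst binom_mean_var -/v vE.
rewrite le_eqVlt; apply/orP; left; apply/eqP.
by field; rewrite gt_eqF.
Qed.

Lemma binom_mean_mulmx d (S : 'M[R]_d) p n (x : 'cV[R]_d) i :
  (((1 - p)%:M + p *: S) ^+ n *m x) i 0 = binom_mean p n (fun l => (S ^+ l *m x) i 0).
Proof.
elim: n x => [|n IH] x; first by rewrite expr0.
rewrite exprSr -[_ ^+ n * _]/(_ *m _) -mulmxA mulmxDl mulmxDr mxE.
rewrite mul_scalar_mx -[p *: S *m x]scalemxAl -!scalemxAr [X in X + _]mxE [X in _ + X]mxE !IH /=.
congr (_ * _ + _ * binom_mean _ _ _); apply/funext => l.
by rewrite exprSr -[_ ^+ l * _]/(_ *m _) mulmxA.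
Qed.

End BinomialMean.

Section MarkovConvergence.
Context {R : realType} {d : nat}.
Implicit Types (A : 'M[R]_d) (x : 'cV[R]_d).

Lemma mx_l1_substochastic (S : 'M[R]_d) x : (forall i j, 0 <= S i j) ->
  (forall j, \sum_i S i j <= 1) -> mx_l1 (S *m x) <= mx_l1 x.
Proof.
move=> S0 S1; rewrite /mx_l1.
apply: (@le_trans _ _ (\sum_i \sum_j S i j * `|x j 0|)).
  apply: ler_sum => i _; rewrite big_ord_recl big_ord0 addr0 mxE.
  rewrite (le_trans (ler_norm_sum _ _ _))//; apply: ler_sum => j _.
  by rewrite normrM (ger0_norm (S0 _ _)).
rewrite exchange_big/=; apply: ler_sum => j _.
rewrite big_ord_recl big_ord0 addr0 -mulr_suml ler_piMl//.
Qed.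

(** Since [1 - q] is at least 1/2, a factor 2 pays for its presence in the variance; this is the
    origin of [Num.sqrt 2] in the constant below. *)
Let half_bound (u v q : R) : 0 <= u -> u <= v -> 0 < q -> q <= 1 / 2 ->
  u * q <= 2 * (v * q) * (1 - q).
Proof.
move=> u0 uv q0 q12; rewrite -[2 * _ * _]mulrA mulrCA.
rewrite -[u * q]mulr1 ler_pM// ?(mulr_ge0 u0 (ltW q0)) ?ler_wpM2r ?(ltW q0)//.
by move: q12; lra.
Qed.

(* With A = c (S - 1), e^{tA} x is the limit of the means of S^N x for binomial N
   of variance about c t. *)
Lemma generator_mexp_decay A x : metzler A -> (forall j, \sum_i A i j = 0) ->
  exists2 C : R, 0 <= C & forall t : R, 0 < t -> forall i,
    `|(A *m (mexp (t *: A) *m x)) i 0| * Num.sqrt t <= C.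
Proof.
move=> mA A0.
(* Uniformization: [c] exceeds every diagonal entry in absolute value, so that [S] is nonnegative,
   with column sums at most 1. *)
pose c := mx_l1 A + 1.
have c0 : 0 < c by rewrite ltr_wpDl// mx_l1_ge0.
pose S := 1%:M + c^-1 *: A.
have S0 i j : 0 <= S i j.
  rewrite !mxE; have [<-|ij] := eqVneq i j.
    rewrite [true%:R](_ : _ = 1 :> R)// -[_ * A i i]opprK subr_ge0 -mulrN mulrC ler_pdivrMr// mul1r.
    by rewrite (le_trans (ler_norm _))// normrN (le_trans (mx_l1_entry A i i))// lerDl.
  by rewrite add0r mulr_ge0 ?invr_ge0 ?(ltW c0)// mA.
have S1 j : \sum_i S i j <= 1.
  under eq_bigr do rewrite !mxE; rewrite big_split/= -mulr_sumr A0 mulr0 addr0.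
  by rewrite (bigD1 j)//= eqxx big1 ?addr0// => i /negPf ->.
have Sl l i : `|(S ^+ l *m x) i 0| <= mx_l1 x.
  rewrite (le_trans (mx_l1_entry _ _ _))//.
  elim: l => [|l IH]; first by rewrite expr0 mul1mx.
  rewrite exprS -[S * _]/(S *m _) -mulmxA (le_trans _ IH)//.
  exact: mx_l1_substochastic.
have AS : A = c *: (S - 1%:M).
  by rewrite /S addrC addKr scalerA divff ?scale1r// gt_eqF.
exists (Num.sqrt 2 * c * mx_l1 x / Num.sqrt c).
  by rewrite divr_ge0 ?sqrtr_ge0// mulr_ge0 ?mx_l1_ge0// mulr_ge0 ?sqrtr_ge0 ?(ltW c0).
move=> t t0 i.
have sc0 : 0 < Num.sqrt c by rewrite sqrtr_gt0.
rewrite ler_pdivlMr//.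
pose B (n : nat) := (1%:M + (t / n.+1%:R) *: A) ^+ n.+1.
have cvgB : B n @[n --> \oo] --> mexp (t *: A).
  apply: (@euler_mexp _ _ (fun h => 1%:M + h *: A)) => //; last exact: ltW.
    move=> k l; rewrite (_ : (fun _ => _) = cst ((1%:M : 'M[R]_d) k l) \+ (fun h => h * A k l)).
      rewrite -[X in is_derive _ _ _ X]add0r; apply: is_deriveD.
      exact: is_derive_mulr.
    by apply/funext => h; rewrite !mxE.
  by rewrite scale0r addr0.
have cvgAB : `|(A *m (B n *m x)) i 0| * Num.sqrt t * Num.sqrt c @[n --> \oo] -->
    `|(A *m (mexp (t *: A) *m x)) i 0| * Num.sqrt t * Num.sqrt c.
  apply: cvgM; last exact: cvg_cst.
  apply: cvgM; last exact: cvg_cst.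
  apply: cvg_norm; rewrite [X in _ --> X]mxE; under eq_cvg do rewrite mxE.
  apply: cvg_big => [|k _]; first exact: add_continuous.
  apply: cvgM; first exact: cvg_cst.
  rewrite [X in _ --> X]mxE; under eq_cvg do rewrite mxE.
  apply: cvg_big => [|l _]; first exact: add_continuous.
  apply: cvgM; last exact: cvg_cst.
  by move/cvg_mxP : cvgB; apply.
rewrite -(cvg_lim _ cvgAB)//; apply: limr_le; first by apply/cvg_ex; eexists; exact: cvgAB.
near=> n.
(* With this [p] the Euler factor is the mixture (1 - p) + p S, whose power is a binomial mean of
   powers of [S]; multiplying by A = c (S - 1) turns the values into unit increments. *)
pose p : R := t / n.+1%:R * c.
have p0 : 0 < p by rewrite mulr_gt0// divr_gt0.
have p12 : p <= 1 / 2.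
  have H1 : 2 * (t * c) <= n%:R by near: n; exact: nbhs_infty_ger.
  rewrite /p mulrAC ler_pdivrMr// -[n.+1%:R]natr1.
  by move: (t * c) (n%:R : R) H1 => u v; lra.
have BE : B n = ((1 - p)%:M + p *: S) ^+ n.+1.
  congr (_ ^+ _); rewrite /p /S scalerDr scalerA -[_ / c]mulrA divff ?gt_eqF// mulr1 addrA.
  by rewrite -[p *: 1%:M]/(p *: 1%:M) scalemx1 -raddfD/= subrK.
have ABE : (A *m (B n *m x)) i 0 =
    c * binom_mean p n.+1 (fun l => (S ^+ l.+1 *m x) i 0 - (S ^+ l *m x) i 0).
  rewrite AS -scalemxAl mxE mulmxBl mul1mx BE; congr (_ * _).
  rewrite mxE [X in _ + X]mxE mulmxA.
  have comm (C : 'M[R]_d) (u v : R) : C * (u%:M + v *: C) = (u%:M + v *: C) * C.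
    rewrite mulrDl mulrDr -![_ * _]/(_ *m _) scalar_mxC; congr (_ + _).
    by rewrite -scalemxAl -scalemxAr.
  have -> : S *m ((1 - p)%:M + p *: S) ^+ n.+1 *m x = ((1 - p)%:M + p *: S) ^+ n.+1 *m (S *m x).
    rewrite mulmxA; congr (_ *m _); apply: (@commrX _ S); rewrite /GRing.comm.
    exact: comm.
  rewrite !binom_mean_mulmx -[in LHS]mulN1r -binom_meanZ -binom_meanD.
  congr binom_mean; apply/funext => l; rewrite mulN1r; congr (_ - _).
  by rewrite exprSr -[_ ^+ l * _]/(_ *m _) mulmxA.
have := @binom_mean_diff_le R p n.+1 (fun l => (S ^+ l *m x) i 0) (mx_l1 x).
rewrite p0 (le_lt_trans p12) ?ltr_pdivrMr ?mul1r ?ltr1n//= => /(_ isT (fun l => Sl l i)).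
rewrite ABE normrM (gtr0_norm c0).
set D := `|binom_mean _ _ _| => HD.
have D0 : 0 <= D by rewrite /D normr_ge0.
(* [t * c] is [n.+1%:R * p], while the power n+1 of the factor, differenced once, is governed by a
   binomial variance with n+2 trials: the bound loses nothing but the factor 2. *)
have Hs : Num.sqrt t * Num.sqrt c <= Num.sqrt 2 * Num.sqrt (n.+2%:R * p * (1 - p)).
  rewrite -(sqrtrM c (ltW t0)) -(sqrtrM _ (ler0n R 2)); apply: ler_wsqrtr; rewrite mulrA.
  have -> : t * c = n.+1%:R * p by rewrite /p; field; rewrite ?pnatr_eq0.
  by apply: half_bound => //; rewrite ler_nat.
rewrite (@le_trans _ _ (c * D * (Num.sqrt 2 * Num.sqrt (n.+2%:R * p * (1 - p)))))//.
  by rewrite -mulrA ler_wpM2l// mulr_ge0// ltW.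
rewrite [leLHS](_ : _ = (Num.sqrt 2 * c) * (Num.sqrt (n.+2%:R * p * (1 - p)) * D)); last by ring.
by rewrite ler_wpM2l// mulr_ge0 ?sqrtr_ge0// ltW.
Unshelve. all: by end_near. Qed.

Lemma ones_dotE (v : 'cV[R]_d) : ones_dot v = \sum_i v i 0.
Proof. by rewrite /ones_dot mxE; apply: eq_bigr => i _; rewrite !mxE mul1r. Qed.

Lemma cluster_cvg_eq {T : topologicalType} (F : set_system T) {FF : ProperFilter F} (f : T -> R) (l : R) (x : T) :
  cluster F x -> {for x, continuous f} -> f @ F --> l -> f x = l.
Proof.
move=> Fx cf fl; apply/eqP; rewrite -subr_eq0 -normr_le0; apply/ler_addgt0Pr => e e0.
rewrite add0r.
have e20 : 0 < e / 2 by rewrite divr_gt0.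
have H1 : F [set v | `|l - f v| < e / 2] by move/cvgrPdist_lt : fl; apply.
have H2 : nbhs x [set v | `|f x - f v| < e / 2] by move/cvgrPdist_lt : cf; apply.
have [v [/= v1 v2]] := Fx _ _ H1 H2.
rewrite (_ : f x - l = (f x - f v) - (l - f v)); last by ring.
by rewrite (le_trans (ler_normB _ _))// [leRHS]splitr lerD// ltW.
Qed.

Lemma cluster_ge0 {T : topologicalType} (F : set_system T) (f : T -> R) (x : T) :
  cluster F x -> {for x, continuous f} -> F [set v | 0 <= f v] -> 0 <= f x.
Proof.
move=> Fx cf H1; rewrite leNgt; apply/negP => fx0.
have H2 : nbhs x [set v | `|f x - f v| < - f x] by move/cvgrPdist_lt : cf; apply; rewrite oppr_gt0.
have [v [/= v1 v2]] := Fx _ _ H1 H2.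
by move: v2; rewrite ltr_norml => /andP[]; lra.
Qed.

(** Compactness: every cluster point of p_t is a probability vector annihilated by Q^T, hence equals
    [pi], and a filter living in a compact set with one cluster point converges to it. *)
Lemma unique_invariant_cvg (Q : 'M[R]_d) (pi : 'cV[R]_d) (p : R -> 'cV[R]_d) :
  is_unique_invariant Q pi -> (forall t, 0 <= t -> forall i, 0 <= p t i 0) ->
  (forall t, 0 <= t -> ones_dot (p t) = 1) ->
  Q^T *m p t @[t --> +oo] --> (0 : 'cV[R]_d) -> p t @[t --> +oo] --> pi.
Proof.
move=> [[pi0 pi1 piQ] piu] p0 p1 pQ.
have le1 (v : 'cV[R]_d) i : (forall i, 0 <= v i 0) -> ones_dot v = 1 -> v i 0 <= 1.
  move=> v0 <-; rewrite ones_dotE (bigD1 i)//= lerDl; exact: sumr_ge0.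
pose F : set_system 'rV[R]_d := (fun t => (p t)^T) t @[t --> +oo].
have FF : ProperFilter F by exact: fmap_proper_filter.
(* The cube is wider than [0, 1]^d because [compact_cluster_set1] wants [V] to be a neighbourhood of
   the limit, and entries of [pi] may be 0 or 1. Rows are used because the compactness result is
   about row vectors. *)
pose V := [set v : 'rV[R]_d | forall i, v ord0 i \in `[(-2)%R, 2%R]].
have cV : compact V.
  have H := @segment_compact R (-2) 2.
  exact: (@rV_compact R d (fun=> [set x : R | x \in `[(-2)%R, 2%R]]) (fun=> H)).
have t0near : \forall t \near +oo, 0 <= t :> R by apply: nbhs_pinfty_ge; rewrite num_real.
have Fin (D : set 'rV[R]_d) : (forall t, 0 <= t -> D (p t)^T) -> F D.
  by move=> H; exact: (filterS H t0near).
have FV : F V.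
  apply: Fin => t t0 i /=; rewrite mxE in_itv/= (le_trans _ (p0 _ t0 i)) ?(le_trans (le1 _ i (p0 _ t0) (p1 _ t0)))//; lra.
have piV : nbhs (pi^T) V.
  apply: (@filter_forall 'rV[R]_d _ _ (nbhs pi^T) (nbhs_filter pi^T)) => i.
  have H : nbhs (pi^T ord0 i) [set y : R | y \in `[(-2)%R, 2%R]].
    rewrite mxE; apply/nbhs_ballP; exists 1 => //= y; rewrite /ball/= in_itv/= ltr_norml.
    by have := pi0 i; have := le1 _ i pi0 pi1; move=> ? ? /andP[? ?]; apply/andP; split; lra.
  exact: (@coord_continuous R 1 d ord0 i pi^T _ H).
have cc i (x : 'rV[R]_d) : {for x, continuous (fun v : 'rV[R]_d => v ord0 i)} by exact: coord_continuous.
have csum (a : 'I_d -> R) (x : 'rV[R]_d) :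
    {for x, continuous (fun v : 'rV[R]_d => \sum_i a i * v ord0 i)}.
  suff H : (fun v : 'rV[R]_d => \sum_i a i * v ord0 i) v @[v --> x] --> \sum_i a i * x ord0 i by exact: H.
  refine (@cvg_big _ _ _ _ _ _ _ (nbhs x) _ _ _ (nbhs_filter x) _) => [|i _]; first exact: add_continuous.
  by apply: cvgM; [exact: cvg_cst|exact: cc].
have clF (x : 'rV[R]_d) : cluster F x -> x = pi^T.
  move=> Fx; rewrite -[LHS]trmxK; congr (_^T); apply: piu; split.
  - move=> i; rewrite mxE; apply: (cluster_ge0 Fx (cc i x)).
    by apply: Fin => t t0; rewrite /= mxE p0.
  - rewrite ones_dotE; under eq_bigr do rewrite mxE.
    under eq_bigr do rewrite -[x _ _]mul1r.
    apply: (@cluster_cvg_eq _ F FF (fun v : 'rV[R]_d => \sum_i 1 * v ord0 i) _ _ Fx).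
      exact: (csum (fun=> 1)).
    apply: cvg_near_cst; apply: Fin => t t0 /=.
    rewrite -[RHS](p1 t t0) ones_dotE; apply: eq_bigr => i _.
    by rewrite mul1r mxE.
  - apply/matrixP => i j; rewrite (ord1 j) [RHS]mxE.
    have -> : (Q^T *m x^T) i 0 = (fun v : 'rV[R]_d => \sum_k Q k i * v ord0 k) x.
      by rewrite mxE; apply: eq_bigr => k _; rewrite !mxE.
    apply: (@cluster_cvg_eq _ F FF (fun v : 'rV[R]_d => \sum_k Q k i * v ord0 k) 0 _ Fx).
      exact: (csum (fun k => Q k i)).
    have /cvg_mxP/(_ i 0) := pQ; rewrite [X in _ --> X]mxE.
    rewrite (_ : (fun t => (Q^T *m p t) i 0) = (fun t => \sum_k Q k i * (p t)^T ord0 k))//.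
    by apply/funext => t; rewrite mxE; apply: eq_bigr => k _; rewrite !mxE.
have clF1 : cluster F = [set pi^T].
  apply/seteqP; split=> [x /clF //|x ->].
  by have [y [_ Fy]] := cV F FF FV; rewrite -(clF y Fy).
have : F --> pi^T.
  exact: (compact_cluster_set1 (@norm_hausdorff R 'rV[R]_d) cV piV FF FV clF1).
move=> /cvg_mxP H; apply/cvg_mxP => i j; rewrite (ord1 j).
have := H 0 i; rewrite mxE.
by under eq_fun do rewrite mxE.
Unshelve. all: by end_near. Qed.

Lemma transient_cvg (Q : 'M[R]_d) (pi p0 : 'cV[R]_d) : is_generator Q ->
  is_unique_invariant Q pi ->
  (forall t, 0 <= t -> forall i, 0 <= (mexp (t *: Q^T) *m p0) i 0) ->
  (forall t, 0 <= t -> ones_dot (mexp (t *: Q^T) *m p0) = 1) ->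
  mexp (t *: Q^T) *m p0 @[t --> +oo] --> pi.
Proof.
move=> [Q0 Q1] upi pge0 psum; apply: (unique_invariant_cvg upi) => //.
have mQ : metzler Q^T by move=> i j ij; rewrite mxE Q0// eq_sym.
have sQ j : \sum_i Q^T i j = 0 by rewrite -[RHS](Q1 j); apply: eq_bigr => i _; rewrite mxE.
have [C C0 HC] := generator_mexp_decay p0 mQ sQ.
apply/cvg_mxP => i j; rewrite (ord1 j) [X in _ --> X]mxE.
apply/cvgr0Pnorm_le => e e0; near=> t.
have t0 : 0 < t by near: t; apply: nbhs_pinfty_gt; rewrite num_real.
have : `|(Q^T *m (mexp (t *: Q^T) *m p0)) i 0| * Num.sqrt t <= C by exact: HC.
rewrite -ler_pdivlMr ?sqrtr_gt0// => /le_trans; apply.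
rewrite ler_pdivrMr ?sqrtr_gt0// mulrC -ler_pdivrMr//.
rewrite -[leLHS]ger0_norm ?divr_ge0 ?(ltW e0)// -sqrtr_sqr; apply: ler_wsqrtr.
by near: t; apply: nbhs_pinfty_ge; rewrite num_real.
Unshelve. all: by end_near. Qed.

End MarkovConvergence.

(** * The linear system for the moments *)

Section MomentSystem.
Context {R : realType} {d : nat}.
Variables (Q : 'M[R]_d) (alpha gamma sigma : 'cV[R]_d).

Let Al := diagc alpha.
Let Ga := diagc gamma.
Let Si := diagc (sqvec sigma).

Lemma mx_derive_block m1 m2 n1 n2 (F1 : R -> 'M[R]_(m1, n1)) (F2 : R -> 'M[R]_(m1, n2))
    (F3 : R -> 'M[R]_(m2, n1)) (F4 : R -> 'M[R]_(m2, n2)) t D1 D2 D3 D4 :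
  mx_derive F1 t D1 -> mx_derive F2 t D2 -> mx_derive F3 t D3 -> mx_derive F4 t D4 ->
  mx_derive (fun s => block_mx (F1 s) (F2 s) (F3 s) (F4 s)) t (block_mx D1 D2 D3 D4).
Proof.
move=> d1 d2 d3 d4 i j.
case: (split_ordP i) => k ->; case: (split_ordP j) => l ->.
- by rewrite block_mxEul; under eq_fun do rewrite block_mxEul.
- by rewrite block_mxEur; under eq_fun do rewrite block_mxEur.
- by rewrite block_mxEdl; under eq_fun do rewrite block_mxEdl.
- by rewrite block_mxEdr; under eq_fun do rewrite block_mxEdr.
Qed.

Lemma mx_derive_col m1 m2 n (F1 : R -> 'M[R]_(m1, n)) (F2 : R -> 'M[R]_(m2, n)) t D1 D2 :
  mx_derive F1 t D1 -> mx_derive F2 t D2 ->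
  mx_derive (fun s => col_mx (F1 s) (F2 s)) t (col_mx D1 D2).
Proof.
move=> d1 d2 i j; case: (split_ordP i) => k ->.
- by rewrite col_mxEu; under eq_fun do rewrite col_mxEu.
- by rewrite col_mxEd; under eq_fun do rewrite col_mxEd.
Qed.

Lemma mx_derive_usub m1 m2 n (F : R -> 'M[R]_(m1 + m2, n)) t D :
  mx_derive F t D -> mx_derive (fun s => usubmx (F s)) t (usubmx D).
Proof. by move=> dF i j; rewrite mxE; under eq_fun do rewrite mxE; exact: dF. Qed.

Lemma mx_derive_dsub m1 m2 n (F : R -> 'M[R]_(m1 + m2, n)) t D :
  mx_derive F t D -> mx_derive (fun s => dsubmx (F s)) t (dsubmx D).
Proof. by move=> dF i j; rewrite mxE; under eq_fun do rewrite mxE; exact: dF. Qed.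

Lemma mx_deriveZ m n (f : R -> R) (F : R -> 'M[R]_(m, n)) t f' F' :
  is_derive t (1 : R) f f' -> mx_derive F t F' ->
  mx_derive (fun s => f s *: F s) t (f' *: F t + f t *: F').
Proof.
move=> df dF i j; rewrite !mxE (_ : (fun _ => _) = f * (fun s => F s i j)).
  apply: is_derive_eq; first exact: (@is_deriveM R R^o f (fun s => F s i j) t 1 f' (F' i j) df (dF i j)).
  by rewrite /GRing.scale/= addrC [F t i j * _]mulrC.
by apply/funext => s; rewrite mxE.
Qed.

Let G (h : R) : 'M[R]_d := 1%:M + h *: - Ga.
Let E (h : R) : 'M[R]_d := mexp (h *: Q^T).

(** Generator of the triangular system satisfied by the stacked vector (p, nu, w). *)
Definition moment_gen : 'M[R]_(d + (d + d)) :=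
  block_mx Q^T 0 (col_mx Al Si)
    (block_mx (Qbar Q gamma) 0 (2 *: Al) (Qbar Q (2 *: gamma))).

(** One step of the scheme on the stacked vector (p, nu, w). The matrix [E h] moves the chain and
    [G h] is the damping by 1 - h gamma; the blocks of w come from expanding the square of (1 - h
    gamma) N + h alpha + sigma D, where D^2 contributes [h] and D contributes 0. *)
Definition moment_step h : 'M[R]_(d + (d + d)) :=
  block_mx (E h) 0 (col_mx (h *: (Al *m E h)) (h *: ((h *: (Al *m Al) + Si) *m E h)))
    (block_mx (G h *m E h) 0 (h *: (2 *: (Al *m (G h *m E h)))) (G h *m (G h *m E h))).

Let E0 : E 0 = 1%:M. Proof. by rewrite /E scale0r mexp0. Qed.
Let G0 : G 0 = 1%:M. Proof. by rewrite /G scale0r addr0. Qed.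

Lemma moment_step0 : moment_step 0 = 1%:M.
Proof.
by rewrite /moment_step !scale0r E0 G0 !mul1mx col_mx0 -!scalar_mx_block.
Qed.

Let did (t : R) : is_derive t (1 : R) (fun s : R => s) 1.
Proof. exact: is_derive_id. Qed.

Let dE : mx_derive E 0 Q^T.
Proof. by have := mx_derive_mexp Q^T 0; rewrite scale0r mexp0 mul1mx. Qed.

Let dG : mx_derive G 0 (- Ga).
Proof.
have := mx_deriveD (mx_derive_cst (1%:M : 'M[R]_d) 0)
  (mx_deriveZ (did 0) (mx_derive_cst (- Ga) 0)).
by rewrite scaler0 addr0 scale1r add0r.
Qed.

Let dscale m n (F : R -> 'M[R]_(m, n)) F' : mx_derive F 0 F' ->
  mx_derive (fun h => h *: F h) 0 (F 0).
Proof. by move=> dF; have := mx_deriveZ (did 0) dF; rewrite scale1r scale0r addr0. Qed.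

(** Terms of order h^2 disappear. The two factors [G] in the last block each contribute -
    diag(gamma), which is how [2 *: gamma] arises in the equation of w. *)
Lemma mx_derive_moment_step : mx_derive moment_step 0 moment_gen.
Proof.
have dGE := mx_deriveM dG dE.
rewrite E0 G0 mulmx1 mul1mx in dGE.
have dGE' : mx_derive (fun h => G h *m E h) 0 (Qbar Q gamma).
  by rewrite /Qbar addrC.
have dGGE := mx_deriveM dG dGE'.
rewrite /= E0 G0 !mulmx1 mul1mx in dGGE.
apply: mx_derive_block => //; first exact: mx_derive_cst.
- apply: mx_derive_col.
  + have := dscale (mx_deriveM (mx_derive_cst Al 0) dE).
    by rewrite E0 mulmx1.
  + have dS : mx_derive (fun h : R => h *: (Al *m Al) + Si) 0 (Al *m Al).
      have := mx_deriveD (mx_deriveZ (did 0) (mx_derive_cst (Al *m Al) 0)) (mx_derive_cst Si 0).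
      by rewrite scaler0 scale1r !addr0.
    by have := dscale (mx_deriveM dS dE); rewrite E0 mulmx1 scale0r add0r.
- apply: mx_derive_block => //; first exact: mx_derive_cst.
  + have := dscale (mx_deriveM (mx_derive_cst (2 *: Al) 0) dGE').
    rewrite E0 G0 !mulmx1.
    by under [X in mx_derive X]eq_fun do rewrite -scalemxAl.
  + move: dGGE; rewrite /Qbar.
    have -> : diagc (2 *: gamma) = Ga + Ga.
      apply/matrixP => i j; rewrite !mxE; case: (i == j); rewrite ?mulr1n ?mulr0n ?addr0//.
      by rewrite mulr_natl mulr2n.
    by rewrite opprD [Q^T + (_ + _)]addrA [- Ga + _]addrC.
Qed.

(** The functions [nut] and [wt] are blocks of a single exponential in dimension 3d, so they solve
    the differential equations by construction; the two recursions are blocks of powers of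
    [moment_step], and [euler_mexp] identifies their limit. The later sections use nothing else of
    this construction. *)
Lemma moment_systemP (p0 nu0 w0 : 'cV[R]_d) :
  exists nut wt : R -> 'cV[R]_d,
  [/\ nut 0 = nu0, wt 0 = w0,
   forall t, mx_derive nut t (Qbar Q gamma *m nut t + Al *m (mexp (t *: Q^T) *m p0)),
   forall t, mx_derive wt t (Qbar Q (2 *: gamma) *m wt t
     + (2 *: (Al *m nut t) + Si *m (mexp (t *: Q^T) *m p0))) &
   forall T, 0 <= T -> forall nun wn : nat -> nat -> 'cV[R]_d,
     (forall n, nun n 0%N = nu0) -> (forall n, wn n 0%N = w0) ->
     (forall n k, let h := T / n.+1%:R in let p := mexp ((k.+1%:R * h) *: Q^T) *m p0 in
       nun n k.+1 = G h *m (E h *m nun n k) + h *: (Al *m p)) ->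
     (forall n k, let h := T / n.+1%:R in let p := mexp ((k.+1%:R * h) *: Q^T) *m p0 in
       wn n k.+1 = G h *m (G h *m (E h *m wn n k))
         + h *: (2 *: (Al *m (G h *m (E h *m nun n k))))
         + h *: ((h *: (Al *m Al) + Si) *m p)) ->
     (nun n n.+1 @[n --> \oo] --> nut T) /\ (wn n n.+1 @[n --> \oo] --> wt T)].
Proof.
pose z0 := col_mx p0 (col_mx nu0 w0).
pose z t := mexp (t *: moment_gen) *m z0.
have dz t : mx_derive z t (moment_gen *m z t).
  have := mx_deriveM (mx_derive_mexp moment_gen t) (mx_derive_cst z0 t).
  by rewrite mulmx0 addr0 -mexp_scale_comm -mulmxA.
pose pt t := usubmx (z t); pose nut t := usubmx (dsubmx (z t)).
pose wt t := dsubmx (dsubmx (z t)).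
have zE t : z t = col_mx (pt t) (col_mx (nut t) (wt t)) by rewrite !vsubmxK.
have AzE t : moment_gen *m z t = col_mx (Q^T *m pt t)
   (col_mx (Qbar Q gamma *m nut t + Al *m pt t)
     (Qbar Q (2 *: gamma) *m wt t + (2 *: (Al *m nut t) + Si *m pt t))).
  rewrite zE mul_block_col mul0mx addr0 mul_col_mx mul_block_col mul0mx addr0.
  by rewrite add_col_mx -scalemxAl; congr (col_mx _ (col_mx _ _)); rewrite addrC// addrA [_ + Qbar _ _ *m _]addrC.
have z00 : z 0 = z0 by rewrite /z scale0r mexp0 mul1mx.
have ptE t : pt t = mexp (t *: Q^T) *m p0.
  have dp s : mx_derive pt s (Q^T *m pt s + 0).
    by have := mx_derive_usub (dz s); rewrite AzE col_mxKu addr0.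
  have dc s : mx_derive (fun s => mexp ((t - s) *: Q^T) *m pt s) s 0.
    by have := @mx_derive_duhamel _ _ _ _ _ t dp s; rewrite mulmx0.
  have := mx_derive0 dc t 0; rewrite subrr subr0 scale0r mexp0 mul1mx => ->.
  by rewrite /pt z00 col_mxKu.
exists nut, wt; split.
- by rewrite /nut z00 col_mxKd col_mxKu.
- by rewrite /wt z00 !col_mxKd.
- move=> t; have := mx_derive_usub (mx_derive_dsub (dz t)).
  by rewrite AzE col_mxKd col_mxKu ptE.
- move=> t; have := mx_derive_dsub (mx_derive_dsub (dz t)).
  by rewrite AzE !col_mxKd ptE.
move=> T T0 nun wn nu00 w00 nurec wrec.
have Hz n k : let h := T / n.+1%:R in
    moment_step h ^+ k *m z0 = col_mx (mexp ((k%:R * h) *: Q^T) *m p0) (col_mx (nun n k) (wn n k)).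
  move=> h; elim: k => [|k IH].
    by rewrite expr0 mul1mx mul0r scale0r mexp0 mul1mx nu00 w00.
  rewrite exprS -[moment_step h * _]/(_ *m _) -mulmxA IH.
  rewrite /moment_step mul_block_col mul0mx addr0 mul_col_mx mul_block_col mul0mx addr0 add_col_mx.
  have pE : E h *m (mexp ((k%:R * h) *: Q^T) *m p0) = mexp ((k.+1%:R * h) *: Q^T) *m p0.
    by rewrite mulmxA -mexpDscale -natr1 mulrDl mul1r addrC.
  rewrite pE nurec wrec /= -!scalemxAl -!mulmxA pE.
  congr (col_mx _ (col_mx _ _)); first by rewrite addrC.
  by rewrite addrA [_ + G h *m _]addrC addrAC addrA addrAC.
have /cvg_mxP H := euler_mexp mx_derive_moment_step moment_step0 T0.
have {}H : moment_step (T / n.+1%:R) ^+ n.+1 *m z0 @[n --> \oo] --> z T.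
  apply/cvg_mxP => i j; rewrite [X in _ --> X]mxE; under eq_cvg do rewrite mxE.
  apply: cvg_big => [|k _]; first exact: add_continuous.
  by apply: cvgM; [exact: H|exact: cvg_cst].
move/cvg_mxP in H; split; apply/cvg_mxP => i j.
  have := H (rshift d (lshift d i)) j; rewrite zE col_mxEd col_mxEu.
  by under eq_cvg do rewrite Hz col_mxEd col_mxEu.
have := H (rshift d (rshift d i)) j; rewrite zE !col_mxEd.
by under eq_cvg do rewrite Hz !col_mxEd.
Qed.

End MomentSystem.

Lemma eq_vint {R : realType} {d : nat} (t : R) (f g : R -> 'cV[R]_d) :
  (forall s, 0 <= s -> f s = g s) -> vint t f = vint t g.
Proof.
move=> fg; apply/matrixP => i j; rewrite !mxE; apply: eq_Rintegral => s.
by rewrite inE /= in_itv/= => /andP[s0 _]; rewrite fg.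
Qed.

Section LinearSystem.
Context {R : realType} {d : nat}.
Implicit Types (Q : 'M[R]_d) (u v : 'cV[R]_d).

Lemma diagc_mulE v u i : (diagc v *m u) i 0 = v i 0 * u i 0.
Proof. by rewrite /diagc mul_diag_mx !mxE. Qed.

Lemma Qbar_metzler Q v : is_generator Q -> metzler (Qbar Q v).
Proof.
move=> [Q0 _] i j ij; rewrite !mxE (negPf ij) mulr0n subr0.
by apply: Q0; rewrite eq_sym.
Qed.

Lemma Qbar_col_sum Q v j : is_generator Q -> \sum_i Qbar Q v i j = - v j 0.
Proof.
move=> [_ Q1]; under eq_bigr do rewrite !mxE.
rewrite big_split/= Q1 add0r sumrN (bigD1 j)//= eqxx mulr1n big1 ?addr0// => i ij.
by rewrite (negPf ij) mulr0n.
Qed.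

(** The inverse of the sum of inverses avoids selecting a least entry; the added 1 covers the case
    [d = 0]. *)
Lemma pos_lower_bound v : (forall i, 0 < v i 0) -> exists2 c : R, 0 < c & forall i, c <= v i 0.
Proof.
move=> v0; have s0 : 0 < \sum_i (v i 0)^-1 + 1.
  by rewrite ltr_wpDl// sumr_ge0// => i _; rewrite invr_ge0 ltW.
exists (\sum_i (v i 0)^-1 + 1)^-1; first by rewrite invr_gt0.
move=> i; rewrite -[leRHS]invrK lef_pV2 ?posrE// ?invr_gt0//.
rewrite (bigD1 i)//= -addrA lerDl addr_ge0// sumr_ge0// => k _.
by rewrite invr_ge0 ltW.
Qed.

Lemma Qbar_unitmx Q v : is_generator Q -> (forall i, 0 < v i 0) -> Qbar Q v \in unitmx.
Proof.
move=> hQ /pos_lower_bound[c c0 cv]; apply: (metzler_unitmx (Qbar_metzler _ hQ) c0) => j.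
by rewrite Qbar_col_sum// lerN2.
Qed.

Lemma Qbar_ode_cvg Q v (y b : R -> 'cV[R]_d) (bl : 'cV[R]_d) :
  is_generator Q -> (forall i, 0 < v i 0) ->
  (forall s, mx_derive y s (Qbar Q v *m y s + b s)) ->
  b t @[t --> +oo] --> bl -> y t @[t --> +oo] --> - (invmx (Qbar Q v) *m bl).
Proof.
move=> hQ v0 dy bbl; have [c c0 cv] := pos_lower_bound v0.
apply: (@linear_ode_cvg _ _ _ y b bl d%:R c) => //; last exact: Qbar_unitmx.
move=> t t0; apply: mexp_l1_le => //; first exact: Qbar_metzler.
by move=> j; rewrite Qbar_col_sum// lerN2.
Qed.

Lemma cvg_diagc (f : R -> 'cV[R]_d) v u :
  f t @[t --> +oo] --> u -> diagc v *m f t @[t --> +oo] --> diagc v *m u.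
Proof.
move=> /cvg_mxP fu; apply/cvg_mxP => i j; rewrite (ord1 j) diagc_mulE.
by under eq_fun do rewrite diagc_mulE; apply: cvgM => //; exact: cvg_cst.
Qed.

Lemma cvg_ones_dot (f : R -> 'cV[R]_d) u :
  f t @[t --> +oo] --> u -> ones_dot (f t) @[t --> +oo] --> ones_dot u.
Proof.
move=> /cvg_mxP fu; rewrite ones_dotE; under eq_fun do rewrite ones_dotE.
by apply: cvg_big => [|i _]; [exact: add_continuous|exact: fu].
Qed.

Lemma mexp_mul_kernel (A : 'M[R]_d) u t : A *m u = 0 -> mexp (t *: A) *m u = u.
Proof.
move=> Au; have dF s : mx_derive (fun s => mexp (s *: A) *m u) s 0.
  by move=> i j; have := is_derive_mexp_mul A u i j s; rewrite Au mulmx0.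
by rewrite (mx_derive0 dF t 0) scale0r mexp0 mul1mx.
Qed.

Lemma mexp_continuous (A : 'M[R]_d) u i : continuous (fun s : R => (mexp (s *: A) *m u) i 0).
Proof.
apply: (@mx_derive_continuous _ _ _ (fun s => mexp (s *: A) *m u) (fun s => mexp (s *: A) *m (A *m u))).
by move=> s k l; exact: is_derive_mexp_mul.
Qed.

End LinearSystem.

(** * Moments of centered normal laws *)

Section NormalMoments.
Context {R : realType}.
Local Notation mu := (@lebesgue_measure R).

Lemma ge0_integral_oppr (f : R -> \bar R) : measurable_fun [set: R] f ->
  (forall x, (0 <= f x)%E) -> (\int[mu]_x f x = \int[mu]_x f (- (x : R))%R)%E.
Proof.
move=> mf f0; have mo : measurable_fun setT (-%R : measurableTypeR R -> measurableTypeR R).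
  exact: oppr_measurable.
rewrite -[RHS](@ge0_integral_pushforward _ _ (measurableTypeR R) (measurableTypeR R) R _ mo mu setT f)//.
apply: (@eq_measure_integral _ _ _ _ (measure_function_pushforward__canonical__measure_function_Measure mu mo)) => A mA AS.
exact/esym/lebesgue_measureN.
Qed.

(** The Radon-Nikodym density of the normal law and [normal_pdf] have the same integral over every
    measurable set, so they agree almost everywhere. *)
Lemma ge0_integral_normal_prob (s : R) (f : R -> \bar R) : s != 0 ->
  measurable_fun [set: R] f -> (forall x, (0 <= f x)%E) ->
  (\int[normal_prob 0 s]_x f x = \int[mu]_x (f x * (normal_pdf 0 s x)%:E))%E.
Proof.
move=> s0 mf f0.
have dom := @normal_prob_dominates R 0 s.
rewrite -(Radon_Nikodym_SigmaFinite.change_of_variables dom f0)//.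
have mg := Radon_Nikodym_SigmaFinite.f_integrable dom.
set g := Radon_Nikodym_SigmaFinite.f _ _ in mg *.
have mpdf : measurable_fun [set: R] (fun x => (normal_pdf 0 s x)%:E).
  by apply/measurable_EFinP; exact: measurable_normal_pdf.
apply: ae_eq_integral => //.
- by apply: emeasurable_funM => //; exact: measurable_int mg.
- exact: emeasurable_funM.
have : ae_eq mu setT g (fun x => (normal_pdf 0 s x)%:E).
  apply: integral_ae_eq => //.
  by move=> E _ mE; rewrite -(Radon_Nikodym_SigmaFinite.f_integral dom).
by apply: filterS => x /= gx Dx; rewrite gx.
Qed.

Variable s : R.
Hypothesis s0 : 0 < s.
Let g : R -> R := normal_pdf (0 : R) s.
Let sn : s != 0. Proof. by rewrite gt_eqF. Qed.

Let gE x : g x = normal_peak s * expR (- (x ^+ 2 / (s ^+ 2 *+ 2))).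
Proof. by rewrite /g normal_pdfE ?gt_eqF// /normal_fun subr0 mulNr. Qed.

Let g0 x : 0 <= g x. Proof. exact: normal_pdf_ge0. Qed.

Let gN x : g (- x) = g x. Proof. by rewrite !gE sqrrN. Qed.

Let mg : measurable_fun [set: R] g. Proof. exact: measurable_normal_pdf. Qed.

Let dg (x : R) : is_derive x (1 : R) g (- (x / s ^+ 2) * g x).
Proof.
have dx2 : is_derive x (1 : R) (fun x : R => x ^+ 2) (2 * x).
  have := @is_deriveM R R^o id id x 1 1 1 (is_derive_id x 1) (is_derive_id x 1).
  by rewrite [x *: 1]mulr1 mulrDl mul1r.
have dq := @is_deriveZ R R^o R^o (fun x : R => x ^+ 2) (- (s ^+ 2 *+ 2)^-1) x 1 _ dx2.
have de := @is_derive1_comp R expR _ x _ _ (is_derive_expR _) dq.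
have := @is_deriveZ R R^o R^o _ (normal_peak s) x 1 _ de.
rewrite (_ : normal_peak s \*: _ = g); last first.
  apply/funext => y; rewrite gE /= /GRing.scale/=; congr (_ * expR _).
  by rewrite mulNr mulrC.
move=> H; apply: (is_derive_eq H); rewrite gE /GRing.scale/= -mulr_natr.
have -> : expR (- (s ^+ 2 * 2)^-1 * x ^+ 2) = expR (- (x ^+ 2 / (s ^+ 2 * 2))).
  by congr expR; rewrite mulNr mulrC.
move: (normal_peak s) (expR _) => c u.
rewrite -/(_ * _).
by field.
Qed.

Let cg : continuous g.
Proof. by move=> x; apply/differentiable_continuous/derivable1_diffP; have [] := dg x. Qed.

(** An antiderivative of (x^2 - s^2) g. It vanishes at 0 and at infinity, which is the reason why
    the second moment is s^2. *)
Let F (x : R) : R := - (s ^+ 2 * x * g x).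

Let dF (x : R) : is_derive x (1 : R) F ((x ^+ 2 - s ^+ 2) * g x).
Proof.
have d1 := @is_deriveM R R^o id g x 1 _ _ (is_derive_id x 1) (dg x).
have := @is_deriveZ R R^o R^o _ (- s ^+ 2) x 1 _ d1.
rewrite (_ : - s ^+ 2 \*: _ = F); last first.
  apply/funext => y; rewrite /F /= /GRing.scale/= [(id * g) y]/(y * g y).
  by rewrite mulNr -[_ * (g y)]/(_ * _) mulrA.
by move=> H; apply: (is_derive_eq H); rewrite /GRing.scale/= mulr1; field.
Qed.

Let cF : continuous F.
Proof. by move=> x; apply/differentiable_continuous/derivable1_diffP; have [] := dF x. Qed.

(** The crude bound e^{-q} <= 1/q with q = x^2 / (2 s^2) makes |F x| at most [K / x]. *)
Let Flim : F x @[x --> +oo] --> (0 : R).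
Proof.
pose v : R := s ^+ 2 * 2.
have v0 : 0 < v by rewrite mulr_gt0// exprn_gt0.
pose K : R := normal_peak s * s ^+ 2 * v.
have pk0 := normal_peak_ge0 s.
have K0 : 0 <= K by rewrite /K mulr_ge0 ?(ltW v0)// mulr_ge0// sqr_ge0.
have s0' := ltW s0; apply/cvgr0Pnorm_le => /= e e0; near=> x.
have x0 : 0 < x by near: x; apply: nbhs_pinfty_gt; rewrite num_real.
apply: (@le_trans _ _ (K / x)); last first.
  have H : K / e <= x by near: x; apply: nbhs_pinfty_ge; rewrite num_real.
  by rewrite ler_pdivrMr// mulrC -ler_pdivrMr.
have q0 : 0 < x ^+ 2 / v by rewrite divr_gt0// exprn_gt0.
have s2x : 0 <= s ^+ 2 * x by rewrite mulr_ge0 ?sqr_ge0// ltW.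
rewrite /F normrN ger0_norm ?mulr_ge0//.
have H : expR (- (x ^+ 2 / v)) <= (x ^+ 2 / v)^-1.
  rewrite expRN lef_pV2 ?posrE ?expR_gt0//.
  by rewrite (le_trans _ (expR_ge1Dx _))// lerDr.
rewrite gE -mulr_natr -/v.
apply: (@le_trans _ _ (s ^+ 2 * x * (normal_peak s * (x ^+ 2 / v)^-1))).
  by rewrite ler_wpM2l// ler_wpM2l.
rewrite le_eqVlt; apply/orP; left; apply/eqP; rewrite /K.
by field; rewrite !gt_eqF.
Unshelve. all: by end_near. Qed.

(** The integrand (x^2 - s^2) g changes sign at [s]. The half line is cut there because the
    fundamental theorem on an unbounded interval is applied to a nonnegative function. *)
Let integral_ge : (\int[mu]_(x in `[s, +oo[) ((x ^+ 2 - s ^+ 2) * g x)%:E = (s ^+ 3 * g s)%:E)%E.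
Proof.
rewrite (@ge0_continuous_FTC2y _ (fun x => (x ^+ 2 - s ^+ 2) * g x) F s 0).
- by rewrite /F -EFinB sub0r opprK; congr EFin; ring.
- by move=> x sx; rewrite mulr_ge0// subr_ge0 ler_sqr ?nnegrE ?(ltW s0)// (le_trans (ltW s0)).
- apply: continuous_subspaceT => x; apply: cvgM; last exact: cg.
  by apply: cvgB; [exact: exprn_continuous|exact: cvg_cst].
- exact: Flim.
- by move=> x _; have [] := dF x.
- by apply: cvg_at_right_filter; exact: cF.
- by move=> x _; rewrite derive1E; have [_ ->] := dF x.
Qed.

Let integral_le : (\int[mu]_(x in `[0%R, s]) ((s ^+ 2 - x ^+ 2) * g x)%:E = (s ^+ 3 * g s)%:E)%E.
Proof.
have dNF x : is_derive x (1 : R) (fun x => - F x) ((s ^+ 2 - x ^+ 2) * g x).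
  have dFN := @is_deriveN _ _ _ F x 1 _ (dF x).
  by apply: (is_derive_eq dFN); rewrite -mulNr opprB.
rewrite (@continuous_FTC2 _ (fun x => (s ^+ 2 - x ^+ 2) * g x) (fun x => - F x))//.
- by rewrite /F mulr0 mul0r opprK !oppr0 sube0; congr EFin; ring.
- apply: continuous_subspaceT => x; apply: cvgM; last exact: cg.
  by apply: cvgB; [exact: cvg_cst|exact: exprn_continuous].
- split=> [x _||].
  + by have [] := dNF x.
  + by apply: cvg_at_right_filter; apply: cvgN; exact: cF.
  + by apply: cvg_at_left_filter; apply: cvgN; exact: cF.
- by move=> x _; rewrite derive1E; have [_ ->] := dNF x.
Qed.

Let mpg (p : R -> R) (D : set R) : measurable D -> continuous p ->
  measurable_fun D (fun x => (p x * g x)%:E).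
Proof.
move=> mD cp; apply/measurable_funTS/measurable_EFinP/measurable_funM => //.
exact: continuous_measurable_fun.
Qed.

(** On [0, s[ the side with s^2 exceeds the other by s^3 g(s), on [s, +oo[ it falls short by the
    same amount. *)
Let half_moment2 : (\int[mu]_(x in `[0%R, +oo[) (x ^+ 2 * g x)%:E =
  \int[mu]_(x in `[0%R, +oo[) (s ^+ 2 * g x)%:E)%E.
Proof.
have sq : continuous (fun x : R => x ^+ 2) by exact: exprn_continuous.
have cs (c : R) : continuous (fun x : R => c) by move=> ?; exact: cvg_cst.
have cB1 : continuous (fun x : R => x ^+ 2 - s ^+ 2).
  by move=> x; apply: cvgB; [exact: sq|exact: cs].
have cB2 : continuous (fun x : R => s ^+ 2 - x ^+ 2).
  by move=> x; apply: cvgB; [exact: cs|exact: sq].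
have US : `[0%R, +oo[%classic = `[0%R, s[ `|` `[s, +oo[ :> set R.
  by apply: itv_bndbnd_setU => //; rewrite bnd_simp ltW.
have disj : [disjoint `[0%R, s[%classic & `[s, +oo[%classic :> set R].
  apply/disj_setPS => x [] /=; rewrite !in_itv/= andbT => /andP[_ xs] sx.
  by move: (lt_le_trans xs sx); rewrite ltxx.
have sg0 x : (0 <= (s ^+ 2 * g x)%:E)%E by rewrite lee_fin mulr_ge0 ?sqr_ge0.
have xg0 x : (0 <= (x ^+ 2 * g x)%:E)%E by rewrite lee_fin mulr_ge0 ?sqr_ge0.
rewrite US ge0_integral_setU//; last by apply: mpg => //; exact: measurableU.
rewrite ge0_integral_setU//; last by apply: mpg => //; exact: measurableU.
have E1 : (\int[mu]_(x in `[0%R, s[) (s ^+ 2 * g x)%:E =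
    \int[mu]_(x in `[0%R, s[) (x ^+ 2 * g x)%:E + (s ^+ 3 * g s)%:E)%E.
  rewrite -integral_le -(@integral_itv_bndo_bndc R _ s (fun x => ((s ^+ 2 - x ^+ 2) * g x)%:E)).
    rewrite -ge0_integralD//; last 3 first.
    - exact: mpg.
    - move=> x /=; rewrite in_itv/= => /andP[x0 xs]; rewrite lee_fin mulr_ge0// subr_ge0.
      by rewrite ler_sqr ?nnegrE// ltW// (le_lt_trans x0).
    - exact: mpg.
    by apply: eq_integral => x _; rewrite -EFinD; congr EFin; ring.
  exact: mpg.
have E2 : (\int[mu]_(x in `[s, +oo[) (x ^+ 2 * g x)%:E =
    \int[mu]_(x in `[s, +oo[) (s ^+ 2 * g x)%:E + (s ^+ 3 * g s)%:E)%E.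
  rewrite -integral_ge -ge0_integralD//; last 3 first.
  - exact: mpg.
  - move=> x /=; rewrite in_itv/= andbT => sx; rewrite lee_fin mulr_ge0// subr_ge0.
    by rewrite ler_sqr ?nnegrE ?(ltW s0)// (le_trans (ltW s0)).
  - exact: mpg.
  by apply: eq_integral => x _; rewrite -EFinD; congr EFin; ring.
by rewrite E1 E2 -addeA [(_%:E + _)%E]addeC.
Qed.

Lemma normal_moment2 : (\int[normal_prob 0 s]_x (x ^+ 2)%:E = (s ^+ 2)%:E)%E.
Proof.
have sq : continuous (fun x : R => x ^+ 2) by exact: exprn_continuous.
rewrite ge0_integral_normal_prob//; last 2 first.
- by apply/measurable_EFinP; exact: continuous_measurable_fun.
- by move=> x; rewrite lee_fin sqr_ge0.
under eq_integral do rewrite -EFinM -/(g _).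
rewrite (@ge0_symfun_integralT _ (fun x => x ^+ 2 * g x)).
- rewrite -set_itvcy half_moment2 set_itvcy -(@ge0_symfun_integralT _ (fun x => s ^+ 2 * g x)).
  + under eq_integral do rewrite EFinM.
    rewrite ge0_integralZl//.
    * by rewrite integral_normal_pdf mule1.
    * exact/measurable_EFinP.
    * by move=> x _; rewrite lee_fin; exact: g0.
    * by rewrite lee_fin sqr_ge0.
  + by move=> x; rewrite mulr_ge0 ?sqr_ge0.
  + by move=> x; apply: cvgM; [exact: cvg_cst|exact: cg].
  + by move=> x /=; rewrite gN.
- by move=> x; rewrite mulr_ge0 ?sqr_ge0.
- by move=> x; apply: cvgM; [exact: sq|exact: cg].
- by move=> x /=; rewrite sqrrN gN.
Qed.

(** The positive and negative parts have equal integrals by reflection; their difference is 0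
    because both are finite, being dominated by 1 + x^2. *)
Lemma normal_moment1 : (\int[normal_prob 0 s]_x x%:E = 0)%E.
Proof.
have mp : measurable_fun [set: R] (fun x : R => (x%:E : \bar R)) by exact/measurable_EFinP.
rewrite integralE ge0_integral_normal_prob//; last exact: measurable_funepos.
rewrite [X in (_ - X)%E]ge0_integral_normal_prob//; last exact: measurable_funeneg.
set I := (\int[_]_x _)%E; set J := (\int[_]_x _)%E.
have IJ : I = J.
  rewrite /I ge0_integral_oppr//.
  - by apply: eq_integral => x _; rewrite -!/(g _) gN funeposE funenegE.
  - apply: emeasurable_funM; first exact: measurable_funepos.
    exact/measurable_EFinP.
  - by move=> x; rewrite mule_ge0// lee_fin.
have Jfin : J \is a fin_num.
  rewrite ge0_fin_numE; last by apply: integral_ge0 => x _; rewrite mule_ge0// lee_fin.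
  have : (J <= \int[normal_prob 0 s]_x (1 + x ^+ 2)%:E)%E.
    rewrite ge0_integral_normal_prob//; last 2 first.
    - apply/measurable_EFinP; apply: continuous_measurable_fun => x.
      by apply: cvgD; [exact: cvg_cst|exact: exprn_continuous].
    - by move=> x; rewrite lee_fin addr_ge0 ?sqr_ge0.
    apply: ge0_le_integral => //.
    - by move=> x _; rewrite mule_ge0// lee_fin.
    - by apply: emeasurable_funM; [exact: measurable_funeneg|exact/measurable_EFinP].
    - apply: emeasurable_funM; last exact/measurable_EFinP.
      apply/measurable_EFinP; apply: continuous_measurable_fun => x.
      by apply: cvgD; [exact: cvg_cst|exact: exprn_continuous].
    - move=> x _; rewrite lee_wpmul2r ?lee_fin// funenegE -EFinN -EFin_max lee_fin ge_max.
      by rewrite addr_ge0 ?sqr_ge0// andbT; nra.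
  move=> /le_lt_trans; apply.
  under eq_integral do rewrite EFinD.
  rewrite ge0_integralD//; last 2 first.
  - by move=> x _; rewrite lee_fin sqr_ge0.
  - by apply/measurable_EFinP; apply: continuous_measurable_fun; exact: exprn_continuous.
  - rewrite normal_moment2 integral_cst// mul1e.
    apply: (@le_lt_trans _ _ (1 + (s ^+ 2)%:E)%E); last by rewrite ltry.
    by rewrite leeD2r// probability_le1.
by rewrite IJ subee.
Qed.

End NormalMoments.

(** * Expectations and independence *)

Section Expectation.
Context {disp : measure_display} {Omega : measurableType disp} {R : realType}.
Variable P : probability Omega R.
Implicit Types (f g : Omega -> R) (c : R).

Definition L1 f := P.-integrable [set: Omega] (EFin \o f).

Definition Ex f : R := \int[P]_w f w.

Lemma L1_measurable f : L1 f -> measurable_fun [set: Omega] f.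
Proof. by move=> /measurable_int/measurable_EFinP. Qed.

Lemma L1_cst c : L1 (fun=> c).
Proof. exact: finite_measure_integrable_cst. Qed.

Lemma L1D f g : L1 f -> L1 g -> L1 (fun w => f w + g w).
Proof. by move=> lf lg; have := integrableD measurableT lf lg. Qed.

Lemma L1B f g : L1 f -> L1 g -> L1 (fun w => f w - g w).
Proof. by move=> lf lg; have := integrableB measurableT lf lg. Qed.

Lemma L1Z c f : L1 f -> L1 (fun w => c * f w).
Proof. by move=> lf; have := integrableZl measurableT c lf. Qed.

Lemma L1_sum (I : Type) (r : seq I) (p : pred I) (F : I -> Omega -> R) :
  (forall i, L1 (F i)) -> L1 (fun w => \sum_(i <- r | p i) F i w).
Proof.
move=> lF; elim: r => [|i r IH].
  by under eq_fun do rewrite big_nil; exact: L1_cst.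
under eq_fun do rewrite big_cons.
by case: (p i) => //; exact: L1D.
Qed.

Lemma L1_le f g : measurable_fun [set: Omega] f -> (forall w, `|f w| <= g w) ->
  L1 g -> L1 f.
Proof.
move=> mf fg lg; apply: (le_integrable measurableT _ _ lg).
  exact/measurable_EFinP.
by move=> w _; rewrite /= lee_fin (le_trans (fg w))// ler_norm.
Qed.

Lemma L1_bounded f c : measurable_fun [set: Omega] f -> (forall w, `|f w| <= c) ->
  L1 f.
Proof. by move=> mf fc; apply: (L1_le mf fc); exact: L1_cst. Qed.

Lemma L1_boundedM f g c : measurable_fun [set: Omega] f ->
  (forall w, `|f w| <= c) -> L1 g -> L1 (fun w => f w * g w).
Proof.
move=> mf fc lg; apply: (@L1_le _ (fun w => c * `|g w|)).
- by apply: measurable_funM => //; exact: L1_measurable.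
- by move=> w; rewrite normrM ler_wpM2r.
- by apply: L1Z; exact: integrable_norm.
Qed.

Lemma L1_ge0 f : measurable_fun [set: Omega] f -> (forall w, 0 <= f w) ->
  (\int[P]_w (f w)%:E < +oo)%E -> L1 f.
Proof.
move=> mf f0 fi; apply/integrableP; split; first exact/measurable_EFinP.
by under eq_integral => w _ do rewrite /= ger0_norm//.
Qed.

Lemma EFin_Ex f : L1 f -> (\int[P]_w (f w)%:E = (Ex f)%:E)%E.
Proof.
by move=> lf; rewrite /Ex /Rintegral fineK//; exact: integrable_fin_num.
Qed.

Lemma ExpectationE f : L1 f -> 'E_P[f]%E = (Ex f)%:E.
Proof. by move=> lf; rewrite unlock EFin_Ex. Qed.

Lemma eq_Ex f g : (forall w, f w = g w) -> Ex f = Ex g.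
Proof. by move=> fg; apply: eq_Rintegral => w _. Qed.

Lemma Ex_cst c : Ex (fun=> c) = c.
Proof. by rewrite /Ex Rintegral_cst// [fine _]/(fine (P setT)) probability_setT mulr1. Qed.

Lemma ExD f g : L1 f -> L1 g -> Ex (fun w => f w + g w) = Ex f + Ex g.
Proof. exact: RintegralD. Qed.

Lemma ExB f g : L1 f -> L1 g -> Ex (fun w => f w - g w) = Ex f - Ex g.
Proof. exact: RintegralB. Qed.

Lemma ExZ c f : L1 f -> Ex (fun w => c * f w) = c * Ex f.
Proof. by move=> lf; exact: RintegralZl. Qed.

Lemma Ex_sum (I : Type) (r : seq I) (p : pred I) (F : I -> Omega -> R) :
  (forall i, L1 (F i)) ->
  Ex (fun w => \sum_(i <- r | p i) F i w) = \sum_(i <- r | p i) Ex (F i).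
Proof.
move=> lF; elim: r => [|i r IH].
  by rewrite big_nil; under eq_Ex do rewrite big_nil; rewrite Ex_cst.
rewrite big_cons; under eq_Ex do rewrite big_cons.
by case: (p i) => //; rewrite ExD ?IH//; exact: L1_sum.
Qed.

Lemma Ex_ge0 f : (forall w, 0 <= f w) -> 0 <= Ex f.
Proof. by move=> f0; apply: Rintegral_ge0. Qed.

Lemma Ex_le f g : L1 f -> L1 g -> (forall w, f w <= g w) -> Ex f <= Ex g.
Proof. by move=> lf lg fg; apply: le_Rintegral. Qed.

Lemma Ex_norm_le f : L1 f -> `|Ex f| <= Ex (fun w => `|f w|).
Proof. by move=> lf; exact: le_normr_Rintegral. Qed.

Lemma Ex_ae_eq f g : measurable_fun [set: Omega] f ->
  measurable_fun [set: Omega] g -> {ae P, forall w, f w = g w} -> Ex f = Ex g.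
Proof.
move=> mf mg fg; rewrite /Ex /Rintegral; congr fine.
apply: ae_eq_integral => //; try exact/measurable_EFinP.
by apply: filterS fg => w /= ->.
Qed.

Lemma L1_ae_eq f g : measurable_fun [set: Omega] g ->
  {ae P, forall w, f w = g w} -> L1 f -> L1 g.
Proof.
move=> mg fg lf; apply/integrableP; split; first exact/measurable_EFinP.
rewrite (_ : integral _ _ _ = \int[P]_w `|(f w)%:E|)%E.
  by have /integrableP[] := lf.
apply: ae_eq_integral => //.
- by apply: measurableT_comp => //; exact/measurable_EFinP.
- apply: measurableT_comp => //; exact: measurable_int lf.
- by apply: filterS fg => w /= ->.
Qed.

Lemma Ex_indic (A : set Omega) : measurable A -> (Ex (\1_A : Omega -> R))%:E = P A.
Proof.
move=> mA; rewrite -EFin_Ex; last exact: integrable_indic.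
by rewrite integral_indic// setIT.
Qed.

Section Independence.
Variables Y Z : Omega -> R.
Hypotheses (mY : measurable_fun [set: Omega] Y) (mZ : measurable_fun [set: Omega] Z).
Hypothesis YZ : forall U V : set R, measurable U -> measurable V ->
  P (Y @^-1` U `&` Z @^-1` V) = (P (Y @^-1` U) * P (Z @^-1` V))%E.

Let rY : {RV P >-> R} := mfun_Sub (mem_set mY).
Let rZ : {RV P >-> R} := mfun_Sub (mem_set mZ).
Let mYZ : measurable_fun [set: Omega] (fun w => (Y w, Z w)).
Proof. exact: measurable_fun_pair. Qed.
Let rYZ : {RV P >-> (R * R)%type} := mfun_Sub (mem_set mYZ).

Let joint_law (A : set (R * R)) : measurable A ->
  distribution P rYZ A = (distribution P rY \x distribution P rZ)%E A.
Proof.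
move=> mA; apply/esym.
by apply: (product_measure_unique (m' := distribution P rYZ)).
Qed.

(** A Tonelli version comes first: used with the absolute value, it gives the integrability of the
    product, on which the Fubini argument of [indep_Ex] rests. *)
Let indep_norm (f : R -> R) : measurable_fun [set: R] f -> (forall x, 0 <= f x) ->
  (\int[P]_w (f (Y w) * f (Z w))%:E =
  (\int[P]_w (f (Y w))%:E) * (\int[P]_w (f (Z w))%:E))%E.
Proof.
move=> mf f0.
pose q (z : R * R) : \bar R := (f z.1 * f z.2)%:E.
have mq : measurable_fun [set: (R * R)%type] q.
  by apply/measurable_EFinP/measurable_funM; apply: measurableT_comp.
have q0 z : (0 <= q z)%E by rewrite lee_fin mulr_ge0.
transitivity (\int[distribution P rYZ]_z q z)%E; first by rewrite ge0_integral_distribution.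
transitivity (\int[(distribution P rY \x distribution P rZ)%E]_z q z)%E.
  by apply: eq_measure_integral => A mA _; exact: joint_law.
have mEf : measurable_fun [set: R] (EFin \o f) by exact/measurable_EFinP.
have Ef0 (x : R) : (0 <= (f x)%:E)%E by rewrite lee_fin.
rewrite fubini_tonelli1// /fubini_F /q /=.
under eq_integral do under eq_integral do rewrite EFinM.
under eq_integral => x _ do rewrite ge0_integralZl//.
rewrite ge0_integralZr//; last by apply: integral_ge0 => x _; rewrite lee_fin.
by congr (_ * _)%E; rewrite ge0_integral_distribution.
Qed.

Lemma indep_L1 : L1 Y -> L1 Z -> L1 (fun w => Y w * Z w).
Proof.
move=> lY lZ; apply/integrableP; split.
  by apply/measurable_EFinP/measurable_funM.
under eq_integral => w _ do rewrite /= normrM.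
rewrite (indep_norm (f := Num.norm))//.
apply: lte_mul_pinfty.
- exact: integral_ge0.
- by have /integrable_norm/integrable_fin_num := lY; exact.
- by have /integrableP[] := lZ.
Qed.

Lemma indep_Ex : L1 Y -> L1 Z -> Ex (fun w => Y w * Z w) = Ex Y * Ex Z.
Proof.
move=> lY lZ; have lYZ := indep_L1 lY lZ.
apply: EFin_inj; rewrite -EFin_Ex// EFinM -!EFin_Ex//.
pose q (z : R * R) : \bar R := (z.1 * z.2)%:E.
have mq : measurable_fun [set: (R * R)%type] q.
  by apply/measurable_EFinP/measurable_funM.
have iq : (distribution P rYZ).-integrable setT q.
  have : (P.-integrable (rYZ @^-1` setT) (q \o rYZ)) by [].
  by move/(integrable_pushforward mYZ mq); exact.
have iq' : ((distribution P rY \x distribution P rZ)%E).-integrable setT q.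
  apply/integrableP; split => //.
  have /integrableP[_] := iq.
  by rewrite (eq_measure_integral _ (fun A mA _ => joint_law mA)).
have lrY : (distribution P rY).-integrable setT EFin.
  by have := integrable_pushforward mY; apply => //; exact/measurable_EFinP.
have lrZ : (distribution P rZ).-integrable setT EFin.
  by have := integrable_pushforward mZ; apply => //; exact/measurable_EFinP.
transitivity (\int[distribution P rYZ]_z q z)%E.
  by rewrite integral_distribution.
transitivity (\int[(distribution P rY \x distribution P rZ)%E]_z q z)%E.
  by apply: eq_measure_integral => A mA _; exact: joint_law.
rewrite -integral12_prod_meas1// /fubini_F /q /=.
under eq_integral do under eq_integral do rewrite EFinM.
under eq_integral => x _ do rewrite integralZl//.
have lrZf : (\int[distribution P rZ]_y y%:E)%E \is a fin_num by exact: integrable_fin_num.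
rewrite -(fineK lrZf) integralZr// fineK//.
by congr (_ * _)%E; rewrite integral_distribution.
Qed.

End Independence.

End Expectation.

(** Bounded second moments give uniform integrability. Fatou's lemma bounds the limit; then, with Y
    the distance of f_n to f, Y <= min(Y, K) + Y^2 / K: the first term is treated by dominated
    convergence, the second is small for large K. *)
Lemma Ex_cvg_sq_bounded {disp : measure_display} {Omega : measurableType disp} {R : realType}
  (P : probability Omega R) (f_ : nat -> Omega -> R) (f : Omega -> R) (C : R) :
  (forall n, measurable_fun [set: Omega] (f_ n)) -> measurable_fun [set: Omega] f ->
  (forall n, L1 P (fun w => f_ n w ^+ 2)) -> (forall n, Ex P (fun w => f_ n w ^+ 2) <= C) ->
  {ae P, forall w, f_ n w @[n --> \oo] --> f w} ->
  [/\ L1 P (fun w => f w ^+ 2), L1 P f & Ex P (f_ n) @[n --> \oo] --> Ex P f].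
Proof.
move=> mf_ mf l2 eC fcvg.
have mfE n : measurable_fun [set: Omega] (fun w => (f_ n w ^+ 2)%:E).
  by apply/measurable_EFinP; apply: measurable_funX.
have sqcvg : {ae P, forall w, (f_ n w ^+ 2)%:E @[n --> \oo] --> (f w ^+ 2)%:E}.
  apply: filterS fcvg => w fw; apply: cvg_EFin; first exact: nearW.
  by rewrite expr2; under eq_fun do rewrite expr2; exact: cvgM.
have fat := fatou P measurableT mfE (fun n w _ => sqr_ge0 (f_ n w) : (0 <= (f_ n w ^+ 2)%:E)%E).
have lf2 : L1 P (fun w => f w ^+ 2).
  apply: L1_ge0; [exact: measurable_funX|by move=> w; exact: sqr_ge0|].
  apply: (@le_lt_trans _ _ C%:E); last by rewrite ltry.
  rewrite (ae_eq_integral (fun w => limn_einf (fun n => (f_ n w ^+ 2)%:E))) //.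
  - apply: (le_trans fat); rewrite limn_einf_lim; apply: lime_le; first exact: is_cvg_einfs.
    apply: nearW => n; apply: (@le_trans _ _ (\int[P]_w (f_ n w ^+ 2)%:E)%E).
      by apply: ereal_inf_lbound; exists n => /=.
    by rewrite EFin_Ex// lee_fin.
  - by apply/measurable_EFinP; apply: measurable_funX.
  - rewrite (_ : (fun w => _) = \- (fun w => limn_esup (fun n => - (f_ n w ^+ 2)%:E)))%E.
      by apply: measurableT_comp => //; apply: measurable_fun_limn_esup => n; apply: measurableT_comp (mfE n).
    apply/funext => w; rewrite /= -[LHS]oppeK -limn_esupN; congr (- limn_esup _)%E.
  - by apply: filterS sqcvg => w /cvg_limn_einf_sup[-> _] _.
have lsq (g : Omega -> R) : measurable_fun [set: Omega] g -> L1 P (fun w => g w ^+ 2) -> L1 P g.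
  move=> mg lg; apply: (@L1_le _ _ _ _ _ (fun w => 1 + g w ^+ 2)) => //.
    by move=> w; rewrite ler_norml; have := sqr_ge0 (g w - 1); have := sqr_ge0 (g w + 1); nra.
  by apply: L1D => //; exact: L1_cst.
have lf : L1 P f by exact: lsq.
have lfn n : L1 P (f_ n) by apply: lsq.
split => //.
pose Y n w := `|f_ n w - f w|.
have mY n : measurable_fun [set: Omega] (Y n).
  by apply: measurableT_comp => //; exact: measurable_funB.
(* A bound on the mean of Y^2, from (a - b)^2 <= 2 a^2 + 2 b^2; the 1 makes it positive. *)
pose D := 2 * C + 2 * Ex P (fun w => f w ^+ 2) + 1.
have D0 : 0 < D.
  have := eC 0; have : 0 <= Ex P (fun w => f_ 0 w ^+ 2) by apply: Ex_ge0 => w; exact: sqr_ge0.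
  have : 0 <= Ex P (fun w => f w ^+ 2) by apply: Ex_ge0 => w; exact: sqr_ge0.
  by rewrite /D; lra.
have lS n : L1 P (fun w => 2 * f_ n w ^+ 2 + 2 * f w ^+ 2) by apply: L1D; exact: L1Z.
have YS n w : Y n w ^+ 2 <= 2 * f_ n w ^+ 2 + 2 * f w ^+ 2.
  by rewrite /Y real_normK ?num_real//; have := sqr_ge0 (f_ n w + f w); nra.
have lY2 n : L1 P (fun w => Y n w ^+ 2).
  apply: L1_le (lS n); first exact: measurable_funX.
  by move=> w; rewrite ger0_norm ?sqr_ge0.
have YD n : Ex P (fun w => Y n w ^+ 2) <= D.
  apply: (le_trans (Ex_le (lY2 n) (lS n) (YS n))).
  rewrite ExD; [|exact: L1Z|exact: L1Z]; rewrite !ExZ//.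
  by have := eC n; rewrite /D; lra.
have lY n : L1 P (Y n) by exact: lsq.
apply/cvgrPdist_le => e e0.
(* So that [D / K], the share of the quadratic term, is exactly [e / 2]. *)
pose K := D / (e / 2).
have K0 : 0 < K by rewrite divr_gt0// divr_gt0.
have YK : Ex P (fun w => Num.min (Y n w) K) @[n --> \oo] --> (0 : R).
  have mm n : measurable_fun [set: Omega] (fun w => Num.min (Y n w) K).
    by apply: measurable_minr => //; exact: measurable_cst.
  have iK : P.-integrable [set: Omega] (EFin \o (fun=> K)) by exact: (L1_cst P K).
  have m0 : measurable_fun [set: Omega] (cst 0%E : Omega -> \bar R) by exact: measurable_cst.
  have aeY : {ae P, forall w, [set: Omega] w -> (Num.min (Y n w) K)%:E @[n --> \oo] --> 0%E}.
    apply: filterS fcvg => w fw _; apply: cvg_EFin; first exact: nearW.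
    have Y0 : Y n w @[n --> \oo] --> (0 : R).
      by have := cvg_norm (cvgB fw (cvg_cst (f w))); rewrite subrr normr0; exact.
    apply: squeeze_cvgr (cvg_cst 0) Y0; apply: nearW => n /=.
    by rewrite le_min normr_ge0 ltW//= ge_min lexx.
  have aeK : {ae P, forall w, forall n, [set: Omega] w -> (`|(Num.min (Y n w) K)%:E| <= (EFin \o (fun=> K)) w)%E}.
    apply: aeW => w n _; rewrite lee_fin ger0_norm; first by rewrite ge_min lexx orbT.
    by rewrite le_min normr_ge0 ltW.
  have [_ _] := dominated_convergence measurableT (fun n => (measurable_EFinP _ _).2 (mm n)) m0 aeY iK aeK.
  rewrite integral0 => H; have := fine_cvg H; exact.
near=> n.
have YKn : Ex P (fun w => Num.min (Y n w) K) <= e / 2.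
  near: n; have /cvgrPdist_le/(_ (e / 2)) := YK; rewrite divr_gt0// => /(_ isT).
  by apply: filterS => n; rewrite sub0r normrN; apply: le_trans; exact: ler_norm.
have lm : L1 P (fun w => Num.min (Y n w) K).
  apply: L1_le (lY n); first by apply: measurable_minr => //; exact: measurable_cst.
  by move=> w; rewrite ger0_norm ?ge_min ?lexx// le_min normr_ge0 ltW.
rewrite distrC -ExB//; apply: (le_trans (Ex_norm_le (L1B (lfn n) lf))).
apply: (@le_trans _ _ (Ex P (fun w => Num.min (Y n w) K + K^-1 * Y n w ^+ 2))).
  apply: Ex_le; [exact: lY|by apply: L1D => //; exact: L1Z|].
  move=> w; rewrite -/(Y n w); have [_|KY] := leP (Y n w) K.
    by rewrite lerDl mulr_ge0 ?sqr_ge0// invr_ge0 ltW.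
  rewrite -[leLHS]add0r lerD//; first exact: ltW.
  by rewrite expr2 mulrA ler_peMl ?normr_ge0// mulrC ler_pdivlMr// mul1r ltW.
rewrite ExD//; last exact: L1Z.
rewrite ExZ// [e]splitr lerD//.
apply: (@le_trans _ _ (K^-1 * D)); first by rewrite ler_wpM2l// invr_ge0 ltW.
by rewrite /K invf_div -mulrA mulVf ?mulr1// gt_eqF.
Unshelve. all: by end_near.
Qed.

(** * Brownian increments and the Ito isometry *)

(** A comparison of densities replaces the exact value: x^4 times the density of deviation [s] is at
    most 128 s^4 times the density of deviation 2s, which has mass 1. *)
Lemma normal_moment4_le {R : realType} (s : R) : 0 < s ->
  (\int[normal_prob 0 s]_x (x ^+ 4)%:E <= (128 * s ^+ 4)%:E)%E.
Proof.
move=> s0; have sn : s != 0 by rewrite gt_eqF.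
have tn : 2 * s != 0 by rewrite mulf_neq0.
have mx4 : measurable_fun [set: R] (fun x : R => (x ^+ 4)%:E).
  by apply/measurable_EFinP; apply: continuous_measurable_fun; exact: exprn_continuous.
have x40 (x : R) : 0 <= x ^+ 4 by rewrite -[4%N]/(2 * 2)%N exprM sqr_ge0.
rewrite ge0_integral_normal_prob//.
have mpdf (r : R) : measurable_fun [set: R] (fun x => (normal_pdf 0 r x)%:E).
  by apply/measurable_EFinP; exact: measurable_normal_pdf.
have pdf0 (r x : R) : (0 <= (normal_pdf 0 r x)%:E)%E by rewrite lee_fin normal_pdf_ge0.
have s40 : 0 <= 128 * s ^+ 4 by rewrite mulr_ge0.
apply: (@le_trans _ _ (\int[lebesgue_measure]_x ((128 * s ^+ 4)%:E * (normal_pdf 0 (2 * s) x)%:E))%E).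
  apply: ge0_le_integral => //.
  - by move=> x _; apply: mule_ge0; [rewrite lee_fin; exact: x40|exact: pdf0].
  - by apply: emeasurable_funM; [exact: mx4|exact: mpdf].
  - by apply: emeasurable_funM; [exact: measurable_cst|exact: mpdf].
  move=> x _; rewrite -!EFinM lee_fin !normal_pdfE// /normal_fun subr0.
  have -> : normal_peak (2 * s) = normal_peak s / 2.
    rewrite /normal_peak; move: (pi : R) => p.
    have -> : (2 * s) ^+ 2 * p *+ 2 = 2 ^+ 2 * (s ^+ 2 * p *+ 2) by rewrite exprMn -[in LHS]mulrA mulrnAr.
    by rewrite sqrtrM// sqrtr_sqr ger0_norm// invfM mulrC.
  have := normal_peak_ge0 s; move: (normal_peak s) => c c0.
  (* In this variable x^4 is 16 s^4 v^2 and the two exponents are -2v and -v/2. From v^2 <= 4 e^v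
     follows v^2 e^{-2v} <= 4 e^{-v/2}; the peak of the wider density is halved, so 128 = 16 * 4 *
     2. *)
  pose v : R := x ^+ 2 / (s ^+ 2 * 4).
  have v0 : 0 <= v by rewrite divr_ge0 ?sqr_ge0// mulr_ge0 ?sqr_ge0.
  have -> : - x ^+ 2 / (s ^+ 2 *+ 2) = - v - v.
    by rewrite /v -mulr_natr; field.
  have -> : - x ^+ 2 / ((2 * s) ^+ 2 *+ 2) = - (v / 2).
    by rewrite /v -mulr_natr; field.
  have -> : x ^+ 4 = 16 * s ^+ 4 * v ^+ 2 by rewrite /v; field.
  have E1 : expR v = expR (v / 2) ^+ 2 by rewrite expr2 -expRD; congr expR; field.
  have v2 : v ^+ 2 <= 4 * expR v.
    have v4 : 0 <= v / 2 by rewrite divr_ge0.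
    have := expR_ge1Dx (v / 2); rewrite E1; move: (expR _) => y yv.
    have : v / 2 <= y by apply: le_trans yv; rewrite lerDr.
    by move=> vy; nra.
  have v3 : v ^+ 2 * expR (- v - v) <= 4 * expR (- (v / 2)).
    apply: (@le_trans _ _ (4 * expR (v) * expR (- v - v))); first by rewrite ler_wpM2r ?expR_ge0.
    by rewrite -mulrA -expRD ler_wpM2l// ler_expR; lra.
  rewrite (_ : 16 * s ^+ 4 * v ^+ 2 * (c * expR (- v - v)) = (16 * s ^+ 4 * c) * (v ^+ 2 * expR (- v - v))); last by ring.
  rewrite (_ : 128 * s ^+ 4 * (c / 2 * expR (- (v / 2))) = (16 * s ^+ 4 * c) * (4 * expR (- (v / 2)))); last by field.
  apply: ler_wpM2l v3; apply: mulr_ge0 c0; apply: mulr_ge0 => //; exact/exprn_ge0/ltW.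
rewrite ge0_integralZl//.
- by rewrite integral_normal_pdf ?mule1.
- exact: mpdf.
Qed.

Section Law.
Context {disp : measure_display} {Omega : measurableType disp} {R : realType}.
Variables (P : probability Omega R) (m : probability (measurableTypeR R) R).
Variable Y : Omega -> R.
Hypothesis mY : measurable_fun [set: Omega] Y.
Hypothesis law : forall U : set R, measurable U -> m U = P (Y @^-1` U).

Let mY' : measurable_fun [set: Omega] (Y : Omega -> measurableTypeR R).
Proof. exact: mY. Qed.
Let mu : measure (measurableTypeR R) R :=
  measure_function_pushforward__canonical__measure_function_Measure P mY'.

Lemma ge0_integral_law (f : R -> \bar R) : measurable_fun [set: R] f ->
  (forall x, (0 <= f x)%E) -> (\int[m]_x f x = \int[P]_w f (Y w))%E.
Proof.
move=> mf f0; rewrite (@eq_measure_integral _ _ _ setT mu m); last by move=> A mA _; exact: law.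
by rewrite (@ge0_integral_pushforward _ _ _ (measurableTypeR R) R Y mY' P setT f).
Qed.

Lemma integral_law : L1 P Y -> (\int[m]_x x%:E = \int[P]_w (Y w)%:E)%E.
Proof.
move=> lY; rewrite (@eq_measure_integral _ _ _ setT mu m); last by move=> A mA _; exact: law.
rewrite (@integral_pushforward _ _ _ (measurableTypeR R) R Y mY' P setT EFin)//.
Qed.

End Law.

(** * Independence of the Brownian increments from the enlarged past *)

Section Noise.
Context {disp : measure_display} {Omega : measurableType disp} {R : realType}.
Variables (P : probability Omega R) (d : nat) (X : R -> Omega -> 'I_d).
Variable B : R -> Omega -> R.
Local Notation L1 := (L1 P).
Local Notation Ex := (Ex P).
Hypothesis measX : forall t, 0 <= t -> forall i, measurable (X t @^-1` [set i]).
Hypothesis hB : is_brownian P B.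
Hypothesis hXB : independent_of P X B.

Let sX := <<s gen setT X `[0, +oo[ >>.
Let sB s := <<s gen measurable B `[0, s] >>.

(* The past of B together with the whole trajectory of X: the increments of B
   are independent of it, which is more than their independence of the
   history. *)
Definition pastgen (s : R) : set (set Omega) :=
  [set A `&` C | A in <<s gen setT X `[0, +oo[ >> &
                 C in <<s gen measurable B `[0, s] >>].

(** Phrased with the type carrying the generated sigma-algebra, so that the closure properties of
    measurable functions apply to it directly. *)
Definition past_measurable (s : R) (f : Omega -> R) :=
  measurable_fun [set: g_sigma_algebraType (pastgen s)] f.

Lemma measurable_preimX (t : R) (U : set 'I_d) : 0 <= t -> measurable (X t @^-1` U).
Proof.
move=> t0; rewrite (_ : X t @^-1` U = \bigcup_(i in U) (X t @^-1` [set i])).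
  by apply: fin_bigcup_measurable => // i _; exact: measX.
by apply/seteqP; split => w /=; [move=> Uw; exists (X t w)|case=> i Ui /= ->].
Qed.

Lemma sX_measurable A : sX A -> measurable A.
Proof.
apply: smallest_sub; first exact: sigma_algebra_measurable.
move=> _ [t /= + [U _ <-]]; rewrite in_itv/= andbT => t0.
by rewrite setTI; exact: measurable_preimX.
Qed.

Lemma measB (t : R) : 0 <= t -> measurable_fun [set: Omega] (B t).
Proof. by have [] := hB => + _ _ _ _; exact. Qed.

Lemma sB_measurable s A : sB s A -> measurable A.
Proof.
apply: smallest_sub; first exact: sigma_algebra_measurable.
move=> _ [t /= + [U mU <-]]; rewrite in_itv/= => /andP[t0 _].
by apply: measB.
Qed.

Lemma pastgen_measurable s A : pastgen s A -> measurable A.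
Proof.
move=> [E /sX_measurable mE [C /sB_measurable mC <-]]; exact: measurableI.
Qed.

Lemma past_sub_measurable s A : <<s pastgen s >> A -> measurable A.
Proof.
apply: smallest_sub; first exact: sigma_algebra_measurable.
exact: pastgen_measurable.
Qed.

Lemma past_measurable_fun s f : past_measurable s f -> measurable_fun [set: Omega] f.
Proof.
move=> mf _ U mU; have := mf measurableT U mU; exact: past_sub_measurable.
Qed.

Lemma sX_past s A : sX A -> <<s pastgen s >> A.
Proof.
move=> sXA; apply: sub_sigma_algebra; exists A => //; exists setT; last by rewrite setIT.
exact: (@measurableT _ (g_sigma_algebraType (gen measurable B `[0, s]))).
Qed.

Lemma sB_past s A : sB s A -> <<s pastgen s >> A.
Proof.
move=> sBA; apply: sub_sigma_algebra; exists setT.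
  exact: (@measurableT _ (g_sigma_algebraType (gen setT X `[0, +oo[))).
by exists A => //; rewrite setTI.
Qed.

Lemma sB_mono (s t : R) A : s <= t -> sB s A -> sB t A.
Proof.
move=> st; apply: smallest_sub; first exact: smallest_sigma_algebra.
move=> _ [r /= + [U mU <-]]; rewrite in_itv/= => /andP[r0 rs].
by apply: sub_sigma_algebra; exists r => /=; [rewrite in_itv/= r0 (le_trans rs)|exists U].
Qed.

Lemma past_mono (s t : R) A : s <= t -> <<s pastgen s >> A -> <<s pastgen t >> A.
Proof.
move=> st; apply: smallest_sub; first exact: smallest_sigma_algebra.
move=> _ [E sE [C sC <-]]; apply: sub_sigma_algebra; exists E => //; exists C => //.
exact: sB_mono sC.
Qed.

Lemma past_measurable_mono (s t : R) f : s <= t ->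
  past_measurable s f -> past_measurable t f.
Proof. by move=> st mf _ U mU; apply: (past_mono st); exact: mf. Qed.

Lemma past_measurable_X (s t : R) (f : 'I_d -> R) : 0 <= t ->
  past_measurable s (fun w => f (X t w)).
Proof.
move=> t0 _ U mU; rewrite setTI; apply: sX_past; apply: sub_sigma_algebra.
exists t; first by rewrite /= in_itv/= t0.
by exists (f @^-1` U) => //; rewrite setTI.
Qed.

Lemma past_measurable_B (s t : R) : 0 <= t -> t <= s -> past_measurable s (B t).
Proof.
move=> t0 ts _ U mU; rewrite setTI; apply: sB_past; apply: sub_sigma_algebra.
exists t; first by rewrite /= in_itv/= t0 ts.
by exists U => //; rewrite setTI.
Qed.

(** Simple integrands are adapted to [history]; this moves their coefficients into the larger past,
    where grid coefficients read from the future of the chain also live. *)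
Lemma history_past (s : R) f : 0 <= s ->
  (forall U : set R, measurable U -> history X B s (f @^-1` U)) ->
  past_measurable s f.
Proof.
move=> s0 hf _ U mU; rewrite setTI; have := hf U mU.
apply: smallest_sub; first exact: smallest_sigma_algebra.
move=> A [[t /= + [V _ <-]]|[t /= + [V mV <-]]]; rewrite in_itv/= => /andP[t0 ts].
- apply: sX_past; apply: sub_sigma_algebra; exists t; first by rewrite /= in_itv/= t0.
  by exists V.
- apply: sB_past; apply: sub_sigma_algebra; exists t; first by rewrite /= in_itv/= t0 ts.
  by exists V.
Qed.

Definition incr (s t : R) (w : Omega) : R := B t w - B s w.

Lemma incr_measurable (s t : R) : 0 <= s -> s <= t -> measurable_fun [set: Omega] (incr s t).
Proof. by move=> s0 st; apply: measurable_funB; apply: measB => //; exact: le_trans st. Qed.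

Lemma past_measurable_incr (r s t : R) : 0 <= s -> s <= t -> t <= r ->
  past_measurable r (incr s t).
Proof.
move=> s0 st tr; apply: measurable_funB; apply: past_measurable_B => //.
- exact: le_trans st.
- exact: le_trans tr.
Qed.

Lemma pastgen_setI s : setI_closed (pastgen s).
Proof.
move=> _ _ [E sE [C sC <-]] [E' sE' [C' sC' <-]].
exists (E `&` E'); first exact: (@measurableI _ (g_sigma_algebraType (gen setT X `[0, +oo[)) E E').
exists (C `&` C'); first exact: (@measurableI _ (g_sigma_algebraType (gen measurable B `[0, s])) C C').
by rewrite setIACA.
Qed.

(** For the fixed event D on the increment, A |-> P(A and D) and A |-> P(D) P(A) are finite measures
    agreeing on the pi-system [pastgen]. On a generator, the event of X splits off by independence
    of X and B, then the event of the past of B by independence of increments. *)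
Lemma incr_indep (s t : R) (A : set Omega) (U : set R) : 0 <= s -> s <= t ->
  <<s pastgen s >> A -> measurable U ->
  P (A `&` incr s t @^-1` U) = (P A * P (incr s t @^-1` U))%E.
Proof.
move=> s0 st GA mU; have mD : measurable (incr s t @^-1` U).
  by rewrite -[_ @^-1` _]setTI; exact: incr_measurable.
set D := incr s t @^-1` U in mD *.
have PD0 : 0 <= fine (P D) by rewrite fine_ge0.
pose m1 := measure_function_mrestr__canonical__measure_function_Measure P mD.
pose m2 := measure_function_mscale__canonical__measure_function_Measure (NngNum PD0) P.
have -> : (P A * P D)%E = m2 A.
  by rewrite -[m2 A]/(mscale (NngNum PD0) P A) /mscale/= fineK 1?muleC// fin_num_measure.
rewrite -[LHS]/(m1 A).
apply: (@g_sigma_algebra_measure_unique _ _ _ (pastgen s) _ (fun=> setT) _ _ m1 m2) => //.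
- by move=> E; exact: pastgen_measurable.
- move=> _; exists setT; first exact: (@measurableT _ (g_sigma_algebraType (gen setT X `[0, +oo[))).
  exists setT; last by rewrite setIT.
  exact: (@measurableT _ (g_sigma_algebraType (gen measurable B `[0, s]))).
- by rewrite bigcup_const.
- exact: pastgen_setI.
- move=> _ [E sE [C sC <-]]; rewrite -[m2 _]/(mscale (NngNum PD0) P _) -[m1 _]/(P _) /mscale/= fineK ?fin_num_measure//.
  have [_ _ indB _ _] := hB.
  have t0 := le_trans s0 st.
  have sBy r : 0 <= r -> sB r `<=` <<s gen measurable B `[0, +oo[ >>.
    move=> r0; apply: smallest_sub; first exact: smallest_sigma_algebra.
    move=> _ [r' /= + [V mV <-]]; rewrite in_itv/= => /andP[r'0 _].
    by apply: sub_sigma_algebra; exists r' => /=; [rewrite in_itv/= r'0|exists V].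
  have sCD : <<s gen measurable B `[0, +oo[ >> (C `&` D).
    apply: (@measurableI _ (g_sigma_algebraType (gen measurable B `[0, +oo[)) C D).
      exact: sBy sC.
    apply: (sBy t t0).
    have mt r : 0 <= r -> r <= t -> measurable_fun [set: g_sigma_algebraType (gen measurable B `[0, t])] (B r).
      move=> r0 rt _ V mV; rewrite setTI; apply: sub_sigma_algebra.
      exists r; first by rewrite /= in_itv/= r0 rt.
      by exists V => //; rewrite setTI.
    have : measurable_fun [set: g_sigma_algebraType (gen measurable B `[0, t])] (incr s t).
      by apply: measurable_funB; apply: mt.
    by move=> /(_ measurableT U mU); rewrite setTI.
  have pD : preimage_set_system setT (B t \- B s) measurable D.
    by exists U => //; rewrite setTI.
  rewrite -setIA hXB// [C `&` D]setIC (indB _ _ s0 st D C pD sC).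
  by rewrite (hXB sE (sBy _ s0 _ sC)) muleCA.
- by move=> _; rewrite /m1 /mrestr/= (le_lt_trans (probability_le1 _ _))// ?ltry// setTI.
Qed.

Section IncrementMoments.
Variables s t : R.
Hypotheses (s0 : 0 <= s) (st : s <= t).
Let v : R := t - s.
Let mI : measurable_fun [set: Omega] (incr s t). Proof. exact: incr_measurable. Qed.
Let v0 : 0 <= v. Proof. by rewrite subr_ge0. Qed.

Let law : s < t -> forall U : set R, measurable U ->
  normal_prob 0 (Num.sqrt v) U = P (incr s t @^-1` U).
Proof.
move=> lst U mU; have [_ _ _ law _] := hB; have <- := law _ _ s0 lst _ mU.
by [].
Qed.

(** The normal law of increments is given for [s < t] only; the degenerate case is handled through
    this identity. *)
Let incr0 : s = t -> forall w, incr s t w = 0.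
Proof. by move=> -> w; rewrite /incr subrr. Qed.

Lemma incr_pow4 : L1 (fun w => incr s t w ^+ 4) /\
  Ex (fun w => incr s t w ^+ 4) <= 128 * (t - s) ^+ 2.
Proof.
move: st; rewrite le_eqVlt => /predU1P[st'|lst].
  under eq_fun do rewrite incr0// expr0n.
  by split; [exact: L1_cst|rewrite Ex_cst st' subrr expr0n mulr0].
have sv0 : 0 < Num.sqrt v by rewrite sqrtr_gt0 subr_gt0.
have x40 (x : R) : 0 <= x ^+ 4 by rewrite -[4%N]/(2 * 2)%N exprM sqr_ge0.
have H : (\int[P]_w (incr s t w ^+ 4)%:E <= (128 * v ^+ 2)%:E)%E.
  have := normal_moment4_le sv0.
  rewrite -[4%N]/(2 * 2)%N exprM sqr_sqrtr//; apply: le_trans.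
  rewrite (ge0_integral_law mI (law lst))//.
  by apply/measurable_EFinP; apply: continuous_measurable_fun; exact: exprn_continuous.
have l4 : L1 (fun w => incr s t w ^+ 4).
  apply: L1_ge0; [exact: measurable_funX|by move=> w; exact: x40|].
  by apply: le_lt_trans H _; exact: ltry.
by split => //; rewrite -lee_fin -EFin_Ex.
Qed.

Lemma incr_pow2 : L1 (fun w => incr s t w ^+ 2) /\ Ex (fun w => incr s t w ^+ 2) = t - s.
Proof.
move: st; rewrite le_eqVlt => /predU1P[st'|lst].
  under eq_fun do rewrite incr0// expr0n.
  by split; [exact: L1_cst|rewrite Ex_cst st' subrr].
have sv0 : 0 < Num.sqrt v by rewrite sqrtr_gt0 subr_gt0.
have H : (\int[P]_w (incr s t w ^+ 2)%:E = v%:E)%E.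
  have := normal_moment2 sv0; rewrite sqr_sqrtr// => <-.
  rewrite (ge0_integral_law mI (law lst))//.
  - by apply/measurable_EFinP; apply: continuous_measurable_fun; exact: exprn_continuous.
  - by move=> x; rewrite lee_fin sqr_ge0.
have l2 : L1 (fun w => incr s t w ^+ 2).
  apply: L1_ge0; [exact: measurable_funX|by move=> w; rewrite sqr_ge0|].
  by rewrite H ltry.
by split => //; apply: EFin_inj; rewrite -EFin_Ex.
Qed.

Lemma incr_pow1 : L1 (incr s t) /\ Ex (incr s t) = 0.
Proof.
have l1 : L1 (incr s t).
  apply: (@L1_le _ _ _ _ _ (fun w => 1 + incr s t w ^+ 2)) => //.
    by move=> w; rewrite -normr_id ler_norml; move: (incr s t w) => x; rewrite -(real_normK (num_real x)); move: (`|x|) (normr_ge0 x) => y y0; nra.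
  by apply: L1D; [exact: L1_cst|exact: incr_pow2.1].
split => //; move: st; rewrite le_eqVlt => /predU1P[st'|lst].
  by under eq_Ex do rewrite incr0//; rewrite Ex_cst.
have sv0 : 0 < Num.sqrt v by rewrite sqrtr_gt0 subr_gt0.
apply: EFin_inj; rewrite -EFin_Ex//.
by rewrite -[RHS](normal_moment1 sv0) (integral_law mI (law lst)).
Qed.

Variable Y : Omega -> R.
Hypotheses (mY : past_measurable s Y) (lY : L1 Y).

Let indepY (f : R -> R) : measurable_fun [set: R] f -> L1 (f \o incr s t) ->
  L1 (fun w => Y w * f (incr s t w)) /\
  Ex (fun w => Y w * f (incr s t w)) = Ex Y * Ex (f \o incr s t).
Proof.
move=> mf lf.
have mY' := past_measurable_fun mY.
have mfI : measurable_fun [set: Omega] (f \o incr s t) by exact: measurableT_comp.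
have ind (U V : set R) : measurable U -> measurable V ->
    P (Y @^-1` U `&` (f \o incr s t) @^-1` V) = (P (Y @^-1` U) * P ((f \o incr s t) @^-1` V))%E.
  move=> mU mV; rewrite comp_preimage; apply: incr_indep => //.
    by have := mY measurableT mU; rewrite setTI.
  by rewrite -[_ @^-1` _]setTI; exact: mf.
split; first exact: (indep_L1 mY' mfI ind).
exact: (indep_Ex mY' mfI ind).
Qed.

Lemma Ex_past_incr : L1 (fun w => Y w * incr s t w) /\ Ex (fun w => Y w * incr s t w) = 0.
Proof.
have [l e] := incr_pow1; have [] := @indepY id (@measurable_id _ _ _) l.
by rewrite [Ex (id \o _)]e mulr0.
Qed.

Lemma Ex_past_incr2 : L1 (fun w => Y w * incr s t w ^+ 2) /\
  Ex (fun w => Y w * incr s t w ^+ 2) = (t - s) * Ex Y.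
Proof.
have [l e] := incr_pow2.
have [|] := @indepY (fun x => x ^+ 2) _ l; first exact: exprn_measurable.
by rewrite [X in _ = _ * X]e mulrC.
Qed.

Lemma Ex_past_incr4 : (forall w, 0 <= Y w) -> L1 (fun w => Y w * incr s t w ^+ 4) /\
  Ex (fun w => Y w * incr s t w ^+ 4) <= 128 * (t - s) ^+ 2 * Ex Y.
Proof.
move=> Y0; have [l e] := incr_pow4.
have [|l' ->] := @indepY (fun x => x ^+ 4) _ l; first exact: exprn_measurable.
by split => //; rewrite mulrC ler_wpM2r// Ex_ge0.
Qed.

End IncrementMoments.

End Noise.

(** Length of the intersection of [a, b[ and [a', b'[, set to 0 when they are disjoint. *)
Definition overlap {R : realType} (a b a' b' : R) : R :=
  Num.max 0 (Num.min b b' - Num.max a a').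

Lemma overlapC {R : realType} (a b a' b' : R) : overlap a b a' b' = overlap a' b' a b.
Proof. by rewrite /overlap minC maxC [Num.max a _]maxC maxC. Qed.

Lemma overlapE {R : realType} (T a b a' b' : R) : 0 <= a -> b <= T ->
  (lebesgue_measure (`[0%R, T] `&` (`[a, b[ `&` `[a', b'[) : set R) = (overlap a b a' b')%:E)%E.
Proof.
move=> a0 bT.
have -> : `[0, T] `&` (`[a, b[ `&` `[a', b'[) = `[Num.max a a', Num.min b b'[%classic :> set R.
  apply/seteqP; split => x /=; rewrite !in_itv/= ge_max lt_min.
    by move=> [_ [/andP[-> ->] /andP[-> ->]]].
  move=> /andP[/andP[ax a'x] /andP[xb xb']]; rewrite ax a'x xb xb' (le_trans a0 ax).
  by rewrite (le_trans (ltW xb) bT).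
rewrite lebesgue_measure_itv/= lte_fin /overlap.
case: ltP => h; first by rewrite -EFinB; congr EFin; apply/esym/max_r; rewrite subr_ge0 ltW.
by congr EFin; apply/esym/max_l; rewrite subr_le0.
Qed.

Lemma integral_indic_sum {disp : measure_display} {S : measurableType disp} {R : realType}
  (m : {measure set S -> \bar R}) (D : set S) (I : finType) (k : I -> R) (A : I -> set S) :
  measurable D -> (m D < +oo)%E -> (forall i, measurable (A i)) ->
  (\int[m]_(s in D) (\sum_i k i * \1_(A i) s)%:E = \sum_i (k i)%:E * m (D `&` A i))%E.
Proof.
move=> mD fD mA.
have iA i : m.-integrable D (fun s => (\1_(A i) s)%:E).
  apply/integrableP; split; first by apply/measurable_EFinP; exact: measurable_indic.
  under eq_integral => x _ do rewrite gee0_abs ?lee_fin//.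
  rewrite integral_indic//; apply: le_lt_trans fD; apply: le_measure => [||x []//]; rewrite inE//.
  exact: measurableI.
under eq_integral do rewrite -sumEFin.
rewrite integral_sum//.
- apply: eq_bigr => i _.
  under eq_integral do rewrite EFinM.
  by rewrite integralZl// integral_indic// setIC.
- move=> i; apply: eq_integrable (integrableZl _ (k i) (iA i)) => //.
Qed.

Lemma lebesgue_measure_itv_lty {R : realType} (T : R) :
  (lebesgue_measure (`[0%R, T]%classic : set R) < +oo)%E.
Proof. by rewrite lebesgue_measure_itv/=; case: ifP => _; rewrite ?ltry// -EFinB ltry. Qed.

Section Isometry.
Context {disp : measure_display} {Omega : measurableType disp} {R : realType}.
Variables (P : probability Omega R) (d : nat) (X : R -> Omega -> 'I_d).
Variable B : R -> Omega -> R.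
Local Notation L1 := (L1 P).
Local Notation Ex := (Ex P).
Hypothesis measX : forall t, 0 <= t -> forall i, measurable (X t @^-1` [set i]).
Hypothesis hB : is_brownian P B.
Hypothesis hXB : independent_of P X B.
Local Notation incr := (incr B).
Local Notation past_measurable := (past_measurable X B).

Let bmul (c c' : Omega -> R) (C C' : R) : (forall w, `|c w| <= C) -> (forall w, `|c' w| <= C') ->
  forall w, `|c w * c' w| <= C * C'.
Proof. by move=> cC c'C w; rewrite normrM ler_pM. Qed.

(** When the cells meet, both increments are cut at [a'] and at [m], the smaller of [b] and [b'].
    The product of coefficients is known at time [a'], so every term with a later increment to the
    first power has mean 0, and only the square of the increment over [a', m] survives. *)
Let cross_le (a b a' b' : R) (c c' : Omega -> R) (C C' : R) :
  0 <= a -> a <= b -> a' <= b' -> a <= a' ->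
  past_measurable a c -> past_measurable a' c' ->
  (forall w, `|c w| <= C) -> (forall w, `|c' w| <= C') ->
  L1 (fun w => (c w * incr a b w) * (c' w * incr a' b' w)) /\
  Ex (fun w => (c w * incr a b w) * (c' w * incr a' b' w)) =
    overlap a b a' b' * Ex (fun w => c w * c' w).
Proof.
move=> a0 ab ab' aa' pc pc' cC cC'.
have a'0 := le_trans a0 aa'.
have pca' : past_measurable a' c by exact: past_measurable_mono pc.
have pcc : past_measurable a' (fun w => c w * c' w) by exact: measurable_funM.
have lcc : L1 (fun w => c w * c' w).
  apply: (L1_bounded _ _ (bmul cC cC')).
  exact: (past_measurable_fun measX hB pcc).
have mcc := past_measurable_fun measX hB pcc.
have [ba'|a'b] := leP b a'.
  have pY : past_measurable a' (fun w => c w * c' w * incr a b w).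
    by apply: measurable_funM => //; exact: past_measurable_incr.
  have lY : L1 (fun w => c w * c' w * incr a b w).
    exact: (L1_boundedM mcc (bmul cC cC') (incr_pow1 hB a0 ab).1).
  have [l e] := Ex_past_incr measX hB hXB a'0 ab' pY lY.
  have E w : c w * incr a b w * (c' w * incr a' b' w) = c w * c' w * incr a b w * incr a' b' w by ring.
  under eq_fun do rewrite E.
  split => //; rewrite e /overlap max_l ?mul0r// subr_le0.
  by rewrite ge_min (le_trans ba')// le_max lexx orbT.
pose m := Num.min b b'.
have a'm : a' <= m by rewrite /m le_min ab' ltW.
have m0 := le_trans a'0 a'm.
have mb : m <= b by rewrite /m ge_min lexx.
have mb' : m <= b' by rewrite /m ge_min lexx orbT.
have pU : past_measurable a' (fun w => c w * c' w * incr a a' w).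
  by apply: measurable_funM => //; exact: past_measurable_incr.
have lU : L1 (fun w => c w * c' w * incr a a' w).
  exact: (L1_boundedM mcc (bmul cC cC') (incr_pow1 hB a0 aa').1).
have pV : past_measurable m (fun w => c w * c' w * incr a' m w).
  apply: measurable_funM; first exact: past_measurable_mono pcc.
  exact: past_measurable_incr.
have lV : L1 (fun w => c w * c' w * incr a' m w).
  exact: (L1_boundedM mcc (bmul cC cC') (incr_pow1 hB a'0 a'm).1).
have [l1 e1] := Ex_past_incr measX hB hXB a'0 ab' pU lU.
have [l2 e2] := Ex_past_incr2 measX hB hXB a'0 a'm pcc lcc.
have [l3 e3] := Ex_past_incr measX hB hXB m0 mb' pV lV.
have [l4 e4] := Ex_past_incr measX hB hXB m0 mb pV lV.
have E w : c w * incr a b w * (c' w * incr a' b' w) =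
    c w * c' w * incr a a' w * incr a' b' w + (c w * c' w * incr a' m w ^+ 2 +
    (c w * c' w * incr a' m w * incr m b' w + c w * c' w * incr a' m w * incr m b w)).
  (* One of the two cells ends at [m], so one of these increments is over an empty cell. *)
  have W : incr m b w * incr m b' w = 0.
    rewrite /incr /m; case: (leP b b') => _; first by rewrite subrr mul0r.
    by rewrite [X in _ * X]subrr mulr0.
  have -> : incr a b w = incr a a' w + incr a' m w + incr m b w by rewrite /incr; ring.
  have H : c w * c' w * (incr m b w * incr m b' w) = 0 by rewrite W mulr0.
  have -> : incr a' b' w = incr a' m w + incr m b' w by rewrite /incr; ring.
  by rewrite -[RHS]addr0 -H; ring.
under eq_fun do rewrite E.
have l34 := L1D l3 l4; have l234 := L1D l2 l34.
split; first exact: L1D.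
rewrite !ExD// e1 e2 e3 e4 !addr0 add0r /overlap; congr (_ * _).
by rewrite -/m (max_r aa') max_r// subr_ge0.
Qed.

Lemma Ex_incr_cross (a b a' b' : R) (c c' : Omega -> R) (C C' : R) :
  0 <= a -> a <= b -> 0 <= a' -> a' <= b' ->
  past_measurable a c -> past_measurable a' c' ->
  (forall w, `|c w| <= C) -> (forall w, `|c' w| <= C') ->
  L1 (fun w => (c w * incr a b w) * (c' w * incr a' b' w)) /\
  Ex (fun w => (c w * incr a b w) * (c' w * incr a' b' w)) =
    overlap a b a' b' * Ex (fun w => c w * c' w).
Proof.
move=> a0 ab a'0 ab' pc pc' cC cC'.
have [aa'|/ltW a'a] := leP a a'; first exact: cross_le cC cC'.
have [l e] := cross_le a'0 ab' ab a'a pc' pc cC' cC.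
have E w : c w * incr a b w * (c' w * incr a' b' w) = c' w * incr a' b' w * (c w * incr a b w).
  by rewrite mulrC.
under eq_fun do rewrite E.
by split => //; rewrite e overlapC; under eq_Ex do rewrite mulrC.
Qed.

Section Step.
Variables (I : finType) (T : R) (a b : I -> R) (c : I -> Omega -> R).
Hypotheses (a0 : forall i, 0 <= a i) (ab : forall i, a i <= b i) (bT : forall i, b i <= T).
Hypothesis pc : forall i, past_measurable (a i) (c i).
Hypothesis bc : forall i, exists C : R, forall w, `|c i w| <= C.

Let lc i j : L1 (fun w => c i w * c j w).
Proof.
have [C hC] := bc i; have [C' hC'] := bc j.
apply: (L1_bounded _ _ (bmul hC hC')).
by apply: measurable_funM; apply: (past_measurable_fun measX hB (@pc _)).
Qed.

Lemma Ex_step_sq (s : R) :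
  L1 (fun w => (\sum_i c i w * \1_(`[a i, b i[) s) ^+ 2) /\
  Ex (fun w => (\sum_i c i w * \1_(`[a i, b i[) s) ^+ 2) =
  \sum_(p : I * I) Ex (fun w => c p.1 w * c p.2 w) *
    \1_(`[a p.1, b p.1[ `&` `[a p.2, b p.2[) s.
Proof.
have E w : (\sum_i c i w * \1_(`[a i, b i[) s) ^+ 2 =
    \sum_(p : I * I) \1_(`[a p.1, b p.1[ `&` `[a p.2, b p.2[) s * (c p.1 w * c p.2 w).
  rewrite expr2 big_distrlr/= pair_bigA/=; apply: eq_bigr => -[i j] _ /=.
  by rewrite indicI/=; ring.
under eq_fun do rewrite E.
have l (p : I * I) : L1 (fun w => \1_(`[a p.1, b p.1[ `&` `[a p.2, b p.2[) s * (c p.1 w * c p.2 w)).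
  by apply: L1Z; exact: lc.
split; first exact: L1_sum.
by rewrite Ex_sum//; apply: eq_bigr => p _; rewrite ExZ; [rewrite mulrC|exact: lc].
Qed.

(** Both sides expand into the same double sum of overlaps times E[c_i c_j]. The cells may overlap
    arbitrarily: the difference of two step processes with unrelated subdivisions is covered without
    a common refinement. *)
Lemma step_isometry :
  L1 (fun w => (\sum_i c i w * incr (a i) (b i) w) ^+ 2) /\
  ((Ex (fun w => (\sum_i c i w * incr (a i) (b i) w) ^+ 2))%:E =
  \int[lebesgue_measure]_(s in `[0%R, T])
    (Ex (fun w => (\sum_i c i w * \1_(`[a i, b i[) s) ^+ 2)%R)%:E)%E.
Proof.
have l (p : I * I) := let: (ex_intro C hC) := bc p.1 in let: (ex_intro C' hC') := bc p.2 in
  Ex_incr_cross (a0 p.1) (ab p.1) (a0 p.2) (ab p.2) (@pc p.1) (@pc p.2) hC hC'.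
have E w : (\sum_i c i w * incr (a i) (b i) w) ^+ 2 =
    \sum_(p : I * I) (c p.1 w * incr (a p.1) (b p.1) w) * (c p.2 w * incr (a p.2) (b p.2) w).
  by rewrite expr2 big_distrlr/= pair_bigA.
under eq_fun do rewrite E.
have l1 p := (l p).1.
split; first exact: L1_sum.
rewrite Ex_sum//; under eq_integral do rewrite (Ex_step_sq _).2.
rewrite integral_indic_sum//; [|exact: lebesgue_measure_itv_lty|by move=> p; exact: measurableI].
rewrite -sumEFin; apply: eq_bigr => p _; rewrite (l p).2 EFinM muleC.
by congr (_ * _)%E; apply/esym/overlapE.
Qed.

End Step.

End Isometry.

(** * Approximation of Ito integrals of functions of the chain *)

Section GeneratorSemigroup.
Context {R : realType} {d : nat}.
Variable Q : 'M[R]_d.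
Hypothesis gQ : is_generator Q.

Lemma generator_metzler : metzler Q^T.
Proof. by move=> i j ij; rewrite mxE; apply: gQ.1; rewrite eq_sym. Qed.

Lemma generator_col_sum (j : 'I_d) : \sum_i Q^T i j = 0.
Proof. by under eq_bigr do rewrite mxE; exact: gQ.2. Qed.

(** The case [c = 0] of the bound for Metzler matrices, applied to the transpose. *)
Lemma generator_mexp_le (t : R) i j : 0 <= t -> `|mexp (t *: Q) i j| <= d%:R.
Proof.
move=> t0; have : mexp (t *: Q) i j = mexp (t *: Q^T) j i.
  by rewrite -linearZ/= mexp_tr mxE.
move=> ->; apply: le_trans (mx_l1_entry _ _ _) _.
apply: le_trans (mexp_l1_le (c := 0) generator_metzler t0 _) _.
  by move=> k; rewrite generator_col_sum oppr0.
by rewrite oppr0 mul0r expR0 mulr1.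
Qed.

Lemma generator_mexp_lip (t : R) i : 0 <= t -> `|mexp (t *: Q) i i - 1| <= mx_l1 Q * d%:R * t.
Proof.
move=> t0.
have dE (s : R) : is_derive s (1 : R) (fun s => mexp (s *: Q) i i) ((Q *m mexp (s *: Q)) i i).
  by rewrite mexp_scale_comm; exact: mx_derive_mexp.
have cE : {within `[0, t], continuous (fun s => mexp (s *: Q) i i)}.
  apply: continuous_subspaceT => s.
  by apply/differentiable_continuous/derivable1_diffP; have [] := dE s.
have [c /[!in_itv]/= /andP[c0 _]] := MVT_segment t0 (fun s _ => dE s) cE.
rewrite scale0r mexp0 mxE eqxx subr0 => ->.
rewrite normrM (ger0_norm t0) ler_wpM2r// mxE (le_trans (ler_norm_sum _ _ _))//.
apply: (@le_trans _ _ (\sum_k `|Q i k| * d%:R)).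
  by apply: ler_sum => k _; rewrite normrM ler_wpM2l// generator_mexp_le.
rewrite -mulr_suml ler_wpM2r// /mx_l1 [leRHS](bigD1 i)//= lerDl.
by apply: sumr_ge0 => k _; exact: sumr_ge0.
Qed.

End GeneratorSemigroup.

Section Chain.
Context {disp : measure_display} {Omega : measurableType disp} {R : realType}.
Variables (P : probability Omega R) (d : nat) (Q : 'M[R]_d) (X : R -> Omega -> 'I_d).
Local Notation L1 := (L1 P).
Local Notation Ex := (Ex P).
Hypothesis hX : is_markov_chain P Q X.

Lemma chain_measurable (t : R) : 0 <= t -> forall i, measurable (X t @^-1` [set i]).
Proof. by have [_ + _ _] := hX; exact. Qed.

Definition ind (t : R) (i : 'I_d) (w : Omega) : R := (X t w == i)%:R.

Lemma indE (t : R) i : ind t i = \1_(X t @^-1` [set i]).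
Proof.
apply/funext => w; rewrite /ind indicE; congr (_%:R); congr nat_of_bool.
by apply/eqP/idP => [Xi|]; [rewrite inE|rewrite inE].
Qed.

Lemma ind_norm (t : R) i w : `|ind t i w| <= 1.
Proof. by rewrite /ind; case: eqP; rewrite ?normr1 ?normr0. Qed.

Lemma ind_ge0 (t : R) i w : 0 <= ind t i w.
Proof. by rewrite /ind. Qed.

Lemma ind_measurable (t : R) i : 0 <= t -> measurable_fun [set: Omega] (ind t i).
Proof. by move=> t0; rewrite indE; apply: measurable_indic; exact: chain_measurable. Qed.

Lemma ind_L1 (t : R) i : 0 <= t -> L1 (ind t i).
Proof. by move=> t0; apply: L1_bounded (ind_norm t i); exact: ind_measurable. Qed.

Lemma sum_ind (t : R) w : \sum_i ind t i w = 1.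
Proof.
rewrite (bigD1 (X t w))//= big1 ?addr0 /ind ?eqxx// => i iX.
by rewrite eq_sym (negPf iX).
Qed.

Lemma indM (t : R) i j w : ind t i w * ind t j w = (i == j)%:R * ind t i w.
Proof.
rewrite /ind; case: eqP => [->|]; last by rewrite mul0r mulr0.
by rewrite mul1r mulr1.
Qed.

(** The case n = 0 of the Markov property. It is given for strictly increasing times, so [s = t] is
    treated apart. *)
Lemma Ex_ind_transition (s t : R) i j : 0 <= s -> s <= t ->
  Ex (fun w => ind s i w * ind t j w) = Ex (ind s i) * mexp ((t - s) *: Q) i j.
Proof.
move=> s0; rewrite le_eqVlt => /predU1P[<-|st].
  rewrite subrr scale0r mexp0 mxE; under eq_Ex do rewrite indM.
  by rewrite ExZ; [rewrite mulrC|exact: ind_L1].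
have t0 := le_trans s0 (ltW st).
have [_ _ + _] := hX.
move=> /(_ 0%N (fun k => if k is 0%N then s else t) (fun k => if k is 0%N then i else j) s0).
have inc (k : nat) : (k <= 0)%N -> (if k is 0%N then s else t) < t by rewrite leqn0 => /eqP ->.
move=> /(_ inc); rewrite /= => H.
have mi := chain_measurable s0 i; have mj := chain_measurable t0 j.
apply: EFin_inj; rewrite EFinM.
have -> : (fun w => ind s i w * ind t j w) = \1_(X s @^-1` [set i] `&` X t @^-1` [set j]).
  by rewrite indicI !indE.
rewrite Ex_indic; last exact: measurableI.
rewrite indE Ex_indic//.
rewrite bigcap_mkord big_ord_recl big_ord1/= in H.
rewrite bigcap_mkord big_ord1/= in H.
exact: H.
Qed.

(** Conditioning on X(s) gives sum_i P(X(s) = i) (1 - p_ii), and 1 - p_ii is at most linear in the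
    elapsed time. *)
Lemma Ex_ind_jump (s t : R) : 0 <= s -> s <= t ->
  Ex (fun w => (X s w != X t w)%:R) <= mx_l1 Q * d%:R * (t - s).
Proof.
move=> s0 st; have t0 := le_trans s0 st.
have ts0 : 0 <= t - s by rewrite subr_ge0.
have E w : (X s w != X t w)%:R = \sum_i (ind s i w - ind s i w * ind t i w).
  rewrite big_split/= sum_ind sumrN (bigD1 (X s w))//= big1 ?addr0.
    by rewrite /ind eqxx mul1r eq_sym; case: eqP; rewrite ?subrr ?subr0.
  by move=> i iX; rewrite /ind eq_sym (negPf iX) mul0r.
rewrite (eq_Ex _ E).
have l i : L1 (fun w => ind s i w * ind t i w).
  apply: L1_boundedM (ind_norm s i) (ind_L1 i t0); exact: ind_measurable.
have li i : L1 (ind s i) by exact: ind_L1.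
rewrite Ex_sum; last by move=> i; exact: L1B.
under eq_bigr => i _ do rewrite ExB// Ex_ind_transition//.
have pE i : Ex (ind s i) - Ex (ind s i) * mexp ((t - s) *: Q) i i <=
    Ex (ind s i) * (mx_l1 Q * d%:R * (t - s)).
  rewrite -[X in X - _]mulr1 -mulrBr ler_wpM2l//.
    by apply: Ex_ge0 => w; exact: ind_ge0.
  by have [gQ _ _ _] := hX; rewrite (le_trans (ler_norm _))// distrC generator_mexp_lip.
apply: le_trans (ler_sum _ (fun i _ => pE i)) _.
rewrite -mulr_suml -Ex_sum//.
by rewrite (eq_Ex _ (sum_ind s)) Ex_cst mul1r.
Qed.

End Chain.

(** For nonnegative functions the integral is a supremum over simple functions below, hence monotone
    without measurability. This is needed because the mean square distance in the definition of the
    Ito integral is not known to be measurable in time. *)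
Lemma ge0_le_integral_any {disp : measure_display} {S : measurableType disp} {R : realType}
  (m : {measure set S -> \bar R}) (D : set S) (f g : S -> \bar R) :
  (forall x, D x -> (0 <= f x)%E) -> (forall x, D x -> (f x <= g x)%E) ->
  (\int[m]_(x in D) f x <= \int[m]_(x in D) g x)%E.
Proof.
move=> f0 fg.
have g0 x : D x -> (0 <= g x)%E by move=> Dx; apply: le_trans (f0 _ Dx) (fg _ Dx).
rewrite !ge0_integralE//; apply: ereal_sup_le => /= _ [h hf <-].
exists h => // x; apply: le_trans (hf x) _.
by rewrite /patch; case: ifPn => // /[!inE] Dx; exact: fg.
Qed.

(** * Riemann sums for the Ito integral *)

Section ItoApproximation.
Context {disp : measure_display} {Omega : measurableType disp} {R : realType}.
Variables (P : probability Omega R) (d : nat) (Q : 'M[R]_d) (X : R -> Omega -> 'I_d).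
Variable B : R -> Omega -> R.
Local Notation L1 := (L1 P).
Local Notation Ex := (Ex P).
Hypothesis hX : is_markov_chain P Q X.
Hypothesis hB : is_brownian P B.
Hypothesis hXB : independent_of P X B.
Variables (sg : 'I_d -> R) (S0 : R).
Hypothesis sgS : forall i, `|sg i| <= S0.
Local Notation incr := (incr B).
Let measX := chain_measurable hX.
Let K : R := mx_l1 Q * d%:R.

Lemma sp_time_le F (T : R) (phi : simple_process (Omega := Omega) F T) (k l : nat) :
  (k <= l)%N -> (l <= sp_size phi)%N -> sp_time phi k <= sp_time phi l.
Proof.
move=> + ls; elim: l ls => [|l IH] ls; first by rewrite leqn0 => /eqP ->.
rewrite leq_eqVlt => /predU1P[->//|]; rewrite ltnS => kl.
by apply: le_trans (IH (ltnW ls) kl) _; exact: sp_incr.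
Qed.

Lemma Ex_coef_jump (s t : R) : 0 <= s -> s <= t ->
  L1 (fun w => (sg (X s w) - sg (X t w)) ^+ 2) /\
  Ex (fun w => (sg (X s w) - sg (X t w)) ^+ 2) <= (2 * S0) ^+ 2 * (K * (t - s)).
Proof.
move=> s0 st; have t0 := le_trans s0 st.
have msg (r : R) : 0 <= r -> measurable_fun [set: Omega] (fun w => sg (X r w)).
  by move=> r0; apply: (past_measurable_fun measX hB (s := 0)); exact: past_measurable_X.
have m2 : measurable_fun [set: Omega] (fun w => (sg (X s w) - sg (X t w)) ^+ 2).
  by apply: measurable_funX; apply: measurable_funB; exact: msg.
have lj : L1 (fun w => (X s w != X t w)%:R).
  apply: (@L1_bounded _ _ _ _ _ 1); last by move=> w; case: (_ != _); rewrite ?normr1 ?normr0.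
  rewrite (_ : (fun _ => _) = \1_(\bigcup_(i in setT) (X s @^-1` [set i] `&` ~` (X t @^-1` [set i])))).
    apply: measurable_indic; apply: fin_bigcup_measurable => // i _.
    by apply: measurableI; [exact: measX|apply: measurableC; exact: measX].
  apply/funext => w; rewrite indicE; congr (_%:R); congr nat_of_bool.
  apply/idP/idP; rewrite inE.
    by move=> ne; exists (X s w) => //; split => //= Xt; rewrite Xt eqxx in ne.
  by move=> [i _ [/= -> Xt]]; rewrite eq_sym; apply/eqP.
have le w : (sg (X s w) - sg (X t w)) ^+ 2 <= (2 * S0) ^+ 2 * (X s w != X t w)%:R.
  case: eqP => [->|_]; first by rewrite subrr expr0n mulr0.
  rewrite mulr1 -ler_sqrt ?sqr_ge0// !sqrtr_sqr.
  rewrite (le_trans (ler_normB _ _))// (le_trans (lerD (sgS _) (sgS _)))//.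
  by rewrite (le_trans _ (ler_norm _))// mulr_natl.
have l2 : L1 (fun w => (sg (X s w) - sg (X t w)) ^+ 2).
  apply: L1_le m2 _ (L1Z _ lj) => w; rewrite ger0_norm ?sqr_ge0//; exact: le.
split => //; apply: le_trans (Ex_le l2 (L1Z _ lj) le) _.
by rewrite ExZ// ler_wpM2l ?sqr_ge0//; exact: Ex_ind_jump.
Qed.

Variables (n : nat) (h : R).
Hypothesis h0 : 0 <= h.
Let T := n%:R * h.

(** The coefficient is read at the right end of the cell: it looks into the future of the chain, but
    not of B. *)
Definition riem_ito (w : Omega) : R :=
  \sum_(l < n) sg (X (l.+1%:R * h) w) * incr (l%:R * h) (l.+1%:R * h) w.

Let psi (s : R) (w : Omega) : R :=
  \sum_(l < n) sg (X (l.+1%:R * h) w) * \1_(`[l%:R * h, l.+1%:R * h[) s.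

Let psi_close (s : R) : 0 <= s -> s < T ->
  L1 (fun w => (sg (X s w) - psi s w) ^+ 2) /\
  Ex (fun w => (sg (X s w) - psi s w) ^+ 2) <= (2 * S0) ^+ 2 * (K * h).
Proof.
move=> s0 sT.
have hp : 0 < h.
  by rewrite lt_neqAle h0 andbT; apply: contraTneq sT => h00; rewrite /T -h00 mulr0 -leNgt.
pose l := Num.truncn (s / h).
have /andP[lh hl] : l%:R * h <= s < l.+1%:R * h.
  have /andP[l1 l2] := truncn_itv (divr_ge0 s0 h0).
  by rewrite -ler_pdivlMr// -ltr_pdivrMr// l1.
have ln : (l < n)%N.
  by rewrite -(ltr_nat R) -(ltr_pM2r hp) (le_lt_trans lh).
have E w : psi s w = sg (X (l.+1%:R * h) w).
  rewrite /psi (bigD1 (Ordinal ln))//= big1 ?addr0.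
    by rewrite indicE mem_set ?mulr1//= in_itv/= lh.
  move=> k kl; rewrite indicE memNset ?mulr0//= in_itv/= => /andP[k1 k2].
  have H1 : (k < l.+1)%N by rewrite -(ltr_nat R) -(ltr_pM2r hp) (le_lt_trans k1).
  have H2 : (l < k.+1)%N by rewrite -(ltr_nat R) -(ltr_pM2r hp) (le_lt_trans lh).
  by move/negP: kl; apply; apply/eqP/val_inj => /=; apply/eqP; rewrite eqn_leq -ltnS H1 -ltnS H2.
under eq_fun do rewrite E.
have [l1 e1] := Ex_coef_jump s0 (ltW hl).
split => //; apply: le_trans e1 _.
rewrite ler_wpM2l ?sqr_ge0// ler_wpM2l ?mulr_ge0 ?mx_l1_ge0//.
by rewrite lerBlDr (le_trans _ (lerD (lexx h) lh))// -natr1 mulrDl mul1r addrC.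
Qed.

(** J is a limit of integrals of simple processes phi_k. By the isometry, the distance of these to
    the Riemann sum is the distance of phi_k to the step function [psi], which is close to sigma(X)
    up to the probability of a jump within [h]. The factor 4 comes from using (x + y)^2 <= 2 x^2 + 2
    y^2 twice. The mesh [h = 0] is allowed, which serves for the initial value. *)
Lemma ito_riem_close (J : Omega -> R) :
  is_ito_integral P (history X B) B (fun s w => sg (X s w)) T J ->
  L1 (fun w => (J w - riem_ito w) ^+ 2) /\
  Ex (fun w => (J w - riem_ito w) ^+ 2) <= 4 * (2 * S0) ^+ 2 * (K * h) * T.
Proof.
move=> [mJ [phi [phiH phiJ]]].
have T0 : 0 <= T by rewrite mulr_ge0.
pose c : R := (2 * S0) ^+ 2 * (K * h).
have c0 : 0 <= c by rewrite mulr_ge0 ?sqr_ge0// mulr_ge0// mulr_ge0// mx_l1_ge0.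
have lh l : 0 <= l%:R * h by rewrite mulr_ge0.
have ll l : l%:R * h <= l.+1%:R * h by rewrite ler_wpM2r// ler_nat.
have lT (l : 'I_n) : l.+1%:R * h <= T by rewrite ler_wpM2r// ler_nat.
have pX l : measurable_fun [set: Omega] (fun w => sg (X (l%:R * h) w)).
  by apply: (past_measurable_fun measX hB (s := 0)); exact: past_measurable_X.
have mR : measurable_fun [set: Omega] riem_ito.
  apply: measurable_sum => l; apply: measurable_funM; first exact: pX.
  exact: (incr_measurable hB).
have mE (f : Omega -> R) : measurable_fun [set: Omega] f ->
    measurable_fun [set: Omega] (fun w => ((f w) ^+ 2)%:E).
  by move=> mf; apply/measurable_EFinP; exact: measurable_funX.
have sq0 (x : R) : (0 <= (x ^+ 2)%:E)%E by rewrite lee_fin sqr_ge0.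
suff main : (\int[P]_w ((J w - riem_ito w) ^+ 2)%:E <= (4 * c * T)%:E)%E.
  have lJ : L1 (fun w => (J w - riem_ito w) ^+ 2).
    apply: L1_ge0; [by apply: measurable_funX; exact: measurable_funB|by move=> w; exact: sqr_ge0|].
    exact: le_lt_trans main (ltry _).
  by split => //; rewrite -lee_fin -EFin_Ex// (le_trans main)// lee_fin /c !mulrA.
pose q k s : \bar R := 'E_P[fun w => ((sp_val (phi k) s w - sg (X s w)) ^+ 2)%R]%E.
pose r k : \bar R := 'E_P[fun w => ((sp_int (phi k) B w - J w) ^+ 2)%R]%E.
have step k : measurable_fun [set: Omega] (sp_int (phi k) B) /\
  (\int[P]_w ((sp_int (phi k) B w - riem_ito w) ^+ 2)%:E <=
   2%:E * (\int[lebesgue_measure]_(s in `[0%R, T]) q k s) + (2 * c * T)%:E)%E.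
  (* The cells of phi_k and those of the grid form one family, the latter with opposite
     coefficients, so that the isometry applies to the difference of the two integrals. *)
  pose I : finType := ('I_(sp_size (phi k)) + 'I_n)%type.
  pose a (i : I) : R := match i with inl l => sp_time (phi k) l | inr l => l%:R * h end.
  pose b (i : I) : R := match i with inl l => sp_time (phi k) l.+1 | inr l => l.+1%:R * h end.
  pose e (i : I) (w : Omega) : R :=
    match i with inl l => sp_coef (phi k) l w | inr l => - sg (X (l.+1%:R * h) w) end.
  have a0 i : 0 <= a i.
    case: i => l //=; rewrite -(sp_time0 (phi k)); apply: sp_time_le => //; exact: ltnW.
  have ab i : a i <= b i by case: i => l /=; [exact: sp_incr|exact: ll].
  have bT i : b i <= T.
    case: i => l /=; last exact: lT.
    apply: (@le_trans _ _ (sp_time (phi k) (sp_size (phi k)))); first exact: sp_time_le.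
    by rewrite sp_timeT.
  have pe i : past_measurable X B (a i) (e i).
    move: (a0 i); case: i => l /= al.
      by apply: (history_past al) => U mU; exact: sp_meas.
    exact: (@past_measurable_X _ _ _ _ X B (l%:R * h) (l.+1%:R * h) (fun i => - sg i) (lh _)).
  have be i : exists C : R, forall w, `|e i w| <= C.
    case: i => l /=; first exact: sp_bound.
    by exists S0 => w; rewrite normrN.
  have [lS eS] := step_isometry measX hB hXB a0 ab bT pe be.
  have EI w : \sum_i e i w * incr (a i) (b i) w = sp_int (phi k) B w - riem_ito w.
    rewrite big_sumType/= /sp_int /riem_ito -sumrN; congr (_ + _).
    by apply: eq_bigr => l _; rewrite mulNr.
  have EV s w : \sum_i e i w * \1_(`[a i, b i[) s = sp_val (phi k) s w - psi s w.
    rewrite big_sumType/= /sp_val /psi -sumrN; congr (_ + _).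
    by apply: eq_bigr => l _; rewrite mulNr.
  have mI : measurable_fun [set: Omega] (sp_int (phi k) B).
    apply: measurable_sum => l; apply: measurable_funM.
      exact: (past_measurable_fun measX hB (pe (inl l))).
    exact: (incr_measurable hB (a0 (inl l)) (ab (inl l))).
  split => //; rewrite (eq_integral (fun w => ((\sum_i e i w * incr (a i) (b i) w) ^+ 2)%:E)); last first.
    by move=> w _; rewrite EI.
  rewrite (EFin_Ex lS) eS.
  pose f (s : R) : R := Ex (fun w => (\sum_i e i w * \1_(`[a i, b i[) s) ^+ 2).
  rewrite -/(f _).
  have f0 s : 0 <= f s by apply: Ex_ge0 => w; exact: sqr_ge0.
  have mf : measurable_fun [set: measurableTypeR R] f.
    rewrite (_ : f = fun s => \sum_(p : I * I) Ex (fun w => e p.1 w * e p.2 w) *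
        \1_(`[a p.1, b p.1[ `&` `[a p.2, b p.2[) s).
      apply: measurable_sum => p; apply: measurable_funM => //.
      by apply: measurable_indic; exact: measurableI.
    by apply/funext => s; rewrite /f (Ex_step_sq measX hB b pe be s).2.
  have q0 s : (0 <= q k s)%E.
    by rewrite /q unlock; apply: integral_ge0 => w _; exact: sq0.
  have fq s : 0 <= s <= T -> ((f s)%:E <= 2%:E * q k s + (2 * c)%:E)%E.
    (* At [s = T] all the half-open cells have ended, so the step process is 0 there. *)
    move=> /andP[s0]; rewrite le_eqVlt => /predU1P[->|sT].
      rewrite /f; under eq_Ex => w.
        rewrite big1; first by rewrite expr0n; over.
        by move=> i _; rewrite indicE memNset ?mulr0//= in_itv/= ltNge bT andbF.
      by rewrite Ex_cst adde_ge0 ?mule_ge0// lee_fin mulr_ge0.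
    have [l1 e1] := psi_close s0 sT.
    have [l2 _] := Ex_step_sq measX hB b pe be s.
    have mX : measurable_fun [set: Omega] (fun w => sg (X s w)).
      by apply: (past_measurable_fun measX hB (s := 0)); exact: past_measurable_X.
    have mV : measurable_fun [set: Omega] (sp_val (phi k) s).
      apply: measurable_sum => l; apply: measurable_funM => //.
      exact: (past_measurable_fun measX hB (pe (inl l))).
    have l3 : L1 (fun w => (sp_val (phi k) s w - sg (X s w)) ^+ 2).
      apply: (@L1_le _ _ _ _ _ (fun w => 2 * (\sum_i e i w * \1_(`[a i, b i[) s) ^+ 2 +
          2 * (sg (X s w) - psi s w) ^+ 2)).
      - by apply: measurable_funX; exact: measurable_funB.
      - move=> w; rewrite EV ger0_norm ?sqr_ge0//.
        move: (sp_val _ _ _) (psi _ _) (sg _) => x y z.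
        by have := sqr_ge0 (x + z - 2 * y); nra.
      - by apply: L1D; apply: L1Z.
    have -> : q k s = (Ex (fun w => (sp_val (phi k) s w - sg (X s w)) ^+ 2))%:E.
      by rewrite /q ExpectationE.
    rewrite -EFinM -EFinD lee_fin.
    apply: (@le_trans _ _ (2 * Ex (fun w => (sp_val (phi k) s w - sg (X s w)) ^+ 2) +
        2 * Ex (fun w => (sg (X s w) - psi s w) ^+ 2))).
      rewrite -!ExZ// -ExD; [|exact: L1Z|exact: L1Z].
      apply: Ex_le => //; first by apply: L1D; apply: L1Z.
      move=> w; rewrite EV; move: (sp_val _ _ _) (psi _ _) (sg _) => x y z.
      by have := sqr_ge0 (x + y - 2 * z); nra.
    by rewrite lerD2l// ler_wpM2l.
  (* The bound f <= 2 q + 2 c cannot be integrated term by term, since [q] may fail to be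
     measurable. The function [g] is a measurable minorant of [q] for which f <= 2 g + 2 c still
     holds. *)
  pose g (s : R) : R := Num.max (f s - 2 * c) 0 / 2.
  have g0 s : 0 <= g s by rewrite /g divr_ge0// le_max lexx orbT.
  have mg : measurable_fun [set: measurableTypeR R] g.
    apply: measurable_funM => //; apply: measurable_maxr => //.
    exact: measurable_funB.
  have c20 : 0 <= 2 * c by rewrite mulr_ge0.
  apply: (@le_trans _ _ (\int[lebesgue_measure]_(s in `[0%R, T]) (2%:E * (g s)%:E + (2 * c)%:E))%E).
    apply: ge0_le_integral_any => s _; first by rewrite lee_fin; exact: (f0 s).
    rewrite -/(f s) -EFinM -EFinD lee_fin /g mulrC divfK//.
    by rewrite -lerBlDr le_max lexx.
  have mEg : measurable_fun (`[0, T]%classic : set (measurableTypeR R)) (EFin \o g).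
    by apply/measurable_EFinP; exact: measurable_funTS.
  rewrite ge0_integralD//=; last 2 first.
  - by move=> s _; rewrite mule_ge0// lee_fin; exact: (g0 s).
  - exact: measurable_funeM.
  rewrite ge0_integralZl//; last by move=> s _; rewrite lee_fin; exact: (g0 s).
  rewrite integral_cst//= lebesgue_measure_itv/= lte_fin.
  apply: leeD.
    rewrite lee_wpmul2l//; apply: ge0_le_integral_any => s; first by rewrite lee_fin => _; exact: (g0 s).
    rewrite /= in_itv/= => sT; have := fq s sT; move: (q0 s).
    case: (q k s) => [x| _ _|//]; last by rewrite leey.
    rewrite -EFinM -EFinD !lee_fin /g => x0 fx.
    by rewrite ler_pdivrMr// ge_max mulr_ge0// andbT lerBlDr mulrC.
  case: ltP => [_|T0']; first by rewrite -EFinD -EFinM subr0.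
  by rewrite mule0 lee_fin mulr_ge0.
have bound k : (\int[P]_w ((J w - riem_ito w) ^+ 2)%:E <=
    2%:E * r k + (4%:E * (\int[lebesgue_measure]_(s in `[0%R, T]) q k s) + (4 * c * T)%:E))%E.
  have [mI le1] := step k.
  apply: (@le_trans _ _ (\int[P]_w (2%:E * ((sp_int (phi k) B w - J w) ^+ 2)%:E +
      2%:E * ((sp_int (phi k) B w - riem_ito w) ^+ 2)%:E))%E).
    apply: ge0_le_integral_any => w _; first exact: sq0.
    rewrite -!EFinM -EFinD lee_fin; move: (sp_int _ _ _) (J w) (riem_ito w) => x y z.
    by have := sqr_ge0 (2 * x - y - z); nra.
  rewrite ge0_integralD//=; last 4 first.
  - by move=> w _; rewrite mule_ge0.
  - by apply: measurable_funeM; exact: (mE _ (measurable_funB mI mJ)).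
  - by move=> w _; rewrite mule_ge0.
  - by apply: measurable_funeM; exact: (mE _ (measurable_funB mI mR)).
  rewrite !ge0_integralZl//; last 2 first.
  - exact: (mE _ (measurable_funB mI mR)).
  - exact: (mE _ (measurable_funB mI mJ)).
  rewrite /r unlock leeD2l//; apply: le_trans (lee_wpmul2l _ le1) _ => //.
  rewrite ge0_muleDr ?mule_ge0//; last 2 first.
  - by apply: integral_ge0 => s _; rewrite /q unlock; apply: integral_ge0 => w _; exact: sq0.
  - by rewrite lee_fin; apply: mulr_ge0 T0; exact: mulr_ge0.
  have E22 : (2 * 2 : R) = 4 by ring.
  have E4 : 2 * (2 * c * T) = 4 * c * T by rewrite -E22 !mulrA.
  by rewrite muleA -EFinM E22 -EFinM E4.
have lim : (2%:E * r k + (4%:E * (\int[lebesgue_measure]_(s in `[0%R, T]) q k s) + (4 * c * T)%:E))%E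
    @[k --> \oo] --> (2%:E * 0 + (4%:E * 0 + (4 * c * T)%:E))%E.
  apply: cvgeD; first by rewrite !mule0 add0e.
    by apply: cvgeZl.
  apply: cvgeD; first by rewrite mule0.
    by apply: cvgeZl.
  exact: cvg_cst.
rewrite !mule0 !add0e in lim.
by apply: (cvge_ge _ lim); near=> k; exact: bound.
Unshelve. all: by end_near. Qed.

End ItoApproximation.

(** * Almost sure convergence of the scheme *)

Section GridStep.
Context {R : realType}.
Implicit Types (h s T : R).

Lemma grid_floor h s : 0 < h -> 0 <= s ->
  (Num.truncn (s / h))%:R * h <= s < (Num.truncn (s / h)).+1%:R * h.
Proof.
move=> hp s0; have /andP[l1 l2] := truncn_itv (divr_ge0 s0 (ltW hp)).
by rewrite -ler_pdivlMr// -ltr_pdivrMr// l1.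
Qed.

Lemma grid_floor_uniq h s k : 0 < h -> 0 <= s -> k%:R * h <= s < k.+1%:R * h ->
  k = Num.truncn (s / h).
Proof.
move=> hp s0 /andP[k1 k2]; have /andP[l1 l2] := grid_floor hp s0.
apply/eqP; rewrite eqn_leq; apply/andP; split; rewrite -ltnS.
  by rewrite -(ltr_nat R) -(ltr_pM2r hp) (le_lt_trans k1).
by rewrite -(ltr_nat R) -(ltr_pM2r hp) (le_lt_trans l1).
Qed.

Lemma grid_step_val h s N (phi : nat -> R) : 0 < h -> 0 <= s -> (Num.truncn (s / h) < N)%N ->
  \sum_(l < N) phi l * \1_(`[l%:R * h, l.+1%:R * h[) s = phi (Num.truncn (s / h)).
Proof.
move=> hp s0 lN; rewrite (bigD1 (Ordinal lN))//= big1 ?addr0.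
  by rewrite indicE mem_set ?mulr1//= in_itv/=; exact: grid_floor.
move=> k kl; rewrite indicE memNset ?mulr0//= in_itv/= => /(grid_floor_uniq hp s0) kE.
by move/negP: kl; apply; apply/eqP/val_inj.
Qed.

(** The interval is closed, so cell number [k] meets it too, but in the single point kh. *)
Lemma lebesgue_grid_cell h (k l : nat) : 0 < h ->
  (lebesgue_measure (`[0%R, (k%:R * h)%R] `&` `[(l%:R * h)%R, (l.+1%:R * h)%R[ : set R)
    = if (l < k)%N then h%:E else 0)%E.
Proof.
move=> hp; have lh : 0 <= l%:R * h by rewrite mulr_ge0// ltW.
case: ltnP => lk.
  have -> : `[0, k%:R * h] `&` `[l%:R * h, l.+1%:R * h[ = `[l%:R * h, l.+1%:R * h[%classic :> set R.
    apply/setIidPr => x /=; rewrite !in_itv/= => /andP[lx xl].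
    rewrite (le_trans lh lx) (le_trans (ltW xl))// ler_pM2r// ler_nat//.
  rewrite lebesgue_measure_itv/= lte_fin ltr_pM2r// ltr_nat ltnSn -EFinB.
  by congr EFin; rewrite -natr1; ring.
apply/eqP; rewrite eq_le measure_ge0 andbT.
rewrite -(lebesgue_measure_set1 (k%:R * h)).
apply: le_measure; rewrite ?inE//; first exact: measurableI.
move=> x /=; rewrite !in_itv/= => -[/andP[_ xk] /andP[lx _]].
apply/eqP; rewrite eq_le xk/= (le_trans _ lx)// ler_pM2r// ler_nat//.
Qed.

End GridStep.

Lemma bounded_convergence {disp : measure_display} {S : measurableType disp} {R : realType}
  (m : {measure set S -> \bar R}) (D : set S) (f_ : nat -> S -> R) (f : S -> R) (A : R) :
  measurable D -> (m D < +oo)%E -> (forall n, measurable_fun D (f_ n)) ->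
  (forall n s, D s -> `|f_ n s| <= A) -> (forall s, D s -> f_ n s @[n --> \oo] --> f s) ->
  [/\ forall n, m.-integrable D (EFin \o f_ n), m.-integrable D (EFin \o f) &
      \int[m]_(s in D) `|f_ n s - f s| @[n --> \oo] --> (0 : R)].
Proof.
move=> mD fD mf fA fcvg.
have fcvgE s : D s -> (f_ n s)%:E @[n --> \oo] --> (f s)%:E.
  by move=> Ds; apply: cvg_EFin; [exact: nearW|exact: fcvg].
have mE n : measurable_fun D (EFin \o f_ n) by exact/measurable_EFinP.
have mf0 : measurable_fun D (EFin \o f).
  by apply: (@emeasurable_fun_cvg _ _ _ _ (fun n => EFin \o f_ n)) => // s Ds; exact: fcvgE.
have iA : m.-integrable D (EFin \o (fun=> A)).
  apply/integrableP; split; first exact: measurable_cst.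
  rewrite (eq_integral (cst `|A|%:E))// integral_cst//.
  by rewrite lte_mul_pinfty.
have ifn n : m.-integrable D (EFin \o f_ n).
  apply: le_integrable iA => // s Ds; rewrite lee_fin (le_trans (fA n s Ds))//; exact: ler_norm.
have [idf lim _] := dominated_convergence mD mE mf0 (aeW _ fcvgE) iA
  (aeW _ (fun s n (Ds : D s) => (fA n s Ds : (`|(f_ n s)%:E| <= A%:E)%E))).
split => //; apply: (@cvg_trans _ (fine (\int[m]_(s in D) `|(f_ n s)%:E - (f s)%:E|)%E @[n --> \oo])) => //.
have := fine_cvg lim; exact.
Qed.

(** * The drift along one path *)

Section PathIntegral.
Context {R : realType} {d : nat}.
Variables (a g : 'I_d -> R) (x : R -> 'I_d) (m : R -> R) (T : R).
Hypothesis T0 : 0 < T.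
Hypothesis cm : {within `[0, +oo[, continuous m}.
Hypothesis cx : forall t : R, 0 <= t -> \forall s \near t^'+, x s = x t.

Definition drift (s : R) : R := a (x s) - g (x s) * m s.

Let h (n : nat) : R := T / n.+1%:R.
Let h0 n : 0 < h n. Proof. by rewrite divr_gt0. Qed.
Let nh n : n.+1%:R * h n = T. Proof. by rewrite mulrC divfK. Qed.

(** The chain is read at the right end and the process at the left end, exactly as the scheme does,
    so that subtracting the two sums leaves only differences of the processes. *)
Definition grid_drift (n l : nat) : R :=
  a (x (l.+1%:R * (T / n.+1%:R))) - g (x (l.+1%:R * (T / n.+1%:R))) * m (l%:R * (T / n.+1%:R)).

(** There are n+2 cells although n+1 cover [0, T[: the point [T] itself belongs to the next one. *)
Let fh (n : nat) (s : R) : R :=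
  \sum_(l < n.+2) grid_drift n l * \1_(`[l%:R * h n, l.+1%:R * h n[) s.

Let fhE n (s : R) : 0 <= s <= T -> fh n s = grid_drift n (Num.truncn (s / h n)).
Proof.
move=> /andP[s0 sT]; rewrite /fh grid_step_val// ltnS.
have /andP[l1 _] := grid_floor (h0 n) s0.
by rewrite -ltnS -(ltr_nat R) -(ltr_pM2r (h0 n)) (le_lt_trans l1)// (le_lt_trans sT)// -{1}(nh n) ltr_pM2r// ltr_nat.
Qed.

Let hlim : h n @[n --> \oo] --> (0 : R).
Proof.
rewrite -[X in _ --> X](mulr0 T); apply: cvgM; first exact: cvg_cst.
exact: cvg_harmonic.
Qed.

(** The right ends are strictly larger than [s] and tend to it, so by right continuity the chain
    eventually has there its value at [s]; the left ends tend to [s] and [m] is continuous. *)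
Let fh_cvg (s : R) : 0 <= s <= T -> fh n s @[n --> \oo] --> drift s.
Proof.
move=> sT; have /andP[s0 _] := sT.
pose l n := Num.truncn (s / h n).
have lo n : (l n)%:R * h n <= s by have /andP[] := grid_floor (h0 n) s0.
have hi n : s < (l n).+1%:R * h n by have /andP[] := grid_floor (h0 n) s0.
have lh0 n : 0 <= (l n)%:R * h n by rewrite mulr_ge0// ltW.
have lim1 : (l n)%:R * h n @[n --> \oo] --> s.
  have dh n : s - h n <= (l n)%:R * h n.
    by rewrite lerBlDr (le_trans (ltW (hi n)))// -natr1 mulrDl mul1r.
  apply: (@squeeze_cvgr _ _ _ _ (fun n => s - h n) (fun=> s)).
  - by apply: nearW => n; rewrite dh lo.
  - by rewrite -[X in _ --> X]subr0; apply: cvgB; [exact: cvg_cst|exact: hlim].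
  - exact: cvg_cst.
have lim2 : (l n).+1%:R * h n @[n --> \oo] --> s^'+.
  have lim2 : (l n).+1%:R * h n @[n --> \oo] --> s.
    rewrite (_ : (fun n => _) = (fun n => (l n)%:R * h n + h n)); last first.
      by apply/funext => n; rewrite -natr1 mulrDl mul1r.
    by rewrite -[X in _ --> X]addr0; apply: cvgD; [exact: lim1|exact: hlim].
  move=> U /= [e e0 eU]; suff : \forall n \near \oo, U ((l n).+1%:R * h n) by [].
  near=> n; have bn : `|s - (l n).+1%:R * h n| < e by near: n; move/cvgrPdist_lt : lim2; apply.
  exact: (eU _ bn (hi n)).
have xl : \forall n \near \oo, x ((l n).+1%:R * h n) = x s := lim2 _ (cx s0).
have ml : m ((l n)%:R * h n) @[n --> \oo] --> m s.
  have /subspace_continuousP/(_ s) := cm.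
  have Ds : `[0, +oo[%classic s by rewrite /= in_itv/= s0.
  move=> /(_ Ds) cms; apply: cvg_comp cms.
  move=> U /= /lim1 H; suff : \forall n \near \oo, U ((l n)%:R * h n) by [].
  have {}H : \forall n \near \oo, `[0, +oo[%classic ((l n)%:R * h n) -> U ((l n)%:R * h n) := H.
  by apply: filterS H => n; apply; rewrite /= in_itv/= lh0.
apply: (@cvg_trans _ ((fun n => a (x s) - g (x s) * m ((l n)%:R * h n)) @ \oo)).
  apply: near_eq_cvg; near=> n; rewrite fhE// /grid_drift -/(h n) -/(l n).
  by have -> : x ((l n).+1%:R * h n) = x s by near: n.
by apply: cvgB; [exact: cvg_cst|apply: cvgM; [exact: cvg_cst|exact: ml]].
Unshelve. all: by end_near. Qed.

Let mu := @lebesgue_measure R.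
Let D : set (measurableTypeR R) := `[0, T].
Let mD : measurable D. Proof. exact: measurable_itv. Qed.

Let mfh n (A : set (measurableTypeR R)) : measurable_fun A (fh n).
Proof.
apply: measurable_funTS; by apply: measurable_sum => l; apply: measurable_funM => //; exact: measurable_indic.
Qed.

Let bounded_m : exists C : R, forall s : R, 0 <= s <= T -> `|m s| <= C.
Proof.
have cmT : {within `[0, T], continuous m}.
  by apply: continuous_subspaceW cm => s /=; rewrite !in_itv/= => /andP[->].
have [c1 _ c1P] := EVT_max (ltW T0) cmT.
have [c2 _ c2P] := EVT_min (ltW T0) cmT.
exists (`|m c1| + `|m c2|) => s sT.
have sD : s \in `[0, T] by rewrite in_itv.
have := c1P _ sD; have := c2P _ sD.
have := ler_norm (m c1); have := lerNnormlW (lexx `|m c2|).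
have := normr_ge0 (m c1); have := normr_ge0 (m c2).
move: (`|m c1|) (`|m c2|) => p q; rewrite ler_norml; lra.
Qed.

(** One sequence [rho] serves all [k], because the error over [0, kh] is at most the integral of the
    absolute error over the whole of [0, T], to which bounded convergence applies. *)
Lemma drift_riemann : exists rho : nat -> R,
  rho n @[n --> \oo] --> (0 : R) /\
  forall n k, (k <= n.+1)%N ->
    `|(\int[lebesgue_measure]_(s in `[0, k%:R * (T / n.+1%:R)]) drift s)
      - T / n.+1%:R * \sum_(l < k) grid_drift n l| <= rho n.
Proof.
have [C mC] := bounded_m.
have C0 : 0 <= C by rewrite (le_trans _ (mC 0 _))// lexx ltW.
pose A := \sum_i (`|a i| + `|g i| * C).
have le1 i (y : R) : `|y| <= C -> `|a i - g i * y| <= A.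
  move=> yC; rewrite (le_trans (ler_normB _ _))// normrM.
  rewrite /A (bigD1 i)//= (@le_trans _ _ (`|a i| + `|g i| * C))//.
    by rewrite lerD2l ler_wpM2l.
  by rewrite lerDl; apply: sumr_ge0 => j _; rewrite addr_ge0// mulr_ge0.
have fhA n s : D s -> `|fh n s| <= A.
  rewrite /D/= in_itv/= => sT; rewrite fhE//; apply: le1; apply: mC.
  have /andP[s0 sT'] := sT; have /andP[l1 _] := grid_floor (h0 n) s0.
  by rewrite mulr_ge0 ?(ltW (h0 n))//= (le_trans l1).
have driftA s : D s -> `|drift s| <= A.
  by rewrite /D/= in_itv/= => sT; apply: le1; exact: mC.
have muD : (mu D < +oo)%E by exact: lebesgue_measure_itv_lty.
have fcvg s : D s -> fh n s @[n --> \oo] --> drift s.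
  by rewrite /D/= in_itv/=; exact: fh_cvg.
have [ifh idr lim] := bounded_convergence mD muD (fun n => @mfh n D) fhA fcvg.
exists (fun n => \int[mu]_(s in D) `|fh n s - drift s|); split; first exact: lim.
move=> n k kn; have kT : k%:R * h n <= T.
  by rewrite -[leRHS](nh n) ler_pM2r// ler_nat.
pose Dk : set (measurableTypeR R) := `[0, k%:R * h n]%classic.
have mDk : measurable Dk by exact: measurable_itv.
have DkD : Dk `<=` D.
  by move=> s; rewrite /Dk /D /= !in_itv/= => /andP[-> sk]; rewrite (le_trans sk).
have ifhk : mu.-integrable Dk (EFin \o fh n) by exact: integrableS (ifh n).
have idrk : mu.-integrable Dk (EFin \o drift) by exact: integrableS idr.
have Ifh : \int[mu]_(s in Dk) fh n s = h n * \sum_(l < k) grid_drift n l.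
  rewrite /Rintegral integral_indic_sum//; last exact: lebesgue_measure_itv_lty.
  rewrite (eq_bigr (fun l : 'I_n.+2 => (if (l < k)%N then h n * grid_drift n l else 0)%:E)); last first.
    move=> l _; transitivity ((grid_drift n l)%:E * (if (l < k)%N then (h n)%:E else 0))%E.
      by congr (_ * _)%E; exact: lebesgue_grid_cell.
    by case: ifP => _; rewrite ?mule0// -EFinM mulrC.
  rewrite sumEFin/= -big_mkcond/= mulr_sumr.
  by rewrite (big_ord_widen_cond n.+2 xpredT (fun l => h n * grid_drift n l))// ltnW.
rewrite -/(h n) -Ifh -[X in X - _]/(\int[mu]_(s in Dk) drift s) -RintegralB//.
have idf : mu.-integrable Dk (EFin \o (fun s => drift s - fh n s)) by have := integrableB mDk idrk ifhk.
rewrite (le_trans (le_normr_Rintegral mDk idf))//.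
have ind : mu.-integrable D (EFin \o (fun s => `|fh n s - drift s|)).
  by apply: integrable_norm; have := integrableB mD (ifh n) idr.
rewrite /Rintegral; apply: fine_le.
- by apply: integrable_fin_num => //; exact: integrable_norm.
- exact: integrable_fin_num.
apply: le_trans (@ge0_subset_integral _ _ _ mu _ _ mDk mD _ _ _ DkD).
- by under eq_integral do rewrite distrC.
- exact: measurable_int ind.
- by move=> s _; rewrite lee_fin.
Qed.

End PathIntegral.

(** Along n + 1 = 2^k the second moments are summable, so the sum of the squares is integrable,
    hence almost surely finite, and its terms tend to 0. *)
Lemma ae_cvg0_subseq {disp : measure_display} {Omega : measurableType disp} {R : realType}
  (P : probability Omega R) (Y : nat -> Omega -> R) (C : R) :
  (forall n, measurable_fun [set: Omega] (Y n)) ->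
  (forall n, L1 P (fun w => Y n w ^+ 2)) ->
  (forall n, Ex P (fun w => Y n w ^+ 2) <= C / n.+1%:R) ->
  {ae P, forall w, Y ((2 ^ k).-1)%N w @[k --> \oo] --> (0 : R)}.
Proof.
move=> mY lY eY.
pose f k w : \bar R := (Y ((2 ^ k).-1)%N w ^+ 2)%:E.
have f0 k w : (0 <= f k w)%E by rewrite lee_fin sqr_ge0.
have mf k : measurable_fun [set: Omega] (f k) by apply/measurable_EFinP; exact: measurable_funX.
have C0 : 0 <= C.
  by have := eY 0%N; rewrite divr1; apply: le_trans; apply: Ex_ge0 => w; exact: sqr_ge0.
pose S w := (\sum_(0 <= k <oo) f k w)%E.
have bound : (\int[P]_w S w <= (2 * C)%:E)%E.
  rewrite integral_nneseries//.
  apply: lime_le; first by apply: is_cvg_nneseries => k _ _; exact: integral_ge0.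
  near=> n.
  apply: (@le_trans _ _ (\sum_(0 <= k < n) (C / 2 ^+ k)%:E)%E).
    apply: lee_sum => k _; rewrite /f EFin_Ex// lee_fin (le_trans (eY _))//.
    by rewrite prednK ?expn_gt0// natrX.
  rewrite sumEFin lee_fin.
  have H : \sum_(0 <= k < n) C / 2 ^+ k <= 2 * C - 2 * C / 2 ^+ n.
    elim: (n) => [|k IH]; first by rewrite big_nil expr0 divr1 subrr.
    rewrite big_nat_recr//= (le_trans (lerD IH (lexx _)))//.
    by rewrite le_eqVlt; apply/orP; left; apply/eqP; rewrite exprS; field; rewrite expf_neq0.
  by rewrite (le_trans H)// gerBl divr_ge0 ?mulr_ge0// exprn_ge0.
have S0 w : (0 <= S w)%E by exact: nneseries_ge0.
have iS : P.-integrable [set: Omega] S.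
  apply/integrableP; split; first by apply: ge0_emeasurable_sum.
  under eq_integral do rewrite gee0_abs//.
  exact: le_lt_trans bound (ltry _).
apply: filterS (integrable_ae measurableT iS) => w /(_ I) Sw.
have Slt : (S w < +oo)%E by rewrite -ge0_fin_numE.
have tail := nneseries_tail_cvg Slt (fun k _ => f0 k w).
have sq : Y ((2 ^ k).-1)%N w ^+ 2 @[k --> \oo] --> (0 : R).
  have : f k w @[k --> \oo] --> 0%E.
    apply: (@squeeze_cvge _ _ _ _ (fun=> 0%E) _ (fun N => \sum_(N <= k <oo) f k w)%E).
    - apply: nearW => N; rewrite f0/= (nneseries_split N 1) ?addn1.
        by rewrite big_nat1 leeDl//; exact: nneseries_ge0.
      by move=> k _; exact: f0.
    - exact: cvg_cst.
    - exact: tail.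
  by move/fine_cvg.
apply/cvgr0Pnorm_lt => /= e e0.
have /cvgr0Pnorm_lt/(_ (e ^+ 2)) := sq.
have e2 : 0 < e ^+ 2 by rewrite exprn_gt0.
move=> /(_ e2); apply: filterS => k.
by rewrite normrX ltr_sqr ?nnegrE// ltW.
Unshelve. all: by end_near. Qed.

(** The perturbations [b k] are kept in a sum instead of being replaced by a maximum: in the
    application they are Ito errors, each controlled in mean square but not jointly in [k]. *)
Lemma discrete_gronwall {R : realType} (u b : nat -> R) (c r : R) (N : nat) :
  0 <= c -> 0 <= r -> (forall k, 0 <= b k) ->
  (forall k, (k <= N)%N -> u k <= r + b k + c * \sum_(l < k) u l) ->
  u N <= r + b N + c * (1 + c) ^+ N * \sum_(l < N) (r + b l).
Proof.
move=> c0 r0 b0 uN.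
have H k : (k <= N)%N -> \sum_(l < k) u l <= (1 + c) ^+ k * \sum_(l < k) (r + b l).
  elim: k => [|k IH] kN; first by rewrite !big_ord0 mulr0.
  rewrite !big_ord_recr/=; have := IH (ltnW kN); have := uN k (ltnW kN).
  have : 1 <= (1 + c) ^+ k.+1 by rewrite exprn_ege1// lerDl.
  have := b0 k; rewrite exprS; set U := \sum_(_ < _) u _; set V := \sum_(_ < _) _.
  move: (b k) (u k) ((1 + c) ^+ k) => bk uk q bk0 q1 H1 H2.
  apply: (@le_trans _ _ ((1 + c) * (q * V) + (r + bk))).
    have : (1 + c) * U <= (1 + c) * (q * V) by rewrite ler_wpM2l// addr_ge0.
    lra.
  by rewrite mulrDr !mulrA lerD2l -[leLHS]mul1r ler_wpM2r// addr_ge0.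
by rewrite (le_trans (uN N _))// lerD2l -mulrA ler_wpM2l// H.
Qed.

Section Scheme.
Context {disp : measure_display} {Omega : measurableType disp} {R : realType} {d : nat}.
Variables (al gm sg : 'I_d -> R) (m0 : R) (X : R -> Omega -> 'I_d) (B : R -> Omega -> R).

(* The coefficients are frozen at the right end of each cell: X is independent
   of B, so that they do not anticipate the increments of B. *)
Fixpoint scheme (h : R) (k : nat) (w : Omega) : R :=
  if k is k'.+1 then
    (1 - h * gm (X (k'.+1%:R * h) w)) * scheme h k' w + h * al (X (k'.+1%:R * h) w)
    + sg (X (k'.+1%:R * h) w) * incr B (k'%:R * h) (k'.+1%:R * h) w
  else m0.

Lemma schemeE (h : R) k w : scheme h k w = m0
  + h * \sum_(l < k) (al (X (l.+1%:R * h) w) - gm (X (l.+1%:R * h) w) * scheme h l w)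
  + riem_ito X B sg k h w.
Proof.
rewrite /riem_ito; elim: k => [|k IH]; first by rewrite !big_ord0 mulr0 !addr0.
move: IH; rewrite /= !big_ord_recr/=; set S := \sum_(i < k) _; set S' := \sum_(i < k) _.
by move: (scheme h k w) => z ->; ring.
Qed.

Variables (T G0 : R) (J : R -> Omega -> R) (M : R -> Omega -> R) (n : nat) (w : Omega) (r : R).
Let h : R := T / n.+1%:R.
Hypothesis T0 : 0 < T.
Hypothesis gmG : forall i, `|gm i| <= G0.
Hypothesis r0 : 0 <= r.
Hypothesis ME : forall k, (k <= n.+1)%N -> M (k%:R * h) w = m0
  + \int[lebesgue_measure]_(s in `[0, k%:R * h]) drift al gm (X ^~ w) (M ^~ w) s
  + J (k%:R * h) w.
Hypothesis driftE : forall k, (k <= n.+1)%N ->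
  `|(\int[lebesgue_measure]_(s in `[0, k%:R * h]) drift al gm (X ^~ w) (M ^~ w) s)
    - h * \sum_(l < k) grid_drift al gm (X ^~ w) (M ^~ w) T n l| <= r.

Definition ito_error (k : nat) (w : Omega) : R :=
  J (k%:R * (T / n.+1%:R)) w - riem_ito X B sg k (T / n.+1%:R) w.

(** Gronwall on a fixed path: [r] is the error of the drift and [ito_error] that of the noise, while
    (1 + h G0)^(n+1) <= e^{T G0} keeps the growth independent of the mesh. *)
Lemma scheme_error :
  `|M T w - scheme h n.+1 w| <= r * (1 + T * (G0 * expR (T * G0)))
    + (`|ito_error n.+1 w| + h * (G0 * expR (T * G0)) * \sum_(l < n.+1) `|ito_error l w|).
Proof.
have h0 : 0 < h by rewrite divr_gt0.
have nh : n.+1%:R * h = T by rewrite mulrC divfK.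
(* [G0] is only an upper bound of absolute values over 'I_d, so its sign needs a state; the value of
   the chain at [w] provides one. *)
have G00 : 0 <= G0 \/ d = 0%N.
  case: (posnP d) => [->|dp]; first by right.
  by left; apply: le_trans (gmG (Ordinal dp)).
have G0p : 0 <= G0.
  case: G00 => // dE; have := ltn_ord (X 0 w); by rewrite [X in (_ < X)%N]dE.
pose u k := `|M (k%:R * h) w - scheme h k w|.
have rec k : (k <= n.+1)%N -> u k <= r + `|ito_error k w| + h * G0 * \sum_(l < k) u l.
  move=> kn; rewrite /u schemeE ME//.
  have := driftE kn; set I := \int[_]_(_ in _) _ => Ir.
  have -> : m0 + I + J (k%:R * h) w - (m0 + h * \sum_(l < k) (al (X (l.+1%:R * h) w) - gm (X (l.+1%:R * h) w) * scheme h l w) + riem_ito X B sg k h w) =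
    (I - h * \sum_(l < k) grid_drift al gm (X ^~ w) (M ^~ w) T n l) + ito_error k w
    - h * \sum_(l < k) (gm (X (l.+1%:R * h) w) * (M (l%:R * h) w - scheme h l w)).
    rewrite /ito_error -/h.
    have -> : \sum_(l < k) grid_drift al gm (X ^~ w) (M ^~ w) T n l =
      \sum_(l < k) (al (X (l.+1%:R * h) w) - gm (X (l.+1%:R * h) w) * scheme h l w) -
      \sum_(l < k) (gm (X (l.+1%:R * h) w) * (M (l%:R * h) w - scheme h l w)).
      by rewrite -sumrB; apply: eq_bigr => l _; rewrite /grid_drift -/h; ring.
    by ring.
  rewrite (le_trans (ler_normB _ _))// lerD//.
    by rewrite (le_trans (ler_normD _ _))// lerD2r.
  rewrite normrM (gtr0_norm h0) -mulrA ler_wpM2l ?(ltW h0)//.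
  rewrite (le_trans (ler_norm_sum _ _ _))// mulr_sumr ler_sum// => l _.
  by rewrite normrM ler_wpM2r.
have hG0 : 0 <= h * G0 by rewrite mulr_ge0// ltW.
have := discrete_gronwall hG0 r0 (fun k => normr_ge0 (ito_error k w)) rec.
rewrite {1}/u nh => /le_trans; apply.
rewrite big_split/= sumr_const card_ord -[r *+ _]mulr_natl.
set S := \sum_(_ < _) _.
have S0 : 0 <= S by apply: sumr_ge0.
have E1 : (1 + h * G0) ^+ n.+1 <= expR (T * G0).
  rewrite -nh -mulrA expRM_natl.
  by apply: lerXn2r; rewrite ?nnegrE ?addr_ge0 ?expR_ge0// expR_ge1Dx.
have E2 : h * G0 * (1 + h * G0) ^+ n.+1 * (n.+1%:R * r + S) <= h * G0 * expR (T * G0) * (n.+1%:R * r + S).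
  by rewrite ler_wpM2r ?addr_ge0 ?mulr_ge0// ler_wpM2l.
have E3 : h * G0 * expR (T * G0) * (n.+1%:R * r + S) =
    r * (T * (G0 * expR (T * G0))) + h * (G0 * expR (T * G0)) * S.
  by rewrite -{2}nh; ring.
by rewrite E3 in E2; lra.
Qed.

End Scheme.

Lemma sqr_sum_le {R : realType} (N : nat) (x : nat -> R) :
  (\sum_(l < N) x l) ^+ 2 <= N%:R * \sum_(l < N) x l ^+ 2.
Proof.
elim: N => [|N IH]; first by rewrite !big_ord0 mul0r expr0n.
rewrite !big_ord_recr/=; move: IH; set S := \sum_(_ < _) x _; set V := \sum_(_ < _) _ => IH.
have V0 : 0 <= V by apply: sumr_ge0 => l _; exact: sqr_ge0.
move: (x N) => y; case: N @S @V IH V0 => [|N] S V IH V0.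
  by rewrite /S /V !big_ord0 !add0r mul1r.
rewrite -[N.+2%:R]natr1; move: S V IH V0 => S V IH V0.
have k0 : 0 < N.+1%:R :> R by rewrite ltr0n.
move: (N.+1%:R : R) k0 IH => k k0 IH.
suff : k * (2 * S * y) <= k * (V + k * y ^+ 2).
  by rewrite ler_pM2l// => H; rewrite sqrrD; nra.
by have := sqr_ge0 (S - k * y); nra.
Qed.

Section SchemeConvergence.
Context {disp : measure_display} {Omega : measurableType disp} {R : realType}.
Variables (P : probability Omega R) (d : nat) (Q : 'M[R]_d) (X : R -> Omega -> 'I_d).
Variables (B M : R -> Omega -> R).
Local Notation L1 := (L1 P).
Local Notation Ex := (Ex P).
Hypothesis hX : is_markov_chain P Q X.
Hypothesis hB : is_brownian P B.
Hypothesis hXB : independent_of P X B.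
Variables (alpha gamma sigma : 'cV[R]_d) (m0 T : R).
Hypothesis T0 : 0 < T.
Hypothesis hM : is_MMOU P alpha gamma sigma m0 X B M.
Let al i : R := alpha i 0.
Let gm i : R := gamma i 0.
Let sg i : R := sigma i 0.
Let G0 : R := mx_l1 gamma.
Let S0 : R := mx_l1 sigma.
Let gmG i : `|gm i| <= G0. Proof. exact: mx_l1_entry. Qed.
Let sgS i : `|sg i| <= S0. Proof. exact: mx_l1_entry. Qed.

(** The error is a deterministic multiple of [rho] on each path plus a random variable Y_n whose
    second moment is O(1/n); the dyadic subsequence makes the latter vanish almost surely. *)
Lemma scheme_ae_cvg :
  {ae P, forall w, scheme al gm sg m0 X B (T / (2 ^+ k)) (2 ^ k)%N w @[k --> \oo] --> M T w}.
Proof.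
have [mM cM] := hM.
(* The definition of M provides an Ito integral for each time separately; a choice assembles them
   into a family, with a dummy value at negative times. *)
move=> H; have [J JP] : exists J : R -> Omega -> R, forall t, 0 <= t ->
    is_ito_integral P (history X B) B (fun s w => sg (X s w)) t (J t) /\
    {ae P, forall w, M t w = m0 + \int[lebesgue_measure]_(s in `[0, t])
      drift al gm (X ^~ w) (M ^~ w) s + J t w}.
  have : forall t, exists Jt : Omega -> R, 0 <= t ->
    is_ito_integral P (history X B) B (fun s w => sg (X s w)) t Jt /\
    {ae P, forall w, M t w = m0 + \int[lebesgue_measure]_(s in `[0, t])
      drift al gm (X ^~ w) (M ^~ w) s + Jt w}.
    move=> t; have [t0|t0] := leP 0 t; last by exists (fun=> 0).
    by have [Jt JtP] := H t t0; exists Jt.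
  by move=> /choice[J JP]; exists J.
have h0 n : 0 < T / n.+1%:R by rewrite divr_gt0.
have nh n : n.+1%:R * (T / n.+1%:R) = T by rewrite mulrC divfK.
pose C1 : R := 4 * (2 * S0) ^+ 2 * (mx_l1 Q * d%:R) * T.
have K0 : 0 <= mx_l1 Q * d%:R by rewrite mulr_ge0// mx_l1_ge0.
have C10 : 0 <= C1.
  by apply: mulr_ge0 (ltW T0); apply: mulr_ge0 K0; apply: mulr_ge0 => //; exact: sqr_ge0.
pose b n := ito_error sg X B T J n.
have mB n l : measurable_fun [set: Omega] (b n l).
  have lh : 0 <= l%:R * (T / n.+1%:R) by rewrite mulr_ge0// ltW.
  apply: measurable_funB; first by have [[+ _] _] := JP _ lh.
  apply: measurable_sum => k; apply: measurable_funM.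
    apply: (past_measurable_fun (chain_measurable hX) hB (s := 0)).
    by apply: past_measurable_X; rewrite mulr_ge0// ltW.
  have h1 := ltW (h0 n); apply: (incr_measurable hB); first by rewrite mulr_ge0.
  by rewrite ler_wpM2r// ler_nat.
have bsq n l : (l <= n.+1)%N -> L1 (fun w => b n l w ^+ 2) /\
    Ex (fun w => b n l w ^+ 2) <= C1 * (T / n.+1%:R).
  move=> ln; have lh : 0 <= l%:R * (T / n.+1%:R) by rewrite mulr_ge0// ltW.
  have [lb eb] := ito_riem_close hX hB hXB sgS (ltW (h0 n)) (JP _ lh).1.
  split => //; apply: le_trans eb _.
  have lT : l%:R * (T / n.+1%:R) <= T by rewrite -[leRHS](nh n) ler_pM2r// ler_nat.
  apply: (@le_trans _ _ (4 * (2 * S0) ^+ 2 * (mx_l1 Q * d%:R * (T / n.+1%:R)) * T)).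
    apply: ler_wpM2l => //; apply: mulr_ge0; last exact: mulr_ge0 K0 (ltW (h0 n)).
    by apply: mulr_ge0 => //; exact: sqr_ge0.
  rewrite /C1 le_eqVlt; apply/orP; left; apply/eqP.
  by move: (T / _) => h'; ring.
pose K1 := G0 * expR (T * G0).
have G00 : 0 <= G0 by exact: mx_l1_ge0.
have K10 : 0 <= K1 by rewrite mulr_ge0// expR_ge0.
pose Y n w := `|b n n.+1 w| + T / n.+1%:R * K1 * \sum_(l < n.+1) `|b n l w|.
have mY n : measurable_fun [set: Omega] (Y n).
  apply: measurable_funD; first exact: measurableT_comp.
  apply: measurable_funM => //; apply: measurable_sum => l; exact: measurableT_comp.
have Y0 n w : 0 <= Y n w.
  by rewrite addr_ge0// mulr_ge0 ?sumr_ge0// mulr_ge0// ltW.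
(* A majorant of Y^2 that is linear in the squared errors, so that their means, each O(1/n), can be
   inserted; the factor n+1 is from the Cauchy-Schwarz inequality for the sum. *)
pose Z n w := 2 * b n n.+1 w ^+ 2 + 2 * ((T / n.+1%:R * K1) ^+ 2 * n.+1%:R) * \sum_(l < n.+1) b n l w ^+ 2.
have YZ n w : Y n w ^+ 2 <= Z n w.
  rewrite /Y /Z; have := sqr_sum_le n.+1 (fun l => `|b n l w|).
  under [X in _ <= _ * X -> _]eq_bigr do rewrite real_normK ?num_real//.
  rewrite -[b n n.+1 w ^+ 2]real_normK ?num_real//.
  set U := \sum_(_ < _) _; set V := \sum_(_ < _) _.
  move: (`|b _ _ _|) (T / n.+1%:R * K1) => y c UV.
  have : c ^+ 2 * U ^+ 2 <= c ^+ 2 * (n.+1%:R * V) by rewrite ler_wpM2l// sqr_ge0.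
  have := sqr_ge0 (y - c * U); nra.
have lb n l : (l < n.+1)%N -> L1 (fun w => b n l w ^+ 2) by move=> ln; have [] := bsq n l (ltnW ln).
have lbn n (l : 'I_n.+1) : L1 (fun w => b n l w ^+ 2) by exact: lb.
have lZ n : L1 (Z n).
  apply: L1D; apply: L1Z; last exact: L1_sum.
  by have [] := bsq n n.+1 (leqnn _).
have eZ n : Ex (Z n) <= (2 * C1 * T * (1 + (T * K1) ^+ 2)) / n.+1%:R.
  have lbb := (bsq n n.+1 (leqnn _)).1; have ebb := (bsq n n.+1 (leqnn _)).2.
  rewrite /Z ExD; [|exact: L1Z|by apply: L1Z; exact: L1_sum].
  rewrite ExZ// ExZ; last exact: L1_sum.
  rewrite Ex_sum//.
  have : \sum_(l < n.+1) Ex (fun w => b n l w ^+ 2) <= n.+1%:R * (C1 * (T / n.+1%:R)).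
    rewrite -[X in X%:R * _]card_ord mulr_natl -sumr_const; apply: ler_sum => l _.
    by have [] := bsq n l (ltnW (ltn_ord l)).
  set V := \sum_(_ < _) _ => VC.
  have c0 : 0 <= (T / n.+1%:R * K1) ^+ 2 * n.+1%:R by rewrite mulr_ge0// sqr_ge0.
  apply: (@le_trans _ _ (2 * (C1 * (T / n.+1%:R)) + 2 * ((T / n.+1%:R * K1) ^+ 2 * n.+1%:R) * (n.+1%:R * (C1 * (T / n.+1%:R))))).
    by rewrite lerD// ler_wpM2l// mulr_ge0.
  rewrite le_eqVlt; apply/orP; left; apply/eqP; field.
  by rewrite nat1r pnatr_eq0.
have lY n : L1 (fun w => Y n w ^+ 2).
  apply: (L1_le _ _ (lZ n)); first exact: measurable_funX.
  by move=> w; rewrite ger0_norm ?sqr_ge0.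
have eY n : Ex (fun w => Y n w ^+ 2) <= (2 * C1 * T * (1 + (T * K1) ^+ 2)) / n.+1%:R.
  exact: le_trans (Ex_le (lY n) (lZ n) (YZ n)) (eZ n).
have aeY := ae_cvg0_subseq mY lY eY.
(* The integral equation holds almost surely at each fixed time; the grid times are countably many,
   so it holds at all of them simultaneously. *)
have aeM : {ae P, forall w, forall n k, (k <= n.+1)%N -> M (k%:R * (T / n.+1%:R)) w = m0
    + \int[lebesgue_measure]_(s in `[0, k%:R * (T / n.+1%:R)]) drift al gm (X ^~ w) (M ^~ w) s
    + J (k%:R * (T / n.+1%:R)) w}.
  apply: ae_foralln => n; apply: ae_foralln => k.
  have kh : 0 <= k%:R * (T / n.+1%:R) by rewrite mulr_ge0// ltW.
  by apply: filterS (JP _ kh).2 => w Mw _.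
have [_ _ _ aeX] := hX.
apply: filterS3 (filterI aeY aeM) cM aeX => w [Yw Mw] cMw [cXw _].
have [rho [rho0 rhoP]] := drift_riemann al gm T0 cMw cXw.
pose n k := (2 ^ k).-1%N.
have nE k : (n k).+1 = (2 ^ k)%N by rewrite prednK// expn_gt0.
have nlim : n k @[k --> \oo] --> \oo.
  apply/cvgnyPge => N; near=> k; have kN : (N <= k)%N by near: k; exists N.
  by rewrite (leq_trans kN)// -ltnS nE ltn_expl.
have rho_ge0 k : 0 <= rho k by apply: le_trans (rhoP k 0%N _).
have lim : rho (n k) * (1 + T * K1) + Y (n k) w @[k --> \oo] --> (0 : R).
  rewrite -[X in _ --> X](addr0 (0 : R)) -[X in _ --> X + _](mul0r (1 + T * K1)).
  apply: cvgD; last exact: Yw.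
  by apply: cvgM; [exact: (cvg_comp _ _ nlim rho0)|exact: cvg_cst].
apply/cvgrPdist_le => /= e e0.
move/cvgr0Pnorm_le : lim => /(_ e e0); apply: filterS => k.
rewrite ger0_norm; last by rewrite addr_ge0// mulr_ge0// addr_ge0// mulr_ge0// ltW.
apply: le_trans.
rewrite -natrX -(nE k).
exact: (scheme_error sg B T0 gmG (rho_ge0 (n k)) (Mw (n k)) (rhoP (n k))).
Unshelve. all: by end_near. Qed.

End SchemeConvergence.

(** * Moments of the scheme *)

Lemma pow4_ge0 {R : realDomainType} (x : R) : 0 <= x ^+ 4.
Proof. by rewrite -[4%N]/(2 * 2)%N exprM sqr_ge0. Qed.

Lemma pow4D {R : realFieldType} (x y : R) : (x + y) ^+ 4 <= 8 * x ^+ 4 + 8 * y ^+ 4.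
Proof.
rewrite -subr_ge0 (_ : _ - _ = 6 * (x ^+ 2 - y ^+ 2) ^+ 2 + (x - y) ^+ 4); last by ring.
by rewrite addr_ge0 ?pow4_ge0// mulr_ge0// sqr_ge0.
Qed.

(** The coefficient of x^4 must be 1 + O(h) for the bound to survive T/h iterations, which rules out
    [pow4D]. Young's inequality on the cross terms gives 7 = 3 + 3 + 1 and 8 = 1 + 3 + 3 + 1, all
    powers of [h] being at most [h]. *)
Lemma pow4_AMGM {R : realFieldType} (x a h : R) : 0 <= h -> h <= 1 ->
  (x + h * a) ^+ 4 <= (1 + 7 * h) * x ^+ 4 + 8 * h * a ^+ 4.
Proof.
move=> h0 h1.
have E1 : 4 * x ^+ 3 * a <= 3 * x ^+ 4 + a ^+ 4.
  rewrite -subr_ge0 (_ : _ - _ = (x ^+ 2 - a ^+ 2) ^+ 2 + 2 * (x * (x - a)) ^+ 2); last by ring.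
  by apply: addr_ge0; [exact: sqr_ge0|apply: mulr_ge0 => //; exact: sqr_ge0].
have E2 : 6 * x ^+ 2 * a ^+ 2 <= 3 * x ^+ 4 + 3 * a ^+ 4.
  rewrite -subr_ge0 (_ : _ - _ = 3 * (x ^+ 2 - a ^+ 2) ^+ 2); last by ring.
  by apply: mulr_ge0 => //; exact: sqr_ge0.
have E3 : 4 * x * a ^+ 3 <= x ^+ 4 + 3 * a ^+ 4.
  rewrite -subr_ge0 (_ : _ - _ = (x ^+ 2 - a ^+ 2) ^+ 2 + 2 * (a * (x - a)) ^+ 2); last by ring.
  by apply: addr_ge0; [exact: sqr_ge0|apply: mulr_ge0 => //; exact: sqr_ge0].
have x4 := pow4_ge0 x; have a4 := pow4_ge0 a.
have h2 : h ^+ 2 <= h by rewrite expr2 ler_piMr.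
have h20 : 0 <= h ^+ 2 by exact: sqr_ge0.
have h3 : h ^+ 3 <= h by rewrite exprS ler_piMr// (le_trans h2).
have h30 : 0 <= h ^+ 3 by exact: exprn_ge0.
have h4 : h ^+ 4 <= h by rewrite exprS ler_piMr// (le_trans h3).
rewrite (_ : (x + h * a) ^+ 4 = x ^+ 4 + h * (4 * x ^+ 3 * a) + h ^+ 2 * (6 * x ^+ 2 * a ^+ 2)
  + h ^+ 3 * (4 * x * a ^+ 3) + h ^+ 4 * a ^+ 4); last by ring.
have F1 := ler_wpM2l h0 E1.
have F2 := ler_wpM2l h20 E2.
have F3 := ler_wpM2l h30 E3.
have F4 := ler_wpM2r a4 h4.
have P2 : 0 <= 3 * x ^+ 4 + 3 * a ^+ 4 by lra.
have P3 : 0 <= x ^+ 4 + 3 * a ^+ 4 by lra.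
have G2 := ler_wpM2r P2 h2.
have G3 := ler_wpM2r P3 h3.
lra.
Qed.

Lemma L1_pow4 {disp : measure_display} {Omega : measurableType disp} {R : realType}
  (P : probability Omega R) (f : Omega -> R) :
  measurable_fun [set: Omega] f -> L1 P (fun w => f w ^+ 4) ->
  [/\ L1 P f, L1 P (fun w => f w ^+ 2) & L1 P (fun w => f w ^+ 3)].
Proof.
move=> mf l4; have l : L1 P (fun w => 1 + f w ^+ 4) by apply: L1D => //; exact: L1_cst.
have A (x : R) : x ^+ 4 = (x ^+ 2) ^+ 2 by rewrite -exprM.
have x2 (x : R) : x ^+ 2 <= 1 + x ^+ 4 by have := sqr_ge0 (x ^+ 2 - 1); rewrite A; nra.
split; apply: (L1_le _ _ l) => //; try exact: measurable_funX.
- move=> w; move: (f w) => x; rewrite ler_norml; have := x2 x; have := sqr_ge0 (x - 1); have := sqr_ge0 (x + 1).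
  by have := pow4_ge0 x; move: (x ^+ 4) => y; nra.
- by move=> w; rewrite ger0_norm ?sqr_ge0//; exact: x2.
- move=> w; move: (f w) => x; rewrite ler_norml; have := x2 x.
  have := sqr_ge0 (x ^+ 2 - x); have := sqr_ge0 (x ^+ 2 + x).
  have -> : (x ^+ 2 - x) ^+ 2 = x ^+ 4 - 2 * x ^+ 3 + x ^+ 2 by ring.
  have -> : (x ^+ 2 + x) ^+ 2 = x ^+ 4 + 2 * x ^+ 3 + x ^+ 2 by ring.
  by have := pow4_ge0 x; lra.
Qed.

Section SchemeMoments.
Context {disp : measure_display} {Omega : measurableType disp} {R : realType}.
Variables (P : probability Omega R) (d : nat) (Q : 'M[R]_d) (X : R -> Omega -> 'I_d).
Variables (B : R -> Omega -> R).
Local Notation L1 := (L1 P).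
Local Notation Ex := (Ex P).
Hypothesis hX : is_markov_chain P Q X.
Hypothesis hB : is_brownian P B.
Hypothesis hXB : independent_of P X B.
Variables (al gm sg : 'I_d -> R) (m0 h : R).
Hypothesis h0 : 0 < h.
Let t (k : nat) : R := k%:R * h.
Let N (k : nat) := scheme al gm sg m0 X B h k.
Let Z (k : nat) (i : 'I_d) := ind X (t k) i.
Let D (k : nat) := incr B (t k) (t k.+1).
Let p := mexp (h *: Q).
Let measX := chain_measurable hX.

Let t0 k : 0 <= t k. Proof. by rewrite mulr_ge0// ltW. Qed.
Let tS k : t k <= t k.+1. Proof. by rewrite ler_pM2r// ler_nat. Qed.
Let tSB k : t k.+1 - t k = h. Proof. by rewrite /t -natr1; ring. Qed.

Let pX (s : R) (f : 'I_d -> R) k : past_measurable X B s (fun w => f (X (t k) w)).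
Proof. exact: past_measurable_X. Qed.

Let mX (f : 'I_d -> R) k : measurable_fun [set: Omega] (fun w => f (X (t k) w)).
Proof. exact: (past_measurable_fun measX hB (@pX 0 f k)). Qed.

Let bX (f : 'I_d -> R) k : forall w, `|f (X (t k) w)| <= \sum_i `|f i|.
Proof. by move=> w; rewrite (bigD1 (X (t k) w))//= lerDl sumr_ge0. Qed.

Let pD k : past_measurable X B (t k.+1) (D k).
Proof. by apply: past_measurable_incr; [exact: t0|exact: tS|exact: lexx]. Qed.

Lemma scheme_past k : past_measurable X B (t k) (N k).
Proof.
elim: k => [|k IH]; first exact: measurable_cst.
apply: measurable_funD; last first.
  by apply: measurable_funM; [exact: pX|exact: pD].
apply: measurable_funD; last by apply: measurable_funM; [exact: measurable_cst|exact: pX].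
apply: measurable_funM; last exact: past_measurable_mono (tS k) IH.
exact: (@pX (t k.+1) (fun i => 1 - h * gm i) k.+1).
Qed.

Let mN k : measurable_fun [set: Omega] (N k).
Proof. exact: (past_measurable_fun measX hB (@scheme_past k)). Qed.

(** Indicator of a cylinder event of the chain at the grid times m, ..., k, as a product so that
    conditioning becomes an identity between expectations. *)
Let cyl (m k : nat) (y : nat -> 'I_d) (w : Omega) : R := \prod_(m <= l < k.+1) Z l (y l) w.

Let Z_past (s : R) k i : past_measurable X B s (Z k i).
Proof. exact: (@pX s (fun j => (j == i)%:R) k). Qed.

Let cyl_past (s : R) m k y : past_measurable X B s (cyl m k y).
Proof. by apply: measurable_prod => l _; exact: Z_past. Qed.

Let cyl_norm m k y w : `|cyl m k y w| <= 1.
Proof.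
rewrite /cyl normr_prod; apply: prodr_ile1 => l _.
by rewrite normr_ge0; exact: ind_norm.
Qed.

Let cylZ_norm m k y j w : `|cyl m k y w * Z k.+1 j w| <= 1.
Proof. by rewrite normrM mulr_ile1//; exact: ind_norm. Qed.

Let mcyl m k y : measurable_fun [set: Omega] (cyl m k y).
Proof. exact: (past_measurable_fun measX hB (@cyl_past 0 m k y)). Qed.

Let mZ k i : measurable_fun [set: Omega] (Z k i).
Proof. exact: (ind_measurable hX). Qed.

Let L1cyl Y m k y : L1 Y -> L1 (fun w => cyl m k y w * Y w).
Proof. by move=> lY; exact: L1_boundedM (mcyl m k y) (cyl_norm m k y) lY. Qed.

Let L1cylZ Y m k y j : L1 Y -> L1 (fun w => cyl m k y w * Z k.+1 j w * Y w).
Proof.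
move=> lY; apply: (L1_boundedM _ (cylZ_norm m k y j) lY).
by apply: measurable_funM; [exact: mcyl|exact: mZ].
Qed.

Let L1Z' Y k j : L1 Y -> L1 (fun w => Z k j w * Y w).
Proof. by move=> lY; apply: (L1_boundedM _ (ind_norm X (t k) j) lY); exact: mZ. Qed.

Let L1X f k Y : L1 Y -> L1 (fun w => f (X (t k) w) * Y w).
Proof. by move=> lY; apply: (L1_boundedM _ (bX f k) lY); exact: mX. Qed.

(* Y sees of the chain after t m only its value at t m: a form of the Markov
   property which, unlike measurability of Y, can be carried along the
   recursion of the scheme. *)
Let MP m (Y : Omega -> R) := forall k y j, (m <= k)%N ->
  Ex (fun w => cyl m k y w * Z k.+1 j w * Y w) = p (y k) j * Ex (fun w => cyl m k y w * Y w).

Let cyl_indic n y w : \prod_(0 <= l < n) Z l (y l) w =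
  \1_(\bigcap_(l in `I_n) X (t l) @^-1` [set y l]) w.
Proof.
rewrite indicE; case: (boolP (w \in _)) => [/set_mem wS|wS].
  rewrite big_nat big1// => l /andP[_ ln]; rewrite /Z /ind.
  by have /= -> := wS l ln; rewrite eqxx.
apply/eqP; rewrite prodf_seq_eq0; apply: contraNT wS => /hasPn H.
rewrite inE => l /= ln; have := H l; rewrite mem_index_iota/= ln => /(_ isT).
by rewrite /Z /ind; case: (X (t l) w =P y l) => // _; rewrite eqxx.
Qed.

Let MP_1 : MP 0 (fun=> 1).
Proof.
move=> k y j _; have [_ _ + _] := hX.
pose y' l := if (l <= k)%N then y l else j.
move=> /(_ k t y' (t0 0)) H.
have tlt l : (l <= k)%N -> t l < t l.+1 by move=> _; rewrite /t ltr_pM2r// ltr_nat.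
have {H} := H tlt; rewrite tSB /y' leqnn ltnn.
have mbig n z : measurable (\bigcap_(l in `I_n) X (t l) @^-1` [set z l]).
  by apply: fin_bigcap_measurable => [|l _]; [exact: finite_II|exact: measX].
have E1 : (fun w => cyl 0 k y w * Z k.+1 j w * 1) =
    \1_(\bigcap_(l in `I_k.+2) X (t l) @^-1` [set y' l]).
  apply/funext => w; rewrite mulr1 -cyl_indic big_nat_recr//= /y' ltnn; congr (_ * _).
  by apply: eq_big_nat => l /andP[_]; rewrite ltnS => ->.
have E2 : (fun w => cyl 0 k y w * 1) =
    \1_(\bigcap_(l in `I_k.+1) X (t l) @^-1` [set y' l]).
  apply/funext => w; rewrite mulr1 -cyl_indic.
  by apply: eq_big_nat => l /andP[_]; rewrite ltnS /y' => ->.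
move=> H; apply: EFin_inj; rewrite EFinM E1 E2 !Ex_indic// [RHS]muleC.
exact: H.
Qed.

Let cylS m k y w : (m <= k)%N -> cyl m k y w = Z m (y m) w * cyl m.+1 k y w.
Proof. by move=> mk; rewrite /cyl big_ltn. Qed.

(** A cylinder starting at m + 1 is the sum, over the states at time m, of cylinders starting at m,
    and the identity is linear. *)
Let MP_S m Y : L1 Y -> MP m Y -> MP m.+1 Y.
Proof.
move=> lY MY k y j mk.
pose y_ i l := if l == m then i else y l.
have cE i w : Z m i w * cyl m.+1 k y w = cyl m k (y_ i) w.
  rewrite [RHS]cylS ?(ltnW mk)// /y_ eqxx; congr (_ * _).
  by apply: eq_big_nat => l /andP[ml _]; rewrite gtn_eqF.
have ykE i : y_ i k = y k by rewrite /y_ gtn_eqF.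
have E1 w : cyl m.+1 k y w * Z k.+1 j w * Y w = \sum_i cyl m k (y_ i) w * Z k.+1 j w * Y w.
  rewrite -[cyl m.+1 k y w]mul1r -(sum_ind X (t m) w) !mulr_suml.
  by apply: eq_bigr => i _; rewrite -cE.
have E2 w : cyl m.+1 k y w * Y w = \sum_i cyl m k (y_ i) w * Y w.
  rewrite -[cyl m.+1 k y w]mul1r -(sum_ind X (t m) w) !mulr_suml.
  by apply: eq_bigr => i _; rewrite -cE.
rewrite (eq_Ex _ E1) (eq_Ex _ E2) !Ex_sum; [|by move=> i; exact: L1cyl|by move=> i; exact: L1cylZ].
rewrite mulr_sumr; apply: eq_bigr => i _.
by rewrite MY ?(ltnW mk)// ykE.
Qed.

Let MP_D m Y Y' : L1 Y -> L1 Y' -> MP m Y -> MP m Y' -> MP m (fun w => Y w + Y' w).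
Proof.
move=> lY lY' MY MY' k y j mk.
under eq_Ex do rewrite mulrDr; under [in RHS]eq_Ex do rewrite mulrDr.
rewrite !ExD; [|exact: L1cyl|exact: L1cyl|exact: L1cylZ|exact: L1cylZ].
by rewrite MY// MY'// mulrDr.
Qed.

(** On a cylinder starting at m the state at that time is prescribed, so the factor is the constant
    [f (y m)]. *)
Let MP_X m f Y : L1 Y -> MP m Y -> MP m (fun w => f (X (t m) w) * Y w).
Proof.
move=> lY MY k y j mk.
have fE w : cyl m k y w * f (X (t m) w) = f (y m) * cyl m k y w.
  rewrite cylS// /Z /ind; case: eqP => [->|_]; last by rewrite !mul0r mulr0.
  by rewrite mulrC.
have E1 w : cyl m k y w * Z k.+1 j w * (f (X (t m) w) * Y w) =
    f (y m) * (cyl m k y w * Z k.+1 j w * Y w).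
  by rewrite !mulrA -fE; ring.
have E2 w : cyl m k y w * (f (X (t m) w) * Y w) = f (y m) * (cyl m k y w * Y w).
  by rewrite !mulrA -fE.
rewrite (eq_Ex _ E1) (eq_Ex _ E2) !ExZ; [|exact: L1cyl|exact: L1cylZ].
by rewrite MY// mulrCA.
Qed.

Let cylM_past m k y Y n : past_measurable X B (t n) Y ->
  past_measurable X B (t n) (fun w => cyl m k y w * Y w).
Proof. by move=> pY; apply: measurable_funM => //; exact: cyl_past. Qed.

Let cylZM_past m k y j Y n : past_measurable X B (t n) Y ->
  past_measurable X B (t n) (fun w => cyl m k y w * Z k.+1 j w * Y w).
Proof.
move=> pY; apply: measurable_funM => //.
by apply: measurable_funM; [exact: cyl_past|exact: Z_past].
Qed.

(** Both sides vanish: the whole trajectory of X, future included, belongs to the past from which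
    the increment is independent. *)
Let MP_incr m n Y : past_measurable X B (t n) Y -> L1 Y -> MP m (fun w => Y w * D n w).
Proof.
move=> pY lY k y j mk.
under eq_Ex do rewrite mulrA; under [in RHS]eq_Ex do rewrite mulrA.
rewrite (Ex_past_incr measX hB hXB (t0 n) (tS n) (cylZM_past m k y j pY) (L1cylZ m k y j lY)).2.
by rewrite (Ex_past_incr measX hB hXB (t0 n) (tS n) (cylM_past m k y pY) (L1cyl m k y lY)).2 mulr0.
Qed.

Let MP_incr2 m n Y : past_measurable X B (t n) Y -> L1 Y -> MP m Y -> MP m (fun w => Y w * D n w ^+ 2).
Proof.
move=> pY lY MY k y j mk.
under eq_Ex do rewrite mulrA; under [in RHS]eq_Ex do rewrite mulrA.
rewrite (Ex_past_incr2 measX hB hXB (t0 n) (tS n) (cylZM_past m k y j pY) (L1cylZ m k y j lY)).2.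
rewrite (Ex_past_incr2 measX hB hXB (t0 n) (tS n) (cylM_past m k y pY) (L1cyl m k y lY)).2.
by rewrite MY// mulrCA.
Qed.

Let g1 (i : 'I_d) : R := 1 - h * gm i.

Let NS k w : N k.+1 w = g1 (X (t k.+1) w) * N k w + h * al (X (t k.+1) w) + sg (X (t k.+1) w) * D k w.
Proof. by []. Qed.

Section FourthMoment.
Variables (A G S : R).
Hypotheses (alA : forall i, `|al i| <= A) (gmG : forall i, `|gm i| <= G) (sgS : forall i, `|sg i| <= S).

Let uu k w := g1 (X (t k.+1) w) * N k w + h * al (X (t k.+1) w).
Let cc k w := sg (X (t k.+1) w).

Let uu_past k : past_measurable X B (t k) (uu k).
Proof.
apply: measurable_funD.
  by apply: measurable_funM; [exact: (@pX (t k) g1 k.+1)|exact: scheme_past].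
by apply: measurable_funM; [exact: measurable_cst|exact: pX].
Qed.

Let cc_past k : past_measurable X B (t k) (cc k). Proof. exact: pX. Qed.

Let muu k : measurable_fun [set: Omega] (uu k).
Proof. exact: (past_measurable_fun measX hB (@uu_past k)). Qed.

Let mcc k : measurable_fun [set: Omega] (cc k).
Proof. exact: (past_measurable_fun measX hB (@cc_past k)). Qed.

Let cc_le k n w : `|cc k w ^+ n| <= S ^+ n.
Proof.
have S0 : 0 <= S by apply: le_trans (sgS (X (t k.+1) w)).
by rewrite normrX; apply: lerXn2r; rewrite ?nnegrE//; exact: sgS.
Qed.

Let step4 k : L1 (fun w => N k w ^+ 4) -> [/\ L1 (fun w => uu k w ^+ 4), L1 (fun w => N k.+1 w ^+ 4) &
  Ex (fun w => N k.+1 w ^+ 4) <= (1 + 4 * h) * Ex (fun w => uu k w ^+ 4) + (4 * h + 384 * h ^+ 2) * S ^+ 4].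
Proof.
move=> lN4.
have lu4 : L1 (fun w => uu k w ^+ 4).
  apply: (@L1_le _ _ _ _ _ (fun w => 8 * ((g1 (X (t k.+1) w)) ^+ 4 * N k w ^+ 4) + 8 * (h * al (X (t k.+1) w)) ^+ 4)).
  - by apply: measurable_funX; exact: muu.
  - move=> w; rewrite ger0_norm ?pow4_ge0// /uu -exprMn; exact: pow4D.
  - apply: L1D; apply: L1Z; first exact: (@L1X (fun i => g1 i ^+ 4)).
    exact: (L1_bounded P (@mX (fun i => (h * al i) ^+ 4) k.+1) (@bX (fun i => (h * al i) ^+ 4) k.+1)).
have [lu1 lu2 lu3] := L1_pow4 (@muu k) lu4.
have pu3c : past_measurable X B (t k) (fun w => uu k w ^+ 3 * cc k w).
  by apply: measurable_funM; [apply: measurable_funX; exact: uu_past|exact: cc_past].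
have lcm n (f : Omega -> R) : L1 f -> L1 (fun w => f w * cc k w ^+ n).
  move=> lf; under eq_fun do rewrite mulrC.
  by apply: (L1_boundedM _ (@cc_le k n) lf); apply: measurable_funX; exact: mcc.
have lu3c : L1 (fun w => uu k w ^+ 3 * cc k w).
  by have := lcm 1%N _ lu3; under eq_fun do rewrite expr1.
have pu2c : past_measurable X B (t k) (fun w => uu k w ^+ 2 * cc k w ^+ 2).
  by apply: measurable_funM; apply: measurable_funX; [exact: uu_past|exact: cc_past].
have lu2c : L1 (fun w => uu k w ^+ 2 * cc k w ^+ 2) by exact: lcm.
have pc4 : past_measurable X B (t k) (fun w => cc k w ^+ 4) by apply: measurable_funX; exact: cc_past.
have lc4 : L1 (fun w => cc k w ^+ 4).
  by apply: L1_bounded (@cc_le k 4); apply: measurable_funX; exact: mcc.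
have [l1 e1] := Ex_past_incr measX hB hXB (t0 k) (tS k) pu3c lu3c.
have [l2 e2] := Ex_past_incr2 measX hB hXB (t0 k) (tS k) pu2c lu2c.
have [|l3 e3] := Ex_past_incr4 measX hB hXB (t0 k) (tS k) pc4 lc4; first by move=> w; exact: pow4_ge0.
(* V exceeds (u + cD)^4 by 2 (cD (u - cD))^2. This absorbs the term in D^3, whose mean would call
   for a third moment, and raises the coefficients 6 and 1 to 8 and 3. *)
pose V w := uu k w ^+ 4 + (4 * (uu k w ^+ 3 * cc k w * D k w) +
  (8 * (uu k w ^+ 2 * cc k w ^+ 2 * D k w ^+ 2) + 3 * (cc k w ^+ 4 * D k w ^+ 4))).
have NV w : N k.+1 w ^+ 4 <= V w.
  rewrite NS -/(uu k w) -/(cc k w) /V -subr_ge0.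
  move: (uu k w) (cc k w) (D k w) => u c x.
  rewrite (_ : _ - _ = 2 * (c * x * (u - c * x)) ^+ 2); last by ring.
  by rewrite mulr_ge0// sqr_ge0.
have lV1 : L1 (fun w => 8 * (uu k w ^+ 2 * cc k w ^+ 2 * D k w ^+ 2) + 3 * (cc k w ^+ 4 * D k w ^+ 4)).
  by apply: L1D; apply: L1Z.
have lV2 : L1 (fun w => 4 * (uu k w ^+ 3 * cc k w * D k w) +
  (8 * (uu k w ^+ 2 * cc k w ^+ 2 * D k w ^+ 2) + 3 * (cc k w ^+ 4 * D k w ^+ 4))).
  by apply: L1D => //; exact: L1Z.
have lV : L1 V by exact: L1D.
have lN : L1 (fun w => N k.+1 w ^+ 4).
  apply: L1_le _ _ lV; first by apply: measurable_funX; exact: mN.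
  by move=> w; rewrite ger0_norm ?pow4_ge0.
split => //; apply: le_trans (Ex_le lN lV NV) _.
rewrite /V ExD// ExD//; last exact: L1Z.
rewrite ExD; [|exact: L1Z|exact: L1Z].
rewrite !ExZ// e1 e2 tSB in e3 *.
have e4 : Ex (fun w => uu k w ^+ 2 * cc k w ^+ 2) <= 2^-1 * Ex (fun w => uu k w ^+ 4) + 2^-1 * S ^+ 4.
  rewrite -ExZ// -[2^-1 * S ^+ 4](Ex_cst P) -ExD; [|exact: L1Z|exact: L1_cst].
  apply: Ex_le => //; first by apply: L1D; [exact: L1Z|exact: L1_cst].
  move=> w; have := @cc_le k 4 w; rewrite ger0_norm ?pow4_ge0//.
  move: (uu k w) (cc k w) => u c; have := sqr_ge0 (u ^+ 2 - c ^+ 2).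
  rewrite (_ : (u ^+ 2 - c ^+ 2) ^+ 2 = u ^+ 4 + c ^+ 4 - 2 * (u ^+ 2 * c ^+ 2)); last by ring.
  lra.
have e5 : Ex (fun w => cc k w ^+ 4) <= S ^+ 4.
  rewrite -[leRHS](Ex_cst P); apply: Ex_le => //; first exact: L1_cst.
  by move=> w; have := @cc_le k 4 w; rewrite ger0_norm ?pow4_ge0.
have e6 : 128 * h ^+ 2 * Ex (fun w => cc k w ^+ 4) <= 128 * h ^+ 2 * S ^+ 4.
  by rewrite ler_wpM2l// mulr_ge0// sqr_ge0.
have e7 := ler_wpM2l (ltW h0) e4.
move: e3 e6 e7; move: (Ex _) (Ex _) (Ex _) (Ex _) (S ^+ 4) => a1 a2 a3 a4 s4.
lra.
Qed.

Lemma scheme_L4 k : L1 (fun w => N k w ^+ 4).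
Proof. by elim: k => [|k /step4[]//]; exact: (L1_cst P (m0 ^+ 4)). Qed.

(** One step multiplies the fourth moment by at most (1 + 4h)(1 + 7h)(1 + hG)^4 <= e^{(11 + 4G)h}.
    For h <= 1 the additive terms satisfy 8h(1 + 4h) <= 40h and 4h + 384h^2 <= 388h, where 384 = 3 *
    128. *)
Lemma scheme_pow4_le k : h <= 1 ->
  Ex (fun w => N k w ^+ 4) <= expR ((11 + 4 * G) * t k) * (m0 ^+ 4 + t k * (40 * A ^+ 4 + 388 * S ^+ 4)).
Proof.
move=> h1; have hh := ltW h0.
elim: k => [|k IH].
  have -> : Ex (fun w => N 0 w ^+ 4) = m0 ^+ 4 by exact: (Ex_cst P (m0 ^+ 4)).
  by rewrite /t mul0r mulr0 expR0 mul1r mul0r addr0.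
have [lu4 lN e1] := step4 (scheme_L4 k).
(* Any state will do: it shows that the bounds [A], [G] and [S] are nonnegative. *)
have i := X (t 0) point.
have A0 : 0 <= A by apply: le_trans (alA i).
have G0 : 0 <= G by apply: le_trans (gmG i).
have S0 : 0 <= S by apply: le_trans (sgS i).
have e2 : Ex (fun w => uu k w ^+ 4) <= (1 + 7 * h) * ((1 + h * G) ^+ 4 * Ex (fun w => N k w ^+ 4)) + 8 * h * A ^+ 4.
  have lN4 := scheme_L4 k; have lZ4 := L1Z ((1 + h * G) ^+ 4) lN4.
  have lZZ4 := L1Z (1 + 7 * h) lZ4; have lA := L1_cst P (8 * h * A ^+ 4).
  have <- : Ex (fun w => (1 + 7 * h) * ((1 + h * G) ^+ 4 * N k w ^+ 4) + 8 * h * A ^+ 4) =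
      (1 + 7 * h) * ((1 + h * G) ^+ 4 * Ex (fun w => N k w ^+ 4)) + 8 * h * A ^+ 4.
    by rewrite (ExD lZZ4 lA) (ExZ _ lZ4) (ExZ _ lN4) Ex_cst.
  apply: Ex_le => //; first exact: L1D.
  move=> w; rewrite /uu.
  have ga : `|g1 (X (t k.+1) w)| <= 1 + h * G.
    rewrite (le_trans (ler_normB _ _))// normr1 lerD2l normrM ger0_norm// ler_wpM2l//.
  have gn : (g1 (X (t k.+1) w) * N k w) ^+ 4 <= (1 + h * G) ^+ 4 * N k w ^+ 4.
    rewrite exprMn ler_wpM2r ?pow4_ge0//.
    rewrite -(ger0_norm (pow4_ge0 (g1 _))) normrX lerXn2r// nnegrE addr_ge0// mulr_ge0//.
  have an : (al (X (t k.+1) w)) ^+ 4 <= A ^+ 4.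
    by rewrite -(ger0_norm (pow4_ge0 (al _))) normrX lerXn2r// nnegrE.
  have := pow4_AMGM (g1 (X (t k.+1) w) * N k w) (al (X (t k.+1) w)) hh h1.
  have := ler_wpM2l hh an; have : 0 <= 1 + 7 * h by lra.
  move=> h7 /(ler_wpM2l (ler0n R 8)); have := ler_wpM2l h7 gn; lra.
have q1 : (1 + 4 * h) * ((1 + 7 * h) * (1 + h * G) ^+ 4) <= expR ((11 + 4 * G) * h).
  have -> : (11 + 4 * G) * h = 4 * h + (7 * h + 4 * (h * G)) by ring.
  rewrite !expRD (expRM_natl 4 (h * G)).
  have hG0 : 0 <= h * G by rewrite mulr_ge0.
  apply: ler_pM => //; rewrite ?mulr_ge0 ?exprn_ge0 ?addr_ge0 ?mulr_ge0 ?expR_ge1Dx//.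
  apply: ler_pM => //; rewrite ?exprn_ge0 ?addr_ge0 ?mulr_ge0 ?expR_ge1Dx//.
  by apply: lerXn2r; rewrite ?nnegrE ?addr_ge0 ?expR_ge0// expR_ge1Dx.
pose q := expR ((11 + 4 * G) * h); pose C := 40 * A ^+ 4 + 388 * S ^+ 4.
have A4 := pow4_ge0 A; have S4 := pow4_ge0 S.
have C0 : 0 <= C by rewrite /C; lra.
have y0 : 0 <= Ex (fun w => N k w ^+ 4) by apply: Ex_ge0 => w; exact: pow4_ge0.
have e3 : Ex (fun w => N k.+1 w ^+ 4) <= q * Ex (fun w => N k w ^+ 4) + h * C.
  apply: (le_trans e1).
  have h4 : 0 <= 1 + 4 * h by lra.
  have := ler_wpM2l h4 e2; have := ler_wpM2r y0 q1; rewrite -/q /C.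
  have : h ^+ 2 * S ^+ 4 <= h * S ^+ 4 by rewrite ler_wpM2r// expr2 ler_piMr.
  have : h * h * A ^+ 4 <= h * A ^+ 4 by rewrite ler_wpM2r// ler_piMr.
  move: (Ex _) (Ex _) (A ^+ 4) (S ^+ 4) ((1 + h * G) ^+ 4) => y u a s g; lra.
apply: (le_trans e3).
have qt : expR ((11 + 4 * G) * t k.+1) = q * expR ((11 + 4 * G) * t k).
  by rewrite /q -expRD /t -natr1; congr expR; ring.
have tk : t k.+1 = t k + h by rewrite /t -natr1; ring.
have q1' : 1 <= expR ((11 + 4 * G) * t k.+1).
  by rewrite -expR0 ler_expR mulr_ge0// addr_ge0// mulr_ge0.
have e4 := ler_wpM2l (expR_ge0 ((11 + 4 * G) * h)) IH.
have e5 : h * C <= expR ((11 + 4 * G) * t k.+1) * (h * C) by rewrite -[leLHS]mul1r ler_wpM2r// mulr_ge0.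
rewrite -/q -/C in e4; rewrite -/C.
rewrite (_ : expR _ * _ = q * (expR ((11 + 4 * G) * t k) * (m0 ^+ 4 + t k * C)) +
  expR ((11 + 4 * G) * t k.+1) * (h * C)); last by rewrite tk in qt *; rewrite qt; ring.
lra.
Qed.

End FourthMoment.

Let lN k : L1 (N k) /\ L1 (fun w => N k w ^+ 2).
Proof.
have sgS i : `|sg i| <= \sum_j `|sg j| by rewrite (bigD1 i)//= lerDl sumr_ge0.
by have [] := L1_pow4 (@mN k) (scheme_L4 sgS k).
Qed.

Let lN1 k : L1 (N k). Proof. exact: (lN k).1. Qed.
Let lN2 k : L1 (fun w => N k w ^+ 2). Proof. exact: (lN k).2. Qed.
Let l1 : L1 (fun=> 1). Proof. exact: L1_cst. Qed.

Let MP_ext m Y Y' : (forall w, Y' w = Y w) -> MP m Y -> MP m Y'.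
Proof. by move=> YY'; rewrite (_ : Y' = Y)//; apply/funext. Qed.

Let MP1 m : MP m (fun=> 1).
Proof. by elim: m => [|m IH]; [exact: MP_1|exact: MP_S]. Qed.

Let lD k Y : past_measurable X B (t k) Y -> L1 Y -> L1 (fun w => Y w * D k w).
Proof. by move=> pY lY; have [] := Ex_past_incr measX hB hXB (t0 k) (tS k) pY lY. Qed.

Let lD2 k Y : past_measurable X B (t k) Y -> L1 Y -> L1 (fun w => Y w * D k w ^+ 2).
Proof. by move=> pY lY; have [] := Ex_past_incr2 measX hB hXB (t0 k) (tS k) pY lY. Qed.

Let p1 k : past_measurable X B (t k) (fun=> 1). Proof. exact: measurable_cst. Qed.

Let f0 i : R := h * al i.
Let f1 i : R := g1 i ^+ 2.
Let f2 i : R := 2 * g1 i * (h * al i).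
Let f3 i : R := (h * al i) ^+ 2.
Let f4 i : R := 2 * g1 i * sg i.
Let f5 i : R := 2 * (h * al i) * sg i.
Let f6 i : R := sg i ^+ 2.

(** Every term is a function of the new state times a factor known without it; the idle factors 1
    maintain this shape, so that [MP_X] and [ExZX] apply uniformly. *)
Let N1E k w : N k.+1 w = g1 (X (t k.+1) w) * N k w +
  (f0 (X (t k.+1) w) * 1 + sg (X (t k.+1) w) * (1 * D k w)).
Proof. by rewrite NS /f0; ring. Qed.

Let N2E k w : N k.+1 w ^+ 2 = f1 (X (t k.+1) w) * N k w ^+ 2 +
  (f2 (X (t k.+1) w) * N k w +
  (f3 (X (t k.+1) w) * 1 +
  (f4 (X (t k.+1) w) * (N k w * D k w) +
  (f5 (X (t k.+1) w) * (1 * D k w) +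
  f6 (X (t k.+1) w) * (1 * D k w ^+ 2))))).
Proof. by rewrite NS /f1 /f2 /f3 /f4 /f5 /f6; ring. Qed.

(** The property of N_k is first carried from time k to k+1; each term of the recursion then
    preserves it, being a function of the state at k+1 times N_k, its square or Brownian
    increments. *)
Let MPN k : MP k (N k) /\ MP k (fun w => N k w ^+ 2).
Proof.
elim: k => [|k [IH1 IH2]].
  have H c : MP 0 (fun=> c).
    have -> : (fun=> c) = (fun w : Omega => c * 1) by apply/funext => w; rewrite mulr1.
    exact: (@MP_X 0 (fun=> c) _ l1 (@MP1 0)).
  by split; [exact: (H m0)|exact: (H (m0 ^+ 2))].
have M1 := MP_S (lN1 k) IH1; have M2 := MP_S (lN2 k) IH2.
have MD := @MP_incr k.+1 k _ (@p1 k) l1; have MD2 := @MP_incr2 k.+1 k _ (@p1 k) l1 (@MP1 k.+1).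
have MND := @MP_incr k.+1 k _ (@scheme_past k) (lN1 k).
have lD1 := lD (@p1 k) l1; have lD21 := lD2 (@p1 k) l1; have lND := lD (@scheme_past k) (lN1 k).
split.
  apply: MP_ext (@N1E k) _.
  by apply: MP_D; [exact: L1X|by apply: L1D; exact: L1X|exact: MP_X|by apply: MP_D; [exact: L1X|exact: L1X|exact: MP_X|exact: MP_X]].
apply: MP_ext (@N2E k) _.
do 5 (apply: MP_D; [exact: L1X|do ?[exact: L1X|apply: L1D]|exact: MP_X|]).
exact: MP_X.
Qed.

(** The property [MP] for cylinders of length one, summed over the state at time k: this is the
    transition matrix acting on the vector of moments. *)
Let trans k Y j : L1 Y -> MP k Y ->
  Ex (fun w => Z k.+1 j w * Y w) = \sum_i p i j * Ex (fun w => Z k i w * Y w).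
Proof.
move=> lY MY.
have cE i w : cyl k k (fun=> i) w = Z k i w by rewrite /cyl big_nat1.
rewrite (eq_Ex _ (g := fun w => \sum_i cyl k k (fun=> i) w * Z k.+1 j w * Y w)); last first.
  move=> w; under eq_bigr do rewrite cE.
  by rewrite -!mulr_suml (sum_ind X (t k) w) mul1r.
rewrite Ex_sum; last by move=> i; exact: L1cylZ.
apply: eq_bigr => i _; rewrite MY//; congr (_ * _).
by apply: eq_Ex => w; rewrite cE.
Qed.

Let ExZX k j f Y : L1 Y -> Ex (fun w => Z k j w * (f (X (t k) w) * Y w)) = f j * Ex (fun w => Z k j w * Y w).
Proof.
move=> lY; rewrite -ExZ; last exact: L1Z'.
apply: eq_Ex => w; rewrite /Z /ind; case: eqP => [->|_]; first by rewrite !mul1r.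
by rewrite !mul0r mulr0.
Qed.

Let ExZD k j Y : past_measurable X B (t k) Y -> L1 Y -> Ex (fun w => Z k.+1 j w * (Y w * D k w)) = 0.
Proof.
move=> pY lY; under eq_Ex do rewrite mulrA.
have pZY : past_measurable X B (t k) (fun w => Z k.+1 j w * Y w) by apply: measurable_funM => //; exact: Z_past.
by have [] := Ex_past_incr measX hB hXB (t0 k) (tS k) pZY (L1Z' k.+1 j lY).
Qed.

Let ExZD2 k j : Ex (fun w => Z k.+1 j w * (1 * D k w ^+ 2)) = h * Ex (fun w => Z k.+1 j w * 1).
Proof.
under eq_Ex do rewrite mulrA.
have pZ : past_measurable X B (t k) (fun w => Z k.+1 j w * 1) by apply: measurable_funM => //; exact: Z_past.
by have [_ ->] := Ex_past_incr2 measX hB hXB (t0 k) (tS k) pZ (L1Z' k.+1 j l1); rewrite tSB.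
Qed.

Lemma scheme_moment1_rec k j : Ex (fun w => ind X (t k.+1) j w * N k.+1 w) =
  g1 j * (\sum_i p i j * Ex (fun w => ind X (t k) i w * N k w))
  + h * al j * Ex (ind X (t k.+1) j).
Proof.
have lD1 := lD (@p1 k) l1.
have E w : ind X (t k.+1) j w * N k.+1 w = Z k.+1 j w * (g1 (X (t k.+1) w) * N k w) +
  (Z k.+1 j w * (f0 (X (t k.+1) w) * 1) + Z k.+1 j w * (sg (X (t k.+1) w) * (1 * D k w))).
  by rewrite N1E /Z; ring.
rewrite (eq_Ex _ E).
rewrite ExD; [|exact/L1Z'/L1X|by apply: L1D; exact/L1Z'/L1X].
rewrite ExD; [|exact/L1Z'/L1X|exact/L1Z'/L1X].
rewrite !ExZX// ExZD// mulr0 addr0 (trans j (lN1 k) (MPN k).1).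
by congr (_ + _ * _); apply: eq_Ex => w; rewrite mulr1.
Qed.

Lemma scheme_moment2_rec k j : Ex (fun w => ind X (t k.+1) j w * N k.+1 w ^+ 2) =
  g1 j ^+ 2 * (\sum_i p i j * Ex (fun w => ind X (t k) i w * N k w ^+ 2))
  + 2 * g1 j * (h * al j) * (\sum_i p i j * Ex (fun w => ind X (t k) i w * N k w))
  + ((h * al j) ^+ 2 + h * sg j ^+ 2) * Ex (ind X (t k.+1) j).
Proof.
have lD1 := lD (@p1 k) l1; have lD21 := lD2 (@p1 k) l1; have lND := lD (@scheme_past k) (lN1 k).
have E w : ind X (t k.+1) j w * N k.+1 w ^+ 2 =
  Z k.+1 j w * (f1 (X (t k.+1) w) * N k w ^+ 2) +
  (Z k.+1 j w * (f2 (X (t k.+1) w) * N k w) +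
  (Z k.+1 j w * (f3 (X (t k.+1) w) * 1) +
  (Z k.+1 j w * (f4 (X (t k.+1) w) * (N k w * D k w)) +
  (Z k.+1 j w * (f5 (X (t k.+1) w) * (1 * D k w)) +
  Z k.+1 j w * (f6 (X (t k.+1) w) * (1 * D k w ^+ 2)))))).
  by rewrite N2E /Z; ring.
rewrite (eq_Ex _ E).
do 5 (rewrite ExD; [|exact/L1Z'/L1X|do ?[exact/L1Z'/L1X|apply: L1D]]).
rewrite !ExZX// !ExZD// ?ExZD2 ?mulr0 ?add0r; last exact: scheme_past.
rewrite (trans j (lN1 k) (MPN k).1) (trans j (lN2 k) (MPN k).2).
have -> : Ex (fun w => Z k.+1 j w * 1) = Ex (ind X (t k.+1) j) by apply: eq_Ex => w; rewrite mulr1.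
rewrite /f1 /f2 /f3 /f6 /Z; ring.
Qed.

End SchemeMoments.

(** * The moments of the process *)

Lemma vexpectE {disp : measure_display} {Omega : measurableType disp} {R : realType}
  (P : probability Omega R) d (Y : Omega -> 'cV[R]_d) i :
  vexpect P Y i 0 = Ex P (fun w => Y w i 0).
Proof. by rewrite mxE unlock. Qed.

Section MomentLimits.
Context {disp : measure_display} {Omega : measurableType disp} {R : realType}.
Variables (P : probability Omega R) (d : nat) (Q : 'M[R]_d) (X : R -> Omega -> 'I_d).
Variables (B M : R -> Omega -> R).
Local Notation L1 := (L1 P).
Local Notation Ex := (Ex P).
Hypothesis hX : is_markov_chain P Q X.
Hypothesis hB : is_brownian P B.
Hypothesis hXB : independent_of P X B.
Variables (alpha gamma sigma : 'cV[R]_d) (m0 : R).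
Hypothesis hM : is_MMOU P alpha gamma sigma m0 X B M.

Definition law0 : 'cV[R]_d := \col_i Ex (ind X 0 i).

Let mexpQ (t : R) i j : mexp (t *: Q^T) j i = mexp (t *: Q) i j.
Proof. by rewrite -linearZ/= mexp_tr mxE. Qed.

Lemma Ex_ind_mexp (t : R) j : 0 <= t -> Ex (ind X t j) = (mexp (t *: Q^T) *m law0) j 0.
Proof.
move=> t0; rewrite mxE.
rewrite (eq_Ex _ (g := fun w => \sum_i ind X 0 i w * ind X t j w)); last first.
  by move=> w; rewrite -mulr_suml sum_ind mul1r.
rewrite Ex_sum; last first.
  move=> i; apply: (L1_boundedM (@ind_measurable _ _ _ _ _ _ _ hX _ i (lexx 0)) (ind_norm X 0 i)); exact: (ind_L1 hX j t0).
apply: eq_bigr => i _; rewrite (mexpQ t i j) [law0 i 0]mxE [RHS]mulrC.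
by rewrite (Ex_ind_transition hX i j (lexx 0) t0) (subr0 t).
Qed.

Let N (h : R) k := scheme (alpha^~ 0) (gamma^~ 0) (sigma^~ 0) m0 X B h k.

Let GE h (u : 'cV[R]_d) i : ((1%:M + h *: - diagc gamma) *m u) i 0 = (1 - h * gamma i 0) * u i 0.
Proof.
rewrite mulmxDl mul1mx scalerN mulNmx -scalemxAl mxE [X in _ + X]mxE [X in - X]mxE diagc_mulE; ring.
Qed.

Let step2E h (u x p : 'cV[R]_d) i :
  ((1%:M + h *: - diagc gamma) *m ((1%:M + h *: - diagc gamma) *m u)
     + h *: (2 *: (diagc alpha *m ((1%:M + h *: - diagc gamma) *m x)))
     + h *: ((h *: (diagc alpha *m diagc alpha) + diagc (sqvec sigma)) *m p)) i 0 =
  (1 - h * gamma i 0) * ((1 - h * gamma i 0) * u i 0)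
     + h * (2 * (alpha i 0 * ((1 - h * gamma i 0) * x i 0)))
     + h * (h * (alpha i 0 * (alpha i 0 * p i 0)) + sigma i 0 ^+ 2 * p i 0).
Proof.
rewrite [LHS]mxE [X in X + _]mxE !GE [X in _ + X + _]mxE [X in _ + h * X + _]mxE diagc_mulE GE.
congr (_ + _); rewrite [LHS]mxE mulmxDl -scalemxAl -mulmxA; congr (_ * _).
by rewrite [LHS]mxE [X in X + _ = _]mxE !diagc_mulE [sqvec _ _ _]mxE.
Qed.

Let EE h (f : nat -> Omega -> R) k j : (mexp (h *: Q^T) *m (\col_i Ex (fun w => ind X (k%:R * h) i w * f k w))) j 0
  = \sum_i mexp (h *: Q) i j * Ex (fun w => ind X (k%:R * h) i w * f k w).
Proof. by rewrite mxE; apply: eq_bigr => i _; rewrite mexpQ mxE. Qed.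

(** The long hypothesis is the last clause of [moment_systemP] for the initial vectors of the
    scheme; the work is to match the exact recursions of the scheme with the matrix form. *)
Let scheme_system (T : R) : 0 < T -> forall nut wt : R -> 'cV[R]_d,
  (forall T, 0 <= T -> forall nun wn : nat -> nat -> 'cV[R]_d,
     (forall n, nun n 0%N = m0 *: law0) -> (forall n, wn n 0%N = m0 ^+ 2 *: law0) ->
     (forall n k, let h := T / n.+1%:R in let p := mexp ((k.+1%:R * h) *: Q^T) *m law0 in
       nun n k.+1 = (1%:M + h *: - diagc gamma) *m (mexp (h *: Q^T) *m nun n k) + h *: (diagc alpha *m p)) ->
     (forall n k, let h := T / n.+1%:R in let p := mexp ((k.+1%:R * h) *: Q^T) *m law0 in
       wn n k.+1 = (1%:M + h *: - diagc gamma) *m ((1%:M + h *: - diagc gamma) *m (mexp (h *: Q^T) *m wn n k))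
         + h *: (2 *: (diagc alpha *m ((1%:M + h *: - diagc gamma) *m (mexp (h *: Q^T) *m nun n k))))
         + h *: ((h *: (diagc alpha *m diagc alpha) + diagc (sqvec sigma)) *m p)) ->
     (nun n n.+1 @[n --> \oo] --> nut T) /\ (wn n n.+1 @[n --> \oo] --> wt T)) ->
  forall j,
   (Ex (fun w => ind X T j w * N (T / n.+1%:R) n.+1 w) @[n --> \oo] --> nut T j 0) /\
   (Ex (fun w => ind X T j w * N (T / n.+1%:R) n.+1 w ^+ 2) @[n --> \oo] --> wt T j 0).
Proof.
move=> T0 nut wt H j.
pose nun n k : 'cV[R]_d := \col_j Ex (fun w => ind X (k%:R * (T / n.+1%:R)) j w * N (T / n.+1%:R) k w).
pose wn n k : 'cV[R]_d := \col_j Ex (fun w => ind X (k%:R * (T / n.+1%:R)) j w * N (T / n.+1%:R) k w ^+ 2).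
have h0 n : 0 < T / n.+1%:R by rewrite divr_gt0.
have tp n k : 0 <= k%:R * (T / n.+1%:R) by rewrite mulr_ge0// ltW.
have li (t : R) i : 0 <= t -> L1 (ind X t i) by move=> t0; exact: (ind_L1 hX i t0).
have init (c : R) i (h : R) : Ex (fun w => ind X (0 * h) i w * c) = c * law0 i 0.
  rewrite mxE mul0r; under eq_Ex do rewrite mulrC.
  by rewrite ExZ//; exact: li.
have [] := H T (ltW T0) nun wn.
- by move=> n; apply/matrixP => i k; rewrite (ord1 k) [LHS]mxE [RHS]mxE; exact: (init m0).
- by move=> n; apply/matrixP => i k; rewrite (ord1 k) [LHS]mxE [RHS]mxE; exact: (init (m0 ^+ 2)).
- move=> n k h p; apply/matrixP => i l; rewrite (ord1 l) mxE.
  rewrite (scheme_moment1_rec hX hB hXB _ _ _ _ (h0 n)) mxE GE.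
  rewrite (EE _ (fun k => N h k)) Ex_ind_mexp// [X in _ = _ + X]mxE diagc_mulE; congr (_ + _); exact: esym (mulrA _ _ _).
- move=> n k h p; apply/matrixP => i l; rewrite (ord1 l) step2E [LHS]mxE.
  rewrite (EE _ (fun k w => N h k w ^+ 2)) (EE _ (fun k => N h k)).
  rewrite (scheme_moment2_rec hX hB hXB _ _ _ _ (h0 n)) Ex_ind_mexp// -/h -/p /N.
  by move: (\sum_i0 _) (\sum_i0 _) (p i 0) => s1 s2 s3; ring.
move=> /cvg_mxP/(_ j 0) c1 /cvg_mxP/(_ j 0) c2.
have TE n : n.+1%:R * (T / n.+1%:R) = T by rewrite mulrC divfK// pnatr_eq0.
split.
  by move: c1; rewrite /nun; under eq_fun do rewrite mxE TE.
by move: c2; rewrite /wn; under eq_fun do rewrite mxE TE.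
Qed.

(** The moments of the scheme have two limits: the solution of the linear system, by the recursion,
    and the moments of M(T), by almost sure convergence and bounded fourth moments. Uniqueness of
    limits identifies them. *)
Lemma MMOU_moments : exists nut wt : R -> 'cV[R]_d,
  [/\ nut 0 = m0 *: law0, wt 0 = m0 ^+ 2 *: law0,
   forall t, mx_derive nut t (Qbar Q gamma *m nut t + diagc alpha *m (mexp (t *: Q^T) *m law0)),
   forall t, mx_derive wt t (Qbar Q (2 *: gamma) *m wt t
     + (2 *: (diagc alpha *m nut t) + diagc (sqvec sigma) *m (mexp (t *: Q^T) *m law0))) &
   forall T : R, 0 < T -> L1 (fun w => M T w ^+ 4) /\ forall j,
     Ex (fun w => ind X T j w * M T w) = nut T j 0 /\
     Ex (fun w => ind X T j w * M T w ^+ 2) = wt T j 0].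
Proof.
have [nut [wt [nut0 wt0 dnu dw lim]]] := moment_systemP Q alpha gamma sigma law0 (m0 *: law0) (m0 ^+ 2 *: law0).
exists nut, wt; split => // T T0.
pose K := (Num.truncn T).+1.
have TK k : T / 2 ^+ (k + K) <= 1.
  rewrite ler_pdivrMr ?exprn_gt0// mul1r -natrX; apply: (@le_trans _ _ K%:R).
    by have /andP[_ /ltW] := truncn_itv (ltW T0).
  by rewrite ler_nat (leq_trans (ltnW (ltn_expl K (ltnSn 1))))// leq_exp2l// leq_addl.
pose Y k := N (T / 2 ^+ (k + K)) (2 ^ (k + K)).
have h0 k : 0 < T / 2 ^+ (k + K) by rewrite divr_gt0// exprn_gt0.
have mY k : measurable_fun [set: Omega] (Y k).
  have p := @scheme_past _ _ _ _ X B (alpha^~ 0) (gamma^~ 0) (sigma^~ 0) m0 _ (h0 k) (2 ^ (k + K)).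
  exact: (past_measurable_fun (chain_measurable hX) hB p).
have alA i : `|alpha i 0| <= mx_l1 alpha by exact: mx_l1_entry.
have gmG i : `|gamma i 0| <= mx_l1 gamma by exact: mx_l1_entry.
have sgS i : `|sigma i 0| <= mx_l1 sigma by exact: mx_l1_entry.
have l4 k : L1 (fun w => Y k w ^+ 4).
  exact: (scheme_L4 hX hB hXB (alpha^~ 0) (gamma^~ 0) m0 (h0 k) sgS).
pose C := expR ((11 + 4 * mx_l1 gamma) * T) * (m0 ^+ 4 + T * (40 * mx_l1 alpha ^+ 4 + 388 * mx_l1 sigma ^+ 4)).
have e4 k : Ex (fun w => Y k w ^+ 4) <= C.
  have := scheme_pow4_le hX hB hXB m0 (h0 k) alA gmG sgS (2 ^ (k + K)) (TK k).
  by rewrite natrX [_ * (T / _)]mulrC divfK ?expf_neq0// pnatr_eq0.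
have [mM _ _] := hM.
have mMT : measurable_fun [set: Omega] (M T) by exact: mM (ltW T0).
have Ycvg : {ae P, forall w, Y k w @[k --> \oo] --> M T w}.
  apply: filterS (scheme_ae_cvg hX hB hXB T0 hM) => w Nw; move: Nw; rewrite -(cvg_shiftn K); exact.
have Y2cvg : {ae P, forall w, Y k w ^+ 2 @[k --> \oo] --> M T w ^+ 2}.
  by apply: filterS Ycvg => w Yw; rewrite expr2; under eq_fun do rewrite expr2; exact: cvgM.
have sq4 (x : R) : x ^+ 4 = (x ^+ 2) ^+ 2 by rewrite -exprM.
(* Applied to the squares of the scheme, whose second moments are its fourth moments; the conclusion
   kept is that M(T)^4 is integrable. *)
have [|||||l4M _ _] := @Ex_cvg_sq_bounded _ _ _ P (fun k w => Y k w ^+ 2) (fun w => M T w ^+ 2) C.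
- by move=> n; apply: measurable_funX.
- by apply: measurable_funX.
- by move=> n; under eq_fun do rewrite -sq4.
- by move=> n; under eq_Ex do rewrite -sq4.
- exact: Y2cvg.
split; first by under eq_fun do rewrite sq4.
have sub (F : nat -> R) (l : R) : F n @[n --> \oo] --> l ->
    F (2 ^ (k + K)).-1 @[k --> \oo] --> l.
  move=> Fl; apply: (cvg_comp (fun k => (2 ^ (k + K)).-1) F) Fl.
  move=> A [m _ mA]; exists m => // k /= mk; apply: mA => /=.
  rewrite -ltnS prednK ?expn_gt0//; apply: (leq_trans (ltn_expl m (ltnSn 1))).
  by rewrite leq_exp2l// (leq_trans mk)// leq_addr.
have NE k : N (T / ((2 ^ (k + K)).-1.+1)%:R) (2 ^ (k + K)).-1.+1 = Y k.
  by rewrite prednK ?expn_gt0// natrX.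
move=> j.
have [c1 c2] := scheme_system T0 lim j.
have {c1} := sub _ _ c1; have {c2} := sub _ _ c2.
under eq_fun do rewrite NE; move=> c2; under eq_fun do rewrite NE; move=> c1.
have mi : measurable_fun [set: Omega] (ind X T j) by exact: (@ind_measurable _ _ _ _ _ _ _ hX _ j (ltW T0)).
have i1 w : 0 <= ind X T j w <= 1 by rewrite /ind; case: (_ == _); rewrite ?lexx ler01.
have lb k : L1 (fun w => 1 + Y k w ^+ 4) by apply: L1D => //; exact: L1_cst.
have eb k : Ex (fun w => 1 + Y k w ^+ 4) <= 1 + C.
  by rewrite ExD// ?Ex_cst ?lerD2l//; exact: L1_cst.
have b1 k w : (ind X T j w * Y k w) ^+ 2 <= 1 + Y k w ^+ 4.
  have /andP[i0 i1'] := i1 w; rewrite exprMn sq4.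
  have ii : ind X T j w ^+ 2 <= 1 by rewrite expr_le1.
  have := ler_wpM2r (sqr_ge0 (Y k w)) ii; have := sqr_ge0 (Y k w ^+ 2 - 1).
  have := sqr_ge0 (Y k w); nra.
have b2 k w : (ind X T j w * Y k w ^+ 2) ^+ 2 <= 1 + Y k w ^+ 4.
  have /andP[i0 i1'] := i1 w; rewrite exprMn -sq4.
  have ii : ind X T j w ^+ 2 <= 1 by rewrite expr_le1.
  by have := ler_wpM2r (pow4_ge0 (Y k w)) ii; lra.
have m1 k : measurable_fun [set: Omega] (fun w => ind X T j w * Y k w) by apply: measurable_funM.
have m2 k : measurable_fun [set: Omega] (fun w => ind X T j w * Y k w ^+ 2).
  by apply: measurable_funM => //; apply: measurable_funX.
have l1 k : L1 (fun w => (ind X T j w * Y k w) ^+ 2).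
  apply: L1_le (lb k); first exact: measurable_funX.
  by move=> w; rewrite ger0_norm ?sqr_ge0.
have l2 k : L1 (fun w => (ind X T j w * Y k w ^+ 2) ^+ 2).
  apply: L1_le (lb k); first exact: measurable_funX.
  by move=> w; rewrite ger0_norm ?sqr_ge0.
split.
- have [|||||_ _ c] := @Ex_cvg_sq_bounded _ _ _ P (fun k w => ind X T j w * Y k w) (fun w => ind X T j w * M T w) (1 + C) => //.
  + exact: measurable_funM.
  + by move=> k; apply: le_trans (eb k); apply: Ex_le => //; exact: b1.
  + by apply: filterS Ycvg => w Yw; apply: cvgM => //; exact: cvg_cst.
  exact: (cvg_unique _ c c1).
- have [|||||_ _ c] := @Ex_cvg_sq_bounded _ _ _ P (fun k w => ind X T j w * Y k w ^+ 2) (fun w => ind X T j w * M T w ^+ 2) (1 + C) => //.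
  + by apply: measurable_funM => //; apply: measurable_funX.
  + by move=> k; apply: le_trans (eb k); apply: Ex_le => //; exact: b2.
  + by apply: filterS Y2cvg => w Yw; apply: cvgM => //; exact: cvg_cst.
  exact: (cvg_unique _ c c2).
Qed.

End MomentLimits.

Lemma Lfun2_sqr_integrable {disp : measure_display} {Omega : measurableType disp} {R : realType}
  (P : probability Omega R) (f : Omega -> R) :
  measurable_fun [set: Omega] f -> L1 P (fun w => f w ^+ 2) -> f \in Lfun P 2%:E.
Proof.
move=> mf lf; rewrite inE; apply/andP; split; first by rewrite inE.
rewrite inE /= /finite_norm unlock /=; apply: poweR_lty.
under eq_integral => w _ do rewrite powR_mulrn// real_normK ?num_real//.
by rewrite EFin_Ex// ltry.
Qed.

Section InitialValue.
Context {disp : measure_display} {Omega : measurableType disp} {R : realType}.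
Variables (P : probability Omega R) (d : nat) (Q : 'M[R]_d) (X : R -> Omega -> 'I_d).
Variables (B M : R -> Omega -> R).
Hypothesis hX : is_markov_chain P Q X.
Hypothesis hB : is_brownian P B.
Hypothesis hXB : independent_of P X B.
Variables (alpha gamma sigma : 'cV[R]_d) (m0 : R).
Hypothesis hM : is_MMOU P alpha gamma sigma m0 X B M.

(** At time 0 the definition still contains an Ito integral. The approximation result with an empty
    grid of mesh 0 bounds its second moment by 0. *)
Lemma MMOU_initial : {ae P, forall w, M 0 w = m0}.
Proof.
have [_ _ /(_ 0 (lexx 0))[J [iJ MJ]]] := hM.
have [mJ _] := iJ.
have sgS i : `|sigma i 0| <= mx_l1 sigma by exact: mx_l1_entry.
have iJ0 : is_ito_integral P (history X B) B (fun s w => sigma (X s w) 0) (0%:R * 0) J by rewrite mul0r.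
have [] := ito_riem_close hX hB hXB sgS (lexx 0) iJ0.
rewrite mul0r mulr0.
have r0 w : riem_ito X B (fun i => sigma i 0) 0 0 w = 0 by rewrite /riem_ito big_ord0.
under eq_fun do rewrite r0 subr0.
move=> lJ eJ.
have eJ0 : Ex P (fun w => J w ^+ 2) = 0.
  by apply/eqP; rewrite eq_le eJ Ex_ge0// => w; exact: sqr_ge0.
have mJ2 : measurable_fun [set: Omega] (fun w => (J w ^+ 2)%:E).
  by apply/measurable_EFinP; exact: measurable_funX.
have /ae_eq_integral_abs : (\int[P]_w `|(J w ^+ 2)%:E| = 0)%E.
  under eq_integral => w _ do rewrite gee0_abs ?lee_fin ?sqr_ge0//.
  by rewrite EFin_Ex// eJ0.
move=> /(_ measurableT mJ2) J0.
apply: filterS2 MJ J0 => w -> /(_ I) [] /eqP; rewrite sqrf_eq0 => /eqP ->.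
by rewrite addr0 set_itv1 Rintegral_set1 addr0.
Qed.

End InitialValue.

(** * Explicit formulas and limits for M *)

Section Assembly.
Context {disp : measure_display} {Omega : measurableType disp} {R : realType}.
Variables (P : probability Omega R) (d : nat) (Q : 'M[R]_d) (X : R -> Omega -> 'I_d).
Variables (B M : R -> Omega -> R).
Local Notation L1 := (L1 P).
Local Notation Ex := (Ex P).
Hypothesis hX : is_markov_chain P Q X.
Hypothesis hB : is_brownian P B.
Hypothesis hXB : independent_of P X B.
Variables (alpha gamma sigma : 'cV[R]_d) (m0 : R).
Hypothesis hM : is_MMOU P alpha gamma sigma m0 X B M.

Lemma transientE t i : transient P X t i 0 = Ex (ind X t i).
Proof. by rewrite /transient vexpectE; apply: eq_Ex => w; rewrite mxE. Qed.

Lemma nuE t i : nu P X M t i 0 = Ex (fun w => ind X t i w * M t w).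
Proof. by rewrite /nu vexpectE; apply: eq_Ex => w; rewrite !mxE mulrC. Qed.

Lemma wvecE t i : wvec P X M t i 0 = Ex (fun w => ind X t i w * M t w ^+ 2).
Proof. by rewrite /wvec vexpectE; apply: eq_Ex => w; rewrite !mxE mulrC. Qed.

Lemma transient_mexp (t : R) : 0 <= t -> transient P X t = mexp (t *: Q^T) *m transient P X 0.
Proof.
move=> t0; have -> : transient P X 0 = law0 P X.
  by apply/matrixP => i j; rewrite (ord1 j) transientE mxE.
by apply/matrixP => i j; rewrite (ord1 j) transientE (Ex_ind_mexp hX).
Qed.

Lemma transient_ge0 t i : 0 <= transient P X t i 0.
Proof. by rewrite transientE; apply: Ex_ge0 => w; exact: ind_ge0. Qed.

Lemma transient_sum1 (t : R) : 0 <= t -> ones_dot (transient P X t) = 1.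
Proof.
move=> t0; rewrite ones_dotE; under eq_bigr do rewrite transientE.
rewrite -Ex_sum; last by move=> i; exact: (ind_L1 hX i t0).
by under eq_Ex do rewrite sum_ind; rewrite Ex_cst.
Qed.

(** The scheme covers positive times only; time 0 comes from the initial value, known almost
    surely. *)
Lemma MMOU_moment_odes : exists nut wt : R -> 'cV[R]_d,
  [/\ nut 0 = m0 *: transient P X 0, wt 0 = m0 ^+ 2 *: transient P X 0,
   forall t, mx_derive nut t
     (Qbar Q gamma *m nut t + diagc alpha *m (mexp (t *: Q^T) *m transient P X 0)),
   forall t, mx_derive wt t (Qbar Q (2 *: gamma) *m wt t
     + (2 *: (diagc alpha *m nut t) + diagc (sqvec sigma) *m (mexp (t *: Q^T) *m transient P X 0))) &
   forall t : R, 0 <= t -> [/\ L1 (fun w => M t w ^+ 4), nu P X M t = nut t & wvec P X M t = wt t]].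
Proof.
have p0 : transient P X 0 = law0 P X by apply/matrixP => i j; rewrite (ord1 j) transientE mxE.
have [nut [wt [nut0 wt0 dnu dw mom]]] := MMOU_moments hX hB hXB hM.
exists nut, wt; rewrite p0; split => // t; rewrite le_eqVlt => /predU1P[<-|/mom[l4 e]]; last first.
  by split => //; apply/matrixP => i j; rewrite (ord1 j) ?nuE ?wvecE; have [e1 e2] := e i.
have M0 := MMOU_initial hX hB hXB hM.
have [mM _ _] := hM; have {}mM := mM 0 (lexx 0).
have mi i : measurable_fun [set: Omega] (ind X 0 i) by exact: (@ind_measurable _ _ _ _ _ _ _ hX _ i (lexx 0)).
have li i : L1 (ind X 0 i) by exact: (ind_L1 hX i (lexx 0)).
split.
- apply: (L1_ae_eq _ _ (L1_cst P (m0 ^+ 4))); first exact: measurable_funX.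
  by apply: filterS M0 => w ->.
- rewrite nut0; apply/matrixP => i j; rewrite (ord1 j) nuE !mxE -ExZ//.
  apply: Ex_ae_eq; [exact: measurable_funM|by apply: measurable_funM => //; exact: measurable_cst|].
  by apply: filterS M0 => w ->; rewrite mulrC.
- rewrite wt0; apply/matrixP => i j; rewrite (ord1 j) wvecE !mxE -ExZ//.
  apply: Ex_ae_eq.
  + by apply: measurable_funM => //; exact: measurable_funX.
  + by apply: measurable_funM => //; exact: measurable_cst.
  + by apply: filterS M0 => w ->; rewrite mulrC.
Qed.

Lemma MMOU_pow4 (t : R) : 0 <= t -> L1 (fun w => M t w ^+ 4).
Proof. by move=> t0; have [? [? [_ _ _ _ /(_ t t0)[]]]] := MMOU_moment_odes. Qed.

Lemma MMOU_measurable (t : R) : 0 <= t -> measurable_fun [set: Omega] (M t).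
Proof. by have [mM _ _] := hM; exact: mM. Qed.

Lemma MMOU_Lfun2 (t : R) : 0 <= t -> M t \in Lfun P 2%:E.
Proof.
move=> t0; have mt := MMOU_measurable t0.
by apply: Lfun2_sqr_integrable => //; have [] := L1_pow4 mt (MMOU_pow4 t0).
Qed.

Let Ex_sum_ind (t : R) (Y : Omega -> R) : 0 <= t -> L1 Y ->
  Ex Y = \sum_i Ex (fun w => ind X t i w * Y w).
Proof.
move=> t0 lY; rewrite -Ex_sum; last first.
  move=> i; apply: (L1_boundedM (@ind_measurable _ _ _ _ _ _ _ hX _ i t0) (ind_norm X t i) lY).
by apply: eq_Ex => w; rewrite -mulr_suml sum_ind mul1r.
Qed.

Lemma MMOU_mean (t : R) : 0 <= t -> 'E_P[M t]%E = (ones_dot (nu P X M t))%:E.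
Proof.
move=> t0; have mt := MMOU_measurable t0; have [l1 _ _] := L1_pow4 mt (MMOU_pow4 t0).
rewrite ExpectationE// ones_dotE (Ex_sum_ind t0 l1); congr (_%:E).
by apply: eq_bigr => i _; rewrite nuE.
Qed.

Lemma MMOU_variance (t : R) : 0 <= t ->
  'V_P[M t]%E = (ones_dot (wvec P X M t) - ones_dot (nu P X M t) ^+ 2)%:E.
Proof.
move=> t0; have mt := MMOU_measurable t0; have [_ l2 _] := L1_pow4 mt (MMOU_pow4 t0).
rewrite varianceE ?MMOU_Lfun2// MMOU_mean// EFinB EFin_expe; congr (_ - _)%E.
have -> : (M t ^+ 2)%R = (fun w => M t w ^+ 2) by apply/funext => w; rewrite fctE.
rewrite ExpectationE// ones_dotE (Ex_sum_ind t0 l2); congr (_%:E).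
by apply: eq_bigr => i _; rewrite wvecE.
Qed.

Lemma nu_initial : nu P X M 0 = m0 *: transient P X 0.
Proof. by have [nut [? [<- _ _ _ /(_ 0 (lexx 0))[]]]] := MMOU_moment_odes. Qed.

Lemma wvec_initial : wvec P X M 0 = m0 ^+ 2 *: transient P X 0.
Proof. by have [? [? [_ <- _ _ /(_ 0 (lexx 0))[]]]] := MMOU_moment_odes. Qed.

Let diagc_continuous (v : 'cV[R]_d) (f : R -> 'cV[R]_d) :
  (forall i, continuous (fun s => f s i 0)) -> forall i, continuous (fun s => (diagc v *m f s) i 0).
Proof.
move=> cf i s; under eq_fun do rewrite diagc_mulE.
by apply: cvgM; [exact: cvg_cst|exact: cf].
Qed.

Lemma nu_duhamel (t : R) : 0 <= t ->
  nu P X M t = mexp (t *: Qbar Q gamma) *m nu P X M 0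
    + vint t (fun s => mexp ((t - s) *: Qbar Q gamma) *m (diagc alpha *m transient P X s)).
Proof.
move=> t0; have [nut [wt [_ _ dnu _ mom]]] := MMOU_moment_odes.
have [[_ -> _] [_ -> _]] := (mom t t0, mom 0 (lexx 0)).
rewrite (duhamel t0 dnu); last by apply: diagc_continuous => i; exact: mexp_continuous.
by congr (_ + _); apply: eq_vint => s s0; rewrite -transient_mexp.
Qed.

Lemma wvec_duhamel (t : R) : 0 <= t ->
  wvec P X M t = mexp (t *: Qbar Q (2 *: gamma)) *m wvec P X M 0
    + vint t (fun s => mexp ((t - s) *: Qbar Q (2 *: gamma))
        *m (2 *: (diagc alpha *m nu P X M s) + diagc (sqvec sigma) *m transient P X s)).
Proof.
move=> t0; have [nut [wt [_ _ dnu dw mom]]] := MMOU_moment_odes.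
have [[_ _ ->] [_ _ ->]] := (mom t t0, mom 0 (lexx 0)).
have cnu i : continuous (fun s => nut s i 0) by exact: (mx_derive_continuous dnu).
rewrite (duhamel t0 dw); last first.
  move=> i s; under eq_fun do rewrite mxE [X in X + _]mxE.
  apply: cvgD; last by apply: diagc_continuous => j; exact: mexp_continuous.
  by apply: cvgM; [exact: cvg_cst|exact: diagc_continuous].
congr (_ + _); apply: eq_vint => s s0; rewrite -transient_mexp//.
by have [_ -> _] := mom s s0.
Qed.

(** Since Q^T pi = 0, the law of the chain stays equal to [pi]; the source in Duhamel's formula is
    then constant and integrates explicitly. *)
Lemma nu_stationary pi (t : R) : Q^T *m pi = 0 -> Qbar Q gamma \in unitmx ->
  transient P X 0 = pi -> 0 <= t ->
  nu P X M t = mexp (t *: Qbar Q gamma) *m nu P X M 0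
    - invmx (Qbar Q gamma) *m ((1%:M - mexp (t *: Qbar Q gamma)) *m (diagc alpha *m pi)).
Proof.
move=> Qpi uQ p0 t0; rewrite nu_duhamel//; congr (_ + _).
rewrite -vint_mexp_cst//; apply: eq_vint => s s0.
by rewrite transient_mexp// p0 (mexp_mul_kernel s Qpi).
Qed.

Hypothesis gamma0 : forall i, 0 < gamma i 0.
Variable pi : 'cV[R]_d.
Hypothesis hpi : is_unique_invariant Q pi.

Let hQ : is_generator Q. Proof. by case: hX. Qed.

Let gamma20 i : 0 < (2 *: gamma) i 0. Proof. by rewrite mxE mulr_gt0. Qed.

(** The limits are found in cascade along the triangular system: that of p feeds the equation of nu,
    and both feed that of w. The solutions [nut] and [wt] agree with the moments for t >= 0, which
    suffices at infinity. *)
Lemma moments_cvg :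
  (nu P X M t @[t --> +oo] --> nu_lim Q alpha gamma pi) /\
  (wvec P X M t @[t --> +oo] --> w_lim Q alpha gamma sigma pi).
Proof.
have [nut [wt [_ _ dnu dw mom]]] := MMOU_moment_odes.
have pcvg : mexp (t *: Q^T) *m transient P X 0 @[t --> +oo] --> pi.
  apply: transient_cvg => // t t0; rewrite -transient_mexp//.
    by move=> i; exact: transient_ge0.
  exact: transient_sum1.
have nucvg : nut t @[t --> +oo] --> nu_lim Q alpha gamma pi.
  by apply: (Qbar_ode_cvg hQ gamma0 dnu); exact: cvg_diagc.
have wcvg : wt t @[t --> +oo] --> w_lim Q alpha gamma sigma pi.
  apply: (Qbar_ode_cvg hQ gamma20 dw); apply: cvgD; last exact: cvg_diagc.
  by apply: cvgZ; [exact: cvg_cst|exact: cvg_diagc].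
split.
  apply: cvg_trans nucvg; apply: near_eq_cvg; near=> t.
  by have [|_ -> _] := mom t; first by near: t; exact: nbhs_pinfty_ge.
apply: cvg_trans wcvg; apply: near_eq_cvg; near=> t.
by have [|_ _ ->] := mom t; first by near: t; exact: nbhs_pinfty_ge.
Unshelve. all: by end_near.
Qed.

Lemma mean_cvg : 'E_P[M t]%E @[t --> +oo] --> (ones_dot (nu_lim Q alpha gamma pi))%:E.
Proof.
have c : (ones_dot (nu P X M t))%:E @[t --> +oo] --> (ones_dot (nu_lim Q alpha gamma pi))%:E.
  by apply: cvg_EFin; [exact: nearW|apply: cvg_ones_dot; exact: moments_cvg.1].
apply: cvg_trans c; apply: near_eq_cvg; near=> t.
by rewrite MMOU_mean//; near: t; exact: nbhs_pinfty_ge.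
Unshelve. all: by end_near.
Qed.

Lemma variance_cvg : 'V_P[M t]%E @[t --> +oo] -->
  (ones_dot (w_lim Q alpha gamma sigma pi) - ones_dot (nu_lim Q alpha gamma pi) ^+ 2)%:E.
Proof.
have [nc wc] := moments_cvg.
have c : (ones_dot (wvec P X M t) - ones_dot (nu P X M t) ^+ 2)%:E @[t --> +oo] -->
    (ones_dot (w_lim Q alpha gamma sigma pi) - ones_dot (nu_lim Q alpha gamma pi) ^+ 2)%:E.
  apply: cvg_EFin; first exact: nearW.
  apply: cvgB; first exact: cvg_ones_dot.
  by under eq_fun do rewrite expr2; rewrite expr2; apply: cvgM; exact: cvg_ones_dot.
apply: cvg_trans c; apply: near_eq_cvg; near=> t.
by rewrite MMOU_variance//; near: t; exact: nbhs_pinfty_ge.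
Unshelve. all: by end_near.
Qed.

End Assembly.

Theorem mainTheorem6 (R : realType) (disp : measure_display)
    (Omega : measurableType disp) (P : probability Omega R)
    (d : nat) (Q : 'M[R]_d) (pi alpha gamma sigma : 'cV[R]_d) (m0 : R)
    (X : R -> Omega -> 'I_d) (B M : R -> Omega -> R)
    (hX : is_markov_chain P Q X)
    (hpi : is_unique_invariant Q pi)
    (hB : is_brownian P B)
    (hXB : independent_of P X B)
    (hgamma : forall i, 0 < gamma i 0)
    (hM : is_MMOU P alpha gamma sigma m0 X B M) :
  (forall t, 0 <= t -> M t \in Lfun P 2%:E) /\
  (forall t, 0 <= t ->
    nu P X M t =
      mexp (t *: Qbar Q gamma) *m nu P X M 0
      + vint t (fun s => mexp ((t - s) *: Qbar Q gamma)
                         *m (diagc alpha *m transient P X s))) /\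
  nu P X M 0 = m0 *: transient P X 0 /\
  (forall t, 0 <= t ->
    wvec P X M t =
      mexp (t *: Qbar Q (2 *: gamma)) *m wvec P X M 0
      + vint t (fun s => mexp ((t - s) *: Qbar Q (2 *: gamma))
                         *m (2 *: (diagc alpha *m nu P X M s)
                             + diagc (sqvec sigma) *m transient P X s))) /\
  wvec P X M 0 = m0 ^+ 2 *: transient P X 0 /\
  (forall t, 0 <= t -> 'E_P[M t]%E = (ones_dot (nu P X M t))%:E) /\
  (forall t, 0 <= t ->
    'V_P[M t]%E = (ones_dot (wvec P X M t) - ones_dot (nu P X M t) ^+ 2)%:E) /\
  Qbar Q gamma \in unitmx /\
  Qbar Q (2 *: gamma) \in unitmx /\
  (transient P X 0 = pi -> forall t, 0 <= t ->
    nu P X M t =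
      mexp (t *: Qbar Q gamma) *m nu P X M 0
      - invmx (Qbar Q gamma)
        *m ((1%:M - mexp (t *: Qbar Q gamma)) *m (diagc alpha *m pi))) /\
  (nu P X M t @[t --> +oo] --> nu_lim Q alpha gamma pi) /\
  (wvec P X M t @[t --> +oo] --> w_lim Q alpha gamma sigma pi) /\
  ('E_P[M t]%E @[t --> +oo] --> (ones_dot (nu_lim Q alpha gamma pi))%:E) /\
  ('V_P[M t]%E @[t --> +oo] -->
    (ones_dot (w_lim Q alpha gamma sigma pi)
     - ones_dot (nu_lim Q alpha gamma pi) ^+ 2)%:E).
Proof.
have hQ : is_generator Q by case: hX.
have uQ : Qbar Q gamma \in unitmx by exact: Qbar_unitmx.
have uQ2 : Qbar Q (2 *: gamma) \in unitmx.
  by apply: Qbar_unitmx => // i; rewrite mxE mulr_gt0.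
have [[_ _ Qpi] _] := hpi.
have [nuc wc] := moments_cvg hX hB hXB hM hgamma hpi.
do 13?split => //.
- by move=> t; exact: (MMOU_Lfun2 hX hB hXB hM).
- by move=> t; exact: (nu_duhamel hX hB hXB hM).
- exact: (nu_initial hX hB hXB hM).
- by move=> t; exact: (wvec_duhamel hX hB hXB hM).
- exact: (wvec_initial hX hB hXB hM).
- by move=> t; exact: (MMOU_mean hX hB hXB hM).
- by move=> t; exact: (MMOU_variance hX hB hXB hM).
- by move=> p0 t; exact: (nu_stationary hX hB hXB hM Qpi uQ p0).
- exact: (mean_cvg hX hB hXB hM hgamma hpi).
- exact: (variance_cvg hX hB hXB hM hgamma hpi).
Qed.
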